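(* For every non-empty index $\mathbf k$, \[\sum_{m,n=0}^{\infty}\zeta^{s,t,\star}_{\widehat{\mathcal{RS}}}(\{1\}^m,\mathbf k,\{1\}^n)\,s^mt^n=-\sum_{m,n=0}^{\infty}\overline{\zeta^{s,t,\star}_{\widehat{\mathcal{RS}}}(\{1\}^m,\mathbf k^{\vee},\{1\}^n)}\,s^mt^n,\] where the bar denotes complex conjugation applied coefficientwise in $\mathbb C[[s,t]]$.
   Context: $s,t$ are commuting indeterminates. An index is a finite tuple $\mathbf{k}=(k_1,\dots,k_r)$ of positive integers ($r\ge0$), with $\mathrm{dep}(\mathbf k)=r$, $\mathrm{wt}(\mathbf k)=\sum k_i$; $\{1\}^m$ is $1$ repeated $m$ times; commas denote concatenation. Admissible indices (empty or $k_r\ge2$) have $\zeta(\mathbf k)=\sum_{0<n_1<\cdots<n_r}n_1^{-k_1}\cdots n_r^{-k_r}$. Words: $\mathfrak H=\mathbb Q\langle e_0,e_1\rangle$, $e_{\mathbf{k}}=e_1e_0^{k_1-1}\cdots e_1e_0^{k_r-1}$; for non-empty $\mathbf k$, $\omega(\mathbf k)\in\mathfrak H$ is defined by $e_1\omega(\mathbf k)=e_{\mathbf k}$. $Z^{ш}:(\mathfrak H,ш)\to\mathbb R$ is the unique shuffle-algebra homomorphism with $Z^{ш}(e_{\mathbf k})=(-1)^{\mathrm{dep}(\mathbf k)}\zeta(\mathbf k)$ for admissible $\mathbf k$ and $Z^{ш}(e_0)=Z^{ш}(e_1)=0$ (shuffle regularization). KZ associator: $\Phi_{\mathrm{KZ}}(X_0,X_1)=\sum_{n\ge0}\sum_{a_1,\dots,a_n\in\{0,1\}}Z^{ш}(e_{a_1}\cdots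 e_{a_n})X_{a_n}\cdots X_{a_1}\in\mathbb C\langle\langle X_0,X_1\rangle\rangle$; $\Phi_{\mathrm{KZ}}(A,B)$ denotes substitution $X_0\mapsto A$, $X_1\mapsto B$. Put $\Phi_{\mathcal{RS}}(X_0,X_1)=\exp(\pi iX_0/2)\Phi_{\mathrm{KZ}}(X_1,X_0)\exp(2\pi iX_1)\Phi_{\mathrm{KZ}}(X_0,X_1)\exp(\pi iX_0/2)$. Pairing: for $\Phi=\sum_W c_WW$ (sum over words $W$ in $X_0,X_1$), $\langle\Phi,e_{a_1}\cdots e_{a_n}\rangle$ is the coefficient $c_{X_{a_1}\cdots X_{a_n}}$, extended linearly in the second argument and coefficientwise to $\mathfrak H[[s,t]]$. Refined values: for non-empty $\mathbf k$, $\zeta^{s,t}_{\widehat{\mathcal{RS}}}(\mathbf k)=\frac{(-1)^{\mathrm{wt}(\mathbf k)+\mathrm{dep}(\mathbf k)}}{2\pi i}\bigl\langle\Phi_{\mathcal{RS}}(X_0,X_1),\ (1+e_0s)^{-1}e_1\omega(\mathbf k)e_1(1+e_0t)^{-1}\bigr\rangle\in\mathbb C[[s,t]]$, and $\zeta^{s,t}_{\widehat{\mathcal{RS}}}(\varnothing)=\exp(-(s+t)\pi i/2)$. Star values: $\mathbf l\preceq\mathbf k$ if $\mathbf l$ is obtained from $(k_1\circ\cdots\circ k_r)$ by replacing each $\circ$ by a comma or a plus sign; $\zeta^{s,t,\star}_{\widehat{\mathcal{RS}}}(\mathbf k)=\sum_{\mathbf l\preceq\mathbf k}\zeta^{s,t}_{\widehat{\mathcal{RS}}}(\mathbf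 l)$. Dual index: writing non-empty $\mathbf k=(1+\cdots+1,\dots,1+\cdots+1)$ with $k_i$ ones in block $i$, $\mathbf k^\vee$ is obtained by interchanging commas and plus signs. *)

(* Defs.v *)
From Stdlib Require Import Reals List Lia.
From Coquelicot Require Import Coquelicot.
Import ListNotations.

Open Scope R_scope.

Fixpoint rsum (l : list R) : R := match l with nil => 0 | x :: l' => x + rsum l' end.
Fixpoint csum (l : list C) : C :=
  match l with nil => RtoC 0 | x :: l' => Cplus x (csum l') end.

Definition is_index (k : list nat) : Prop := List.Forall (fun x => (1 <= x)%nat) k.
Definition wt (k : list nat) : nat := fold_right Nat.add 0%nat k.
Definition dep (k : list nat) : nat := length k.
Definition admissible (k : list nat) : Prop := k = nil \/ (2 <= last k 0)%nat.

Fixpoint mzv_partial (k : list nat) (a N : nat) : R :=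
  match k with
  | nil => 1
  | k1 :: k' =>
      rsum (map (fun n => / (INR n ^ k1) * mzv_partial k' n N)
                (seq (S a) (N - S a)))
  end.
Definition zeta (k : list nat) : R := real (Lim_seq (fun N => mzv_partial k 0 N)).

(* ---------- words in e0, e1 (false = e0, true = e1) ---------- *)
Definition word := list bool.

Fixpoint ek (k : list nat) : word :=
  match k with
  | nil => nil
  | k1 :: k' => true :: repeat false (k1 - 1) ++ ek k'
  end.
Definition omega (k : list nat) : word := tl (ek k).

Fixpoint shuffle (u v : word) {struct u} : list word :=
  match u with
  | nil => v :: nil
  | a :: u' =>
    (fix shv (v : word) : list word :=
       match v with
       | nil => (a :: u') :: nil
       | b :: v' => map (cons a) (shuffle u' (b :: v')) ++ map (cons b) (shv v')
       end) v
  end.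

(* Z : word -> C (extended linearly to H) is the shuffle-regularized MZV map:
   the unique shuffle-algebra homomorphism with Z(e_k) = (-1)^dep zeta(k) for
   admissible k and Z(e0) = Z(e1) = 0. *)
Definition Zsh_spec (Z : word -> C) : Prop :=
  Z nil = RtoC 1 /\
  (forall u v : word, csum (map Z (shuffle u v)) = Cmult (Z u) (Z v)) /\
  (forall k, is_index k -> admissible k ->
      Z (ek k) = RtoC ((-1) ^ dep k * zeta k)) /\
  Z [false] = RtoC 0 /\ Z [true] = RtoC 0.

(* A series is its coefficient function on words in X0 (false), X1 (true),
   read left to right. *)
Definition ncs := word -> C.

Definition ncmul (F G : ncs) : ncs := fun w =>
  csum (map (fun i => Cmult (F (firstn i w)) (G (skipn i w))) (seq 0 (S (length w)))).

Definition ncexp (b : bool) (c : C) : ncs := fun w =>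
  if forallb (fun x => Bool.eqb x b) w
  then Cdiv (Cpow c (length w)) (RtoC (INR (Factorial.fact (length w))))
  else RtoC 0.

(* Phi_KZ(X0,X1) = sum_w Z(e_{a1}...e_{an}) X_{an}...X_{a1} *)
Definition PhiKZ (Z : word -> C) : ncs := fun w => Z (rev w).
Definition PhiKZ_swap (Z : word -> C) : ncs := fun w => PhiKZ Z (map negb w).

Definition piC : C := RtoC PI.

Definition PhiRS (Z : word -> C) : ncs :=
  ncmul (ncexp false (Cdiv (Cmult piC Ci) (RtoC 2)))
   (ncmul (PhiKZ_swap Z)
    (ncmul (ncexp true (Cmult (RtoC 2) (Cmult piC Ci)))
     (ncmul (PhiKZ Z) (ncexp false (Cdiv (Cmult piC Ci) (RtoC 2)))))).

(* ---------- power series in s, t : coefficient of s^m t^n ---------- *)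
Definition ps2 := nat -> nat -> C.

Definition zRS (Z : word -> C) (k : list nat) : ps2 := fun m n =>
  match k with
  | nil =>
      (* exp(-(s+t) pi i / 2) *)
      Cdiv (Cpow (Cdiv (Copp (Cmult piC Ci)) (RtoC 2)) (m + n))
           (RtoC (INR (Factorial.fact m) * INR (Factorial.fact n)))
  | _ =>
      (* (-1)^{wt+dep}/(2 pi i) < Phi_RS, (1+e0 s)^{-1} e1 omega(k) e1 (1+e0 t)^{-1} > *)
      Cmult (Cdiv (Cpow (RtoC (-1)) (wt k + dep k)) (Cmult (RtoC 2) (Cmult piC Ci)))
        (Cmult (Cpow (RtoC (-1)) (m + n))
           (PhiRS Z (repeat false m ++ [true] ++ omega k ++ [true] ++ repeat false n)))
  end.

Fixpoint coarsenings (k : list nat) : list (list nat) :=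
  match k with
  | nil => nil :: nil
  | k1 :: r =>
    match r with
    | nil => (k1 :: nil) :: nil
    | _ => flat_map (fun l => match l with
                              | nil => nil
                              | l1 :: l' => (k1 :: l) :: ((k1 + l1)%nat :: l') :: nil
                              end) (coarsenings r)
    end
  end.

Definition zRS_star (Z : word -> C) (k : list nat) : ps2 := fun m n =>
  csum (map (fun l => zRS Z l m n) (coarsenings k)).

(* separators between the wt(k) ones: true = comma, false = plus *)
Fixpoint seps (k : list nat) : list bool :=
  match k with
  | nil => nil
  | k1 :: r => repeat false (k1 - 1) ++ match r with nil => nil | _ => true :: seps r end
  end.
Fixpoint build (c : nat) (s : list bool) : list nat :=
  match s with
  | nil => c :: nil
  | false :: s' => build (S c) s'
  | true :: s' => c :: build 1 s'
  end.
Definition dual (k : list nat) : list nat := build 1 (map negb (seps k)).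

(* coefficient extraction: sum_{m,n} f m n s^m t^n, with f m n in C[[s,t]] *)
Definition gen2 (f : nat -> nat -> ps2) : ps2 := fun a b =>
  csum (flat_map (fun m => map (fun n => f m n (a - m)%nat (b - n)%nat) (seq 0 (S b)))
                 (seq 0 (S a))).

Definition conj2 (F : ps2) : ps2 := fun m n => Cconj (F m n).
Definition opp2 (F : ps2) : ps2 := fun m n => Copp (F m n).

(* Main.v *)
(* Let L(u) u^X0 be the solution of dG/du = (X0/u + X1/(u-1)) G normalized at 0. As e = 1 - u
   tends to 0, J = e^(-X1) G(1 - e) is group-like and converges on admissible words to multiple
   zeta values, so shuffle regularization identifies its limit with Phi_KZ(X0, X1).
   With u = 1 - z, the associator Phi_RS is the regularized holonomy of the KZ connection along
   the circle |u| = 1. On this circle z -> z/(z-1) is complex conjugation, and it exchanges the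
   residues X1 and X_infinity = - X0 - X1; hence Phi_RS(X0, X_infinity) is the conjugate of
   Phi_RS(X0, X1). By reality, half of the circle suffices, and it is approached from
   |u| = 1 - e, where the failure of the symmetry is governed by the Poisson kernel.
   Finally, the generating function of star values is the pairing of Phi_RS with words in
   e_1 - e_0 and - e_0, and Hoffman's dual swaps these two letters, which is the transpose of the
   substitution X1 -> X_infinity. *)

Require Import Defs.
From Stdlib Require Import Reals List Lia Lra FunctionalExtensionality.
From Coquelicot Require Import Coquelicot.
Import ListNotations.

Set Bullet Behavior "Strict Subproofs".

Local Open Scope list_scope.
Local Open Scope C_scope.

(** * Non-commutative series *)

(** [Lser] converges only inside the unit disc, while the symmetry is exact only on its boundary;
    hence the work at distance [epsj j] from the boundary and the passage to the limit word by word.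
    The obstacle is that regularizing factors such as exp((j + 1) X_true) have no limit: on a fixed
    word they may grow like a power of ln(1/epsj). Errors are therefore tracked as epsj times a
    power of [lam j], which still tends to 0, and diverging factors have to cancel exactly before a
    limit is taken. The Poisson kernel has mass pi on the half circle however small epsj is, so it
    cannot be estimated away. Its primitive [beta] is put into an exponential [ec], which produces
    exp(-i pi X_true) at angle 0; only a commutator of the size of [kern] remains, with integral of
    order epsj ln(1/epsj). Differential identities are integrated without a uniqueness theorem: a
    quantity is shown to have zero derivative, by induction on words where needed, and is evaluated
    at an end. Integrals are bounded through explicit primitives. *)

Lemma csum_app (l l' : list C) : csum (l ++ l') = csum l + csum l'.
Proof. induction l as [|x l IH]; simpl; [|rewrite IH]; ring. Qed.

Lemma csum_plus {A : Type} (f g : A -> C) (l : list A) :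
  csum (map (fun x => f x + g x) l) = csum (map f l) + csum (map g l).
Proof. induction l as [|x l IH]; simpl; [|rewrite IH]; ring. Qed.

Lemma csum_scal {A : Type} (c : C) (f : A -> C) (l : list A) :
  csum (map (fun x => c * f x) l) = c * csum (map f l).
Proof. induction l as [|x l IH]; simpl; [|rewrite IH]; ring. Qed.

Lemma csum_ext {A : Type} (f g : A -> C) (l : list A) :
  (forall x, In x l -> f x = g x) -> csum (map f l) = csum (map g l).
Proof.
  induction l as [|x l IH]; simpl; intros H; auto.
  rewrite (H x), IH; auto.
Qed.

Definition lsh (a : bool) (F : ncs) : ncs := fun w => F (a :: w).
Definition rsh (a : bool) (F : ncs) : ncs := fun w => F (w ++ [a]).
Definition ncadd (F G : ncs) : ncs := fun w => F w + G w.
Definition ncscal (c : C) (F : ncs) : ncs := fun w => c * F w.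
Definition ncone : ncs := fun w => match w with [] => 1 | _ => 0 end.
Definition nclet (b : bool) : ncs :=
  fun w => match w with [a] => if Bool.eqb a b then 1 else 0 | _ => 0 end.

Declare Scope ncs_scope.
Delimit Scope ncs_scope with S.
Infix "**" := ncmul (at level 40, left associativity) : ncs_scope.
Infix "*:" := ncscal (at level 38, right associativity) : ncs_scope.
Local Open Scope ncs_scope.
Lemma ncmul_nil (F G : ncs) : (F ** G) [] = F [] * G [].
Proof. unfold ncmul; simpl; ring. Qed.

Lemma ncmul_cons (F G : ncs) (a : bool) (w : word) :
  (F ** G) (a :: w) = F [] * G (a :: w) + (lsh a F ** G) w.
Proof.
  unfold ncmul, lsh. cbn [length].
  change (seq 0 (S (S (length w)))) with (0%nat :: seq 1 (S (length w))).
  rewrite <- seq_shift, map_cons, map_map. reflexivity.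
Qed.

(** A twisted Leibniz rule: the first letter is read in [F], or in [G] when the part read in [F] is
    empty. Inductions on words of a product rest on it. *)
Lemma lsh_mul (F G : ncs) (a : bool) :
  lsh a (F ** G) = ncadd (F [] *: lsh a G) (lsh a F ** G).
Proof. apply functional_extensionality; intros w. apply ncmul_cons. Qed.

Lemma ncmul_snoc (F G : ncs) (a : bool) (w : word) :
  (F ** G) (w ++ [a]) = (F ** rsh a G) w + F (w ++ [a]) * G [].
Proof.
  revert F; induction w as [|b w IH]; intros F; cbn [app].
  - rewrite ncmul_cons, !ncmul_nil. reflexivity.
  - rewrite !ncmul_cons, IH. unfold rsh, lsh. cbn [app]. ring.
Qed.

Lemma ncmul_add_l (F F' G : ncs) : ncadd F F' ** G = ncadd (F ** G) (F' ** G).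
Proof.
  apply functional_extensionality; intros w; unfold ncadd, ncmul.
  rewrite <- csum_plus. apply csum_ext; intros; ring.
Qed.

Lemma ncmul_add_r (F G G' : ncs) : F ** ncadd G G' = ncadd (F ** G) (F ** G').
Proof.
  apply functional_extensionality; intros w; unfold ncadd, ncmul.
  rewrite <- csum_plus. apply csum_ext; intros; ring.
Qed.

Lemma ncmul_scal_l (c : C) (F G : ncs) : (c *: F) ** G = c *: (F ** G).
Proof.
  apply functional_extensionality; intros w; unfold ncscal, ncmul.
  rewrite <- csum_scal. apply csum_ext; intros; ring.
Qed.

Lemma ncmul_scal_r (c : C) (F G : ncs) : F ** (c *: G) = c *: (F ** G).
Proof.
  apply functional_extensionality; intros w; unfold ncscal, ncmul.
  rewrite <- csum_scal. apply csum_ext; intros; ring.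
Qed.

Lemma ncmul_assoc (F G H : ncs) : F ** (G ** H) = F ** G ** H.
Proof.
  apply functional_extensionality; intros w; revert F.
  induction w as [|a w IH]; intros F.
  - rewrite !ncmul_nil; ring.
  - rewrite !ncmul_cons, IH, lsh_mul, ncmul_add_l, ncmul_scal_l, ncmul_nil.
    unfold ncadd, ncscal. ring.
Qed.

Lemma ncmul_1_l (F : ncs) : ncone ** F = F.
Proof.
  apply functional_extensionality; intros [|a w].
  - rewrite ncmul_nil; unfold ncone; ring.
  - rewrite ncmul_cons. replace (lsh a ncone) with (0 *: F).
    2:{ apply functional_extensionality; intros v; unfold ncscal, lsh, ncone; ring. }
    rewrite ncmul_scal_l; unfold ncscal, ncone; ring.
Qed.

Lemma ncmul_1_r (F : ncs) : F ** ncone = F.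
Proof.
  apply functional_extensionality; intros w; revert F.
  induction w as [|a w IH]; intros F.
  - rewrite ncmul_nil; unfold ncone; ring.
  - rewrite ncmul_cons, IH; unfold lsh, ncone; ring.
Qed.

Lemma ncmul_let_l (b a : bool) (F : ncs) (w : word) :
  (nclet b ** F) (a :: w) = if Bool.eqb a b then F w else 0.
Proof.
  rewrite ncmul_cons.
  replace (lsh a (nclet b)) with ((if Bool.eqb a b then 1 else 0) *: ncone).
  - rewrite ncmul_scal_l, ncmul_1_l; unfold ncscal, nclet.
    destruct (Bool.eqb a b); ring.
  - apply functional_extensionality; intros [|c v]; unfold ncscal, ncone, lsh, nclet;
      destruct (Bool.eqb a b); ring.
Qed.

Lemma ncmul_let_r (b a : bool) (F : ncs) (w : word) :
  (F ** nclet b) (w ++ [a]) = if Bool.eqb a b then F w else 0.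
Proof.
  rewrite ncmul_snoc.
  replace (rsh a (nclet b)) with ((if Bool.eqb a b then 1 else 0) *: ncone).
  - rewrite ncmul_scal_r, ncmul_1_r; unfold ncscal, nclet.
    destruct (Bool.eqb a b); ring.
  - apply functional_extensionality; intros [|c [|d v]]; unfold ncscal, ncone, rsh, nclet;
      cbn [app]; destruct (Bool.eqb a b); ring.
Qed.

Lemma ncmul_let_l_nil (b : bool) (F : ncs) : (nclet b ** F) [] = 0.
Proof. rewrite ncmul_nil; unfold nclet; ring. Qed.

Lemma ncmul_let_r_nil (b : bool) (F : ncs) : (F ** nclet b) [] = 0.
Proof. rewrite ncmul_nil; unfold nclet; ring. Qed.

Definition expc (c : C) (n : nat) : C := c ^ n / RtoC (INR (Factorial.fact n)).

Lemma fact_C_neq_0 (n : nat) : RtoC (INR (Factorial.fact n)) <> 0.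
Proof. intros H; apply RtoC_inj in H; exact (INR_fact_neq_0 n H). Qed.

Lemma S_C_neq_0 (n : nat) : RtoC (INR (S n)) <> 0.
Proof. intros H; apply RtoC_inj in H. revert H; apply not_0_INR; lia. Qed.

Lemma expc_S (c : C) (n : nat) : RtoC (INR (S n)) * expc c (S n) = c * expc c n.
Proof.
  unfold expc. cbn [Cpow]. rewrite fact_simpl, mult_INR, RtoC_mult.
  field. split; [apply fact_C_neq_0|apply S_C_neq_0].
Qed.

(** The binomial theorem without binomial coefficients: multiplying by n + 1 = i + (n + 1 - i)
    splits the sum in two, and [expc_S] reduces each half to degree n. *)
Lemma expc_add (c d : C) (n : nat) :
  csum (map (fun i => expc c i * expc d (n - i)) (seq 0 (S n))) = expc (c + d) n.
Proof.
  induction n as [|n IH].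
  - simpl. unfold expc; simpl. field.
  - enough (E : RtoC (INR (S n)) *
      csum (map (fun i => expc c i * expc d (S n - i)) (seq 0 (S (S n)))) =
      RtoC (INR (S n)) * expc (c + d) (S n)).
    { apply (f_equal (fun z => / RtoC (INR (S n)) * z)) in E.
      rewrite !Cmult_assoc, Cinv_l, !Cmult_1_l in E by apply S_C_neq_0. exact E. }
    rewrite expc_S, <- IH, <- csum_scal.
    rewrite (csum_ext _ (fun i => RtoC (INR i) * expc c i * expc d (S n - i)
      + RtoC (INR (S n - i)) * expc c i * expc d (S n - i))).
    2:{ intros i Hi. apply in_seq in Hi.
        rewrite minus_INR by lia. rewrite RtoC_minus. ring. }
    rewrite csum_plus.
    assert (E1 : csum (map (fun i => RtoC (INR i) * expc c i * expc d (S n - i))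
                         (seq 0 (S (S n))))
                 = c * csum (map (fun i => expc c i * expc d (n - i)) (seq 0 (S n)))).
    { change (seq 0 (S (S n))) with (0%nat :: seq 1 (S n)).
      rewrite <- seq_shift, map_cons, map_map. cbn [csum].
      rewrite <- csum_scal. simpl (INR 0).
      rewrite (csum_ext _ (fun i => c * (expc c i * expc d (n - i)))).
      - ring.
      - intros i _. rewrite expc_S. simpl (S n - S i)%nat. ring. }
    assert (E2 : csum (map (fun i => RtoC (INR (S n - i)) * expc c i * expc d (S n - i))
                         (seq 0 (S (S n))))
                 = d * csum (map (fun i => expc c i * expc d (n - i)) (seq 0 (S n)))).
    { rewrite (seq_S (S n)), map_app, csum_app. cbn [map csum].
      rewrite Nat.add_0_l, Nat.sub_diag. simpl (INR 0).
      rewrite <- csum_scal.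
      rewrite (csum_ext _ (fun i => d * (expc c i * expc d (n - i)))).
      - ring.
      - intros i Hi. apply in_seq in Hi.
        replace (S n - i)%nat with (S (n - i)) by lia.
        transitivity (expc c i * (RtoC (INR (S (n - i))) * expc d (S (n - i)))); [ring|].
        rewrite expc_S. ring. }
    rewrite E1, E2. ring.
Qed.

Lemma ncexp_unfold (b : bool) (c : C) (w : word) :
  ncexp b c w = if forallb (fun x => Bool.eqb x b) w then expc c (length w) else 0.
Proof. reflexivity. Qed.

Lemma ncexp_nil (b : bool) (c : C) : ncexp b c [] = 1.
Proof. unfold ncexp; simpl. field. Qed.

Lemma ncexp_add (b : bool) (c d : C) : ncexp b c ** ncexp b d = ncexp b (c + d).
Proof.
  apply functional_extensionality; intros w; unfold ncmul.
  rewrite ncexp_unfold.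
  destruct (forallb _ w) eqn:E.
  - rewrite <- expc_add. apply csum_ext. intros i Hi. apply in_seq in Hi.
    rewrite <- (firstn_skipn i w), forallb_app in E.
    apply andb_prop in E. destruct E as [E1 E2].
    rewrite !ncexp_unfold, E1, E2, length_firstn, length_skipn.
    rewrite Nat.min_l by lia. reflexivity.
  - rewrite (csum_ext _ (fun _ => 0 * 0)).
    + rewrite csum_scal; ring.
    + intros i _. rewrite <- (firstn_skipn i w), forallb_app in E.
      apply Bool.andb_false_elim in E. rewrite !ncexp_unfold.
      destruct E as [E|E]; rewrite E; ring.
Qed.

Lemma ncexp_0 (b : bool) : ncexp b 0 = ncone.
Proof.
  apply functional_extensionality; intros [|a w]; [apply ncexp_nil|].
  rewrite ncexp_unfold. destruct (forallb _ _); [|reflexivity].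
  unfold expc, ncone; simpl. unfold Cdiv. ring.
Qed.

Lemma ncexp_comm (b : bool) (c d : C) : ncexp b c ** ncexp b d = ncexp b d ** ncexp b c.
Proof. rewrite !ncexp_add. f_equal; ring. Qed.

Lemma ncexp_inv (b : bool) (c : C) : ncexp b c ** ncexp b (- c) = ncone.
Proof. rewrite ncexp_add, <- (ncexp_0 b). f_equal; ring. Qed.

Lemma ncexp_inv' (b : bool) (c : C) : ncexp b (- c) ** ncexp b c = ncone.
Proof. rewrite ncexp_add, <- (ncexp_0 b). f_equal; ring. Qed.

Lemma ncexp_let_comm (b : bool) (c : C) : ncexp b c ** nclet b = nclet b ** ncexp b c.
Proof.
  apply functional_extensionality; intros w.
  destruct w as [|a w]; [rewrite ncmul_let_l_nil, ncmul_let_r_nil; reflexivity|].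
  rewrite ncmul_let_l.
  destruct (@exists_last _ (a :: w)) as [v [d E]]; [discriminate|].
  rewrite E, ncmul_let_r.
  assert (L : length v = length w).
  { apply (f_equal (@length bool)) in E. rewrite length_app in E. simpl in E. lia. }
  apply (f_equal (forallb (fun x => Bool.eqb x b))) in E.
  rewrite forallb_app in E. cbn [forallb] in E.
  rewrite !ncexp_unfold, L.
  destruct (Bool.eqb d b), (Bool.eqb a b), (forallb _ v), (forallb _ w);
    simpl in E; try discriminate E; reflexivity.
Qed.

(** * The antipode [ncS], the letter swap, conjugation, and the substitution [sg] *)

Definition ncS (F : ncs) : ncs := fun w => Cpow (RtoC (-1)) (length w) * F (rev w).
Definition ncswap (F : ncs) : ncs := fun w => F (map negb w).
Definition ncconj (F : ncs) : ncs := fun w => Cconj (F w).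

(* The algebra endomorphism [X_false -> - X_false - X_true], [X_true -> X_true]. *)
Fixpoint sg_at (w : word) (F : ncs) : C :=
  match w with
  | [] => F []
  | false :: w' => - sg_at w' (lsh false F)
  | true :: w' => sg_at w' (lsh true F) - sg_at w' (lsh false F)
  end.
Definition sg (F : ncs) : ncs := fun w => sg_at w F.

Lemma ncS_mul (F G : ncs) : ncS (F ** G) = ncS G ** ncS F.
Proof.
  apply functional_extensionality; intros w; revert G.
  induction w as [|a w IH]; intros G.
  - rewrite ncmul_nil. unfold ncS. cbn [length rev Cpow]. rewrite ncmul_nil. ring.
  - rewrite ncmul_cons.
    replace (lsh a (ncS G)) with ((-1) *: ncS (rsh a G)).
    2:{ apply functional_extensionality; intros v; unfold ncscal, ncS, rsh, lsh.
        simpl. ring. }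
    rewrite ncmul_scal_l. unfold ncscal. rewrite <- IH.
    unfold ncS at 1 2 3 4. simpl. rewrite ncmul_snoc. ring.
Qed.

Lemma ncS_exp (b : bool) (c : C) : ncS (ncexp b c) = ncexp b (- c).
Proof.
  apply functional_extensionality; intros w; unfold ncS. rewrite !ncexp_unfold.
  rewrite length_rev.
  assert (E : forallb (fun x => Bool.eqb x b) (rev w) = forallb (fun x => Bool.eqb x b) w).
  { induction w as [|a w IH]; auto. simpl. rewrite forallb_app, IH. simpl.
    destruct (Bool.eqb a b), (forallb _ w); reflexivity. }
  rewrite E. destruct (forallb _ w); [|ring].
  unfold expc. replace (- c) with (RtoC (-1) * c) by ring.
  rewrite Cpow_mult_l. unfold Cdiv. ring.
Qed.

Lemma ncS_invol (F : ncs) : ncS (ncS F) = F.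
Proof.
  apply functional_extensionality; intros w; unfold ncS.
  rewrite length_rev, rev_involutive, Cmult_assoc, <- Cpow_mult_l.
  replace (RtoC (-1) * RtoC (-1)) with (RtoC 1) by ring.
  rewrite Cpow_1_l. ring.
Qed.

Lemma ncS_add (F G : ncs) : ncS (ncadd F G) = ncadd (ncS F) (ncS G).
Proof. apply functional_extensionality; intros w; unfold ncS, ncadd; ring. Qed.

Lemma ncS_scal (c : C) (F : ncs) : ncS (c *: F) = c *: ncS F.
Proof. apply functional_extensionality; intros w; unfold ncS, ncscal; ring. Qed.

Lemma ncS_let (b : bool) : ncS (nclet b) = (-1) *: nclet b.
Proof.
  apply functional_extensionality; intros [|a [|d w]]; unfold ncS, ncscal, nclet; simpl;
    try ring.
  destruct (rev w) as [|x [|y l]]; simpl; try destruct l; simpl; ring.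
Qed.

Lemma ncS_one : ncS ncone = ncone.
Proof. rewrite <- (ncexp_0 true), ncS_exp. f_equal; ring. Qed.

Lemma ncswap_mul (F G : ncs) : ncswap (F ** G) = ncswap F ** ncswap G.
Proof.
  apply functional_extensionality; intros w; unfold ncswap, ncmul.
  rewrite length_map. apply csum_ext; intros i _.
  rewrite firstn_map, skipn_map. reflexivity.
Qed.

Lemma ncswap_invol (F : ncs) : ncswap (ncswap F) = F.
Proof.
  apply functional_extensionality; intros w; unfold ncswap. rewrite map_map.
  f_equal. rewrite <- (map_id w) at 2. apply map_ext. intros a; apply Bool.negb_involutive.
Qed.

Lemma ncswap_exp (b : bool) (c : C) : ncswap (ncexp b c) = ncexp (negb b) c.
Proof.
  apply functional_extensionality; intros w; unfold ncswap. rewrite !ncexp_unfold.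
  rewrite length_map.
  assert (E : forallb (fun x => Bool.eqb x b) (map negb w)
            = forallb (fun x => Bool.eqb x (negb b)) w).
  { induction w as [|a w IH]; auto. simpl. rewrite IH. destruct a, b; reflexivity. }
  rewrite E. reflexivity.
Qed.

Lemma ncswap_add (F G : ncs) : ncswap (ncadd F G) = ncadd (ncswap F) (ncswap G).
Proof. reflexivity. Qed.

Lemma ncswap_scal (c : C) (F : ncs) : ncswap (c *: F) = c *: ncswap F.
Proof. reflexivity. Qed.

Lemma ncswap_let (b : bool) : ncswap (nclet b) = nclet (negb b).
Proof.
  apply functional_extensionality; intros [|a [|d w]]; unfold ncswap, nclet; simpl; auto.
  destruct a, b; reflexivity.
Qed.

Lemma Cconj_csum (l : list C) : Cconj (csum l) = csum (map Cconj l).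
Proof.
  induction l as [|x l IH]; simpl.
  - unfold Cconj, RtoC; simpl. f_equal; ring.
  - rewrite Cplus_conj, IH. reflexivity.
Qed.

Lemma ncconj_mul (F G : ncs) : ncconj (F ** G) = ncconj F ** ncconj G.
Proof.
  apply functional_extensionality; intros w; unfold ncconj, ncmul.
  rewrite Cconj_csum, map_map. apply csum_ext; intros i _. apply Cmult_conj.
Qed.

Lemma Cconj_RtoC (x : R) : Cconj (RtoC x) = RtoC x.
Proof. unfold Cconj, RtoC; simpl. f_equal; ring. Qed.

Lemma ncconj_exp (b : bool) (c : C) : ncconj (ncexp b c) = ncexp b (Cconj c).
Proof.
  apply functional_extensionality; intros w; unfold ncconj. rewrite !ncexp_unfold.
  destruct (forallb _ w); [|apply Cconj_RtoC].
  unfold expc. rewrite Cdiv_conj by apply fact_C_neq_0.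
  rewrite Cpow_conj, Cconj_RtoC. reflexivity.
Qed.

Lemma ncconj_S (F : ncs) : ncconj (ncS F) = ncS (ncconj F).
Proof.
  apply functional_extensionality; intros w; unfold ncconj, ncS.
  rewrite Cmult_conj, Cpow_conj, Cconj_RtoC. reflexivity.
Qed.

Lemma ncconj_swap (F : ncs) : ncconj (ncswap F) = ncswap (ncconj F).
Proof. reflexivity. Qed.

Lemma sg_add (F G : ncs) : sg (ncadd F G) = ncadd (sg F) (sg G).
Proof.
  apply functional_extensionality; intros w; unfold sg, ncadd; revert F G.
  induction w as [|[] w IH]; intros F G; simpl; auto; unfold lsh; rewrite !IH; ring.
Qed.

Lemma sg_scal (c : C) (F : ncs) : sg (c *: F) = c *: sg F.
Proof.
  apply functional_extensionality; intros w; unfold sg, ncscal; revert F.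
  induction w as [|[] w IH]; intros F; simpl; auto; unfold lsh; rewrite !IH; ring.
Qed.

Lemma lsh_sg (a : bool) (F : ncs) : lsh a (sg F) =
  if a then ncadd (sg (lsh true F)) ((-1) *: sg (lsh false F)) else (-1) *: sg (lsh false F).
Proof.
  apply functional_extensionality; intros w; destruct a; unfold lsh, ncadd, ncscal, sg;
    simpl; unfold lsh; ring.
Qed.

(** [sg] is defined through its transpose on words, e_0 -> - e_0 and e_1 -> e_1 - e_0, so
    multiplicativity has to be derived. Together with the images of the letters it identifies [sg]
    as a substitution. *)
Lemma sg_mul (F G : ncs) : sg (F ** G) = sg F ** sg G.
Proof.
  apply functional_extensionality; intros w; revert F.
  induction w as [|a w IH]; intros F; [unfold sg; simpl; rewrite !ncmul_nil; reflexivity|].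
  rewrite ncmul_cons. change (sg (F ** G) (a :: w)) with (lsh a (sg (F ** G)) w).
  rewrite !lsh_sg, !lsh_mul, !sg_add, !sg_scal.
  change (sg G (a :: w)) with (lsh a (sg G) w). rewrite lsh_sg.
  change (sg F []) with (F []).
  destruct a; unfold ncadd, ncscal; rewrite ?IH.
  - change (fun w0 => sg (lsh true F) w0 + -1 * sg (lsh false F) w0) with
      (ncadd (sg (lsh true F)) ((-1) *: sg (lsh false F))).
    rewrite ncmul_add_l, ncmul_scal_l. unfold ncadd, ncscal. ring.
  - change (fun w0 => -1 * sg (lsh false F) w0) with ((-1) *: sg (lsh false F)).
    rewrite ncmul_scal_l. unfold ncadd, ncscal. ring.
Qed.

Lemma sg_one : sg ncone = ncone.
Proof.
  apply functional_extensionality; intros w; unfold sg.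
  assert (Z0 : forall w, sg_at w (fun _ => 0) = 0).
  { induction w0 as [|[] w0 IH]; simpl; unfold lsh; rewrite ?IH; ring. }
  destruct w as [|[] w]; simpl; auto;
    change (lsh true ncone) with (fun _ : word => RtoC 0);
    change (lsh false ncone) with (fun _ : word => RtoC 0); rewrite ?Z0; ring.
Qed.

Lemma sg_let_true : sg (nclet true) = nclet true.
Proof.
  apply functional_extensionality; intros w.
  replace (lsh true (nclet true)) with ncone by
    (apply functional_extensionality; intros [|]; reflexivity).
  destruct w as [|a w]; [reflexivity|].
  change (sg (nclet true) (a :: w)) with (lsh a (sg (nclet true)) w).
  rewrite lsh_sg.
  replace (lsh true (nclet true)) with ncone by
    (apply functional_extensionality; intros [|]; reflexivity).
  replace (lsh false (nclet true)) with (0 *: ncone) by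
    (apply functional_extensionality; intros [|]; unfold ncscal, lsh, ncone; simpl; ring).
  rewrite sg_scal, sg_one. destruct a, w; unfold ncadd, ncscal, ncone, nclet; simpl; ring.
Qed.

Lemma sg_let_false : sg (nclet false) = (-1) *: ncadd (nclet false) (nclet true).
Proof.
  apply functional_extensionality; intros w.
  destruct w as [|a w]; [unfold sg, ncscal, ncadd; simpl; ring|].
  change (sg (nclet false) (a :: w)) with (lsh a (sg (nclet false)) w).
  rewrite lsh_sg.
  replace (lsh false (nclet false)) with ncone by
    (apply functional_extensionality; intros [|]; reflexivity).
  replace (lsh true (nclet false)) with (0 *: ncone) by
    (apply functional_extensionality; intros [|]; unfold ncscal, lsh, ncone; simpl; ring).
  rewrite sg_scal, sg_one. destruct a, w; unfold ncadd, ncscal, ncone, nclet; simpl; ring.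
Qed.

Lemma sg_exp_true (c : C) : sg (ncexp true c) = ncexp true c.
Proof.
  apply functional_extensionality; intros w.
  assert (Z0 : forall w, sg_at w (fun _ => 0) = 0).
  { induction w0 as [|[] w0 IH]; simpl; unfold lsh; rewrite ?IH; ring. }
  (* Stripping a letter shifts the exponent, so the claim is made for an arbitrary function of the
     length. *)
  assert (K : forall f : nat -> C, forall w,
    sg (fun w => if forallb (fun x => Bool.eqb x true) w then f (length w) else 0) w
    = if forallb (fun x => Bool.eqb x true) w then f (length w) else 0).
  { intros f w0; revert f. unfold sg; induction w0 as [|[] w0 IH]; intros f; auto;
      cbn [sg_at]; unfold lsh; cbn [forallb Bool.eqb andb length]; rewrite ?Z0;
      [rewrite (IH (fun n => f (S n)))|]; ring. }
  exact (K (expc c) w).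
Qed.

Lemma sg_snoc (F : ncs) (a : bool) (w : word) : sg F (w ++ [a]) =
  if a then sg (rsh true F) w - sg (rsh false F) w else - sg (rsh false F) w.
Proof.
  unfold sg; revert F; induction w as [|b w IH]; intros F; simpl.
  - destruct a; reflexivity.
  - destruct a, b; rewrite !IH; unfold rsh, lsh; simpl; ring.
Qed.

Lemma sg_S (F : ncs) : sg (ncS F) = ncS (sg F).
Proof.
  apply functional_extensionality; intros w; revert F.
  induction w as [|a w IH]; intros F; [reflexivity|].
  assert (E : forall b, lsh b (ncS F) = (-1) *: ncS (rsh b F)).
  { intros b; apply functional_extensionality; intros v; unfold lsh, ncS, rsh, ncscal.
    simpl. ring. }
  change (sg (ncS F) (a :: w)) with (lsh a (sg (ncS F)) w).
  rewrite lsh_sg, !E, !sg_scal.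
  destruct a; unfold ncadd, ncscal; rewrite !IH; unfold ncS; cbn [length rev Cpow];
    rewrite sg_snoc; ring.
Qed.

Lemma sg_conj (F : ncs) : ncconj (sg F) = sg (ncconj F).
Proof.
  apply functional_extensionality; intros w; unfold sg, ncconj; revert F.
  induction w as [|[] w IH]; intros F; simpl; auto; unfold lsh;
    rewrite ?Cminus_conj, ?Copp_conj, !IH; reflexivity.
Qed.

Lemma lsh_swap (a : bool) (F : ncs) : lsh a (ncswap F) = ncswap (lsh (negb a) F).
Proof. reflexivity. Qed.

(** The braid relation: with X_inf = - X_false - X_true, [ncswap] and [sg] are the transpositions of
    X_false with X_true and of X_false with X_inf in the symmetric group on the three residues. *)
Lemma sg_swap_sg (F : ncs) : sg (ncswap (sg F)) = ncswap (sg (ncswap F)).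
Proof.
  apply functional_extensionality; intros w; revert F.
  induction w as [|a w IH]; intros F; [reflexivity|].
  change (sg (ncswap (sg F)) (a :: w)) with (lsh a (sg (ncswap (sg F))) w).
  change (ncswap (sg (ncswap F)) (a :: w)) with (lsh a (ncswap (sg (ncswap F))) w).
  rewrite lsh_sg, !lsh_swap, !lsh_sg. cbn [negb].
  destruct a; cbn [negb]; rewrite ?lsh_swap; cbn [negb];
    rewrite ?ncswap_add, ?ncswap_scal, ?sg_add, ?sg_scal, ?ncswap_add, ?ncswap_scal;
    unfold ncadd, ncscal; rewrite !IH; ring.
Qed.

(** * Shuffles and regularization *)

Definition Clim (f : nat -> C) (l : C) : Prop :=
  is_lim_seq (fun j => Re (f j)) (Re l) /\ is_lim_seq (fun j => Im (f j)) (Im l).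

Lemma Clim_ext (f g : nat -> C) (l : C) : (forall j, f j = g j) -> Clim f l -> Clim g l.
Proof.
  intros E [H1 H2]; split.
  - apply is_lim_seq_ext with (2 := H1). intros j; rewrite E; reflexivity.
  - apply is_lim_seq_ext with (2 := H2). intros j; rewrite E; reflexivity.
Qed.

Lemma Clim_const (c : C) : Clim (fun _ => c) c.
Proof. split; apply is_lim_seq_const. Qed.

Lemma Clim_plus (f g : nat -> C) (l m : C) :
  Clim f l -> Clim g m -> Clim (fun j => f j + g j) (l + m).
Proof. intros [H1 H2] [H3 H4]; split; simpl; apply is_lim_seq_plus'; assumption. Qed.

Lemma Clim_mult (f g : nat -> C) (l m : C) :
  Clim f l -> Clim g m -> Clim (fun j => f j * g j) (l * m).
Proof.
  intros [H1 H2] [H3 H4]; split; simpl.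
  - apply is_lim_seq_minus'; apply is_lim_seq_mult'; assumption.
  - apply is_lim_seq_plus'; apply is_lim_seq_mult'; assumption.
Qed.

Lemma Clim_scal (c : C) (f : nat -> C) (l : C) : Clim f l -> Clim (fun j => c * f j) (c * l).
Proof. intros H; apply Clim_mult; [apply Clim_const|exact H]. Qed.

Lemma Clim_opp (f : nat -> C) (l : C) : Clim f l -> Clim (fun j => - f j) (- l).
Proof.
  intros H. apply Clim_ext with (fun j => RtoC (-1) * f j); [intros; ring|].
  replace (- l) with (RtoC (-1) * l) by ring. apply Clim_scal, H.
Qed.

Lemma Clim_minus (f g : nat -> C) (l m : C) :
  Clim f l -> Clim g m -> Clim (fun j => f j - g j) (l - m).
Proof. intros H1 H2. apply Clim_plus; [exact H1|apply Clim_opp, H2]. Qed.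

Lemma Clim_conj (f : nat -> C) (l : C) : Clim f l -> Clim (fun j => Cconj (f j)) (Cconj l).
Proof.
  intros [H1 H2]; split; simpl; [exact H1|].
  apply (is_lim_seq_opp _ (Finite (snd l))), H2.
Qed.

Lemma Clim_unique (f : nat -> C) (l m : C) : Clim f l -> Clim f m -> l = m.
Proof.
  intros [H1 H2] [H3 H4].
  apply is_lim_seq_unique in H1, H2, H3, H4.
  destruct l as [l1 l2], m as [m1 m2]; simpl in *.
  rewrite H1 in H3; rewrite H2 in H4. injection H3; injection H4. congruence.
Qed.

Lemma Clim_csum {A : Type} (f : nat -> A -> C) (g : A -> C) (l : list A) :
  (forall x, In x l -> Clim (fun j => f j x) (g x)) ->
  Clim (fun j => csum (map (f j) l)) (csum (map g l)).
Proof.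
  induction l as [|x l IH]; intros H; simpl; [apply Clim_const|].
  apply Clim_plus; [apply H; left; reflexivity|apply IH; intros; apply H; right; assumption].
Qed.

Definition NClim (F : nat -> ncs) (G : ncs) : Prop := forall w, Clim (fun j => F j w) (G w).

Lemma NClim_const (F : ncs) : NClim (fun _ => F) F.
Proof. intros w; apply Clim_const. Qed.

Lemma NClim_mul (F G : nat -> ncs) (F' G' : ncs) :
  NClim F F' -> NClim G G' -> NClim (fun j => F j ** G j) (F' ** G').
Proof.
  intros H1 H2 w. unfold ncmul.
  apply (Clim_csum (fun j i => F j (firstn i w) * G j (skipn i w))).
  intros i _. apply Clim_mult; auto.
Qed.

Lemma NClim_S (F : nat -> ncs) (G : ncs) : NClim F G -> NClim (fun j => ncS (F j)) (ncS G).
Proof. intros H w. apply Clim_scal, H. Qed.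

Lemma NClim_swap (F : nat -> ncs) (G : ncs) :
  NClim F G -> NClim (fun j => ncswap (F j)) (ncswap G).
Proof. intros H w. apply H. Qed.

Lemma NClim_conj (F : nat -> ncs) (G : ncs) :
  NClim F G -> NClim (fun j => ncconj (F j)) (ncconj G).
Proof. intros H w. apply Clim_conj, H. Qed.

Lemma NClim_sg (F : nat -> ncs) (G : ncs) : NClim F G -> NClim (fun j => sg (F j)) (sg G).
Proof.
  intros H w; revert F G H. unfold sg. induction w as [|a w IH]; intros F G H; [apply H|].
  assert (K : forall b, Clim (fun j => sg_at w (lsh b (F j))) (sg_at w (lsh b G))).
  { intros b. apply IH. intros v. apply H. }
  destruct a; simpl; [apply Clim_minus|apply Clim_opp]; apply K.
Qed.

Lemma NClim_unique (F : nat -> ncs) (G H : ncs) : NClim F G -> NClim F H -> G = H.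
Proof.
  intros H1 H2. apply functional_extensionality; intros w. eapply Clim_unique; auto.
Qed.

(** * Group-like series as characters of the shuffle algebra *)

Definition ssum (F : ncs) (u v : word) : C := csum (map F (shuffle u v)).

Definition glike (F : ncs) : Prop := F [] = 1 /\ forall u v, ssum F u v = F u * F v.

Lemma ssum_nil_l (F : ncs) (v : word) : ssum F [] v = F v.
Proof. unfold ssum; simpl; ring. Qed.

Lemma ssum_nil_r (F : ncs) (u : word) : ssum F u [] = F u.
Proof. unfold ssum; destruct u; simpl; ring. Qed.

Lemma ssum_cons (F : ncs) (a b : bool) (u v : word) :
  ssum F (a :: u) (b :: v) = ssum (lsh a F) u (b :: v) + ssum (lsh b F) (a :: u) v.
Proof.
  unfold ssum. change (shuffle (a :: u) (b :: v)) with
    (map (cons a) (shuffle u (b :: v)) ++ map (cons b) (shuffle (a :: u) v)).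
  rewrite map_app, csum_app, !map_map. reflexivity.
Qed.

(** [shuffle] recurses on first letters; this mirror recursion on last letters gives invariance
    under reversal. The induction is on the total length because either word may lose its letter. *)
Lemma ssum_snoc (F : ncs) (a b : bool) (u v : word) :
  ssum F (u ++ [a]) (v ++ [b]) = ssum (rsh a F) u (v ++ [b]) + ssum (rsh b F) (u ++ [a]) v.
Proof.
  enough (H : forall n u v F, (length u + length v <= n)%nat ->
    ssum F (u ++ [a]) (v ++ [b]) = ssum (rsh a F) u (v ++ [b]) + ssum (rsh b F) (u ++ [a]) v).
  { apply (H (length u + length v)%nat); auto. }
  clear. induction n as [|n IH]; intros u v F L.
  - destruct u, v; simpl in L; try lia. cbn [app].
    rewrite ssum_cons, !ssum_nil_l, !ssum_nil_r. unfold lsh, rsh; simpl. ring.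
  - destruct u as [|c u], v as [|d v]; simpl in L; cbn [app].
    + rewrite ssum_cons, !ssum_nil_l, !ssum_nil_r. unfold lsh, rsh; simpl. ring.
    + rewrite !ssum_cons, !ssum_nil_l.
      change [a] with ([] ++ [a])%list at 1. rewrite IH by (simpl; lia).
      rewrite ssum_nil_l. simpl app. unfold lsh, rsh. simpl app. ring.
    + rewrite !ssum_cons, !ssum_nil_r.
      change [b] with ([] ++ [b])%list at 1. rewrite IH by (simpl; lia).
      rewrite ssum_nil_r. simpl app. unfold lsh, rsh. simpl app. ring.
    + rewrite !ssum_cons.
      change (d :: v ++ [b])%list with ((d :: v) ++ [b])%list.
      change (c :: u ++ [a])%list with ((c :: u) ++ [a])%list.
      rewrite !IH by (simpl; lia). unfold lsh, rsh. simpl app. ring.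
Qed.

Lemma ssum_rev (F : ncs) (u v : word) :
  ssum (fun w => F (rev w)) u v = ssum F (rev u) (rev v).
Proof.
  enough (H : forall n u v F, (length u + length v <= n)%nat ->
    ssum (fun w => F (rev w)) u v = ssum F (rev u) (rev v)).
  { apply (H (length u + length v)%nat); auto. }
  clear. induction n as [|n IH]; intros u v F L.
  - destruct u, v; simpl in L; try lia. reflexivity.
  - destruct u as [|c u]; [simpl; rewrite !ssum_nil_l; reflexivity|].
    destruct v as [|d v]; [simpl rev; rewrite !ssum_nil_r; reflexivity|].
    simpl in L. simpl rev. rewrite ssum_cons, ssum_snoc.
    change (lsh c (fun w => F (rev w))) with (fun w => rsh c F (rev w)).
    change (lsh d (fun w => F (rev w))) with (fun w => rsh d F (rev w)).
    rewrite !IH by (simpl; lia). reflexivity.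
Qed.

Lemma glike_rev (F : ncs) : glike F -> glike (fun w => F (rev w)).
Proof. intros [H1 H2]; split; [exact H1|]. intros u v. rewrite ssum_rev. apply H2. Qed.

Lemma ssum_add (F G : ncs) (u v : word) : ssum (ncadd F G) u v = ssum F u v + ssum G u v.
Proof. apply csum_plus. Qed.

Lemma ssum_scal (c : C) (F : ncs) (u v : word) : ssum (ncscal c F) u v = c * ssum F u v.
Proof. apply csum_scal. Qed.

Definition spsum (f : word -> word -> C) (w : word) : C :=
  csum (map (fun i => f (firstn i w) (skipn i w)) (seq 0 (S (length w)))).

Lemma spsum_cons (f : word -> word -> C) (a : bool) (w : word) :
  spsum f (a :: w) = f [] (a :: w) + spsum (fun p q => f (a :: p) q) w.
Proof.
  unfold spsum. cbn [length].
  change (seq 0 (S (S (length w)))) with (0%nat :: seq 1 (S (length w))).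
  rewrite <- seq_shift, map_cons, map_map. reflexivity.
Qed.

Lemma spsum_nil (f : word -> word -> C) : spsum f [] = f [] [].
Proof. unfold spsum; simpl; ring. Qed.

Lemma spsum_plus (f g : word -> word -> C) (w : word) :
  spsum (fun p q => f p q + g p q) w = spsum f w + spsum g w.
Proof. unfold spsum. apply csum_plus. Qed.

Lemma spsum_ext (f g : word -> word -> C) (w : word) :
  (forall p q, f p q = g p q) -> spsum f w = spsum g w.
Proof. intros H. apply csum_ext; auto. Qed.

(** Deconcatenation, the coproduct dual to [**], is multiplicative for the shuffle product: cutting
    a shuffle of u and v amounts to cutting u and v and shuffling the pieces. Hence products of
    characters are characters. *)
Lemma ssum_mul (F G : ncs) (u v : word) :
  ssum (F ** G) u v =
  spsum (fun p q => spsum (fun p' q' => ssum F p p' * ssum G q q') v) u.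
Proof.
  enough (H : forall n u v F, (length u + length v <= n)%nat -> ssum (F ** G) u v =
    spsum (fun p q => spsum (fun p' q' => ssum F p p' * ssum G q q') v) u).
  { apply (H (length u + length v)%nat); auto. }
  clear F u v. induction n as [|n IH]; intros u v F L.
  - destruct u, v; simpl in L; try lia.
    rewrite !spsum_nil, !ssum_nil_l. apply ncmul_nil.
  - destruct u as [|a u].
    { rewrite spsum_nil, ssum_nil_l. unfold ncmul. fold (spsum (fun p q => F p * G q) v).
      apply spsum_ext. intros p q. rewrite !ssum_nil_l. reflexivity. }
    destruct v as [|b v].
    { rewrite ssum_nil_r. unfold ncmul. fold (spsum (fun p q => F p * G q) (a :: u)).
      apply spsum_ext. intros p q. rewrite spsum_nil, !ssum_nil_r. reflexivity. }
    simpl in L. rewrite ssum_cons, !lsh_mul, !ssum_add, !ssum_scal.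
    rewrite !IH by (simpl; lia).
    rewrite !(spsum_cons _ a u).
    assert (E1 : spsum (fun p q => spsum (fun p' q' =>
        ssum (lsh a F) p p' * ssum G q q') (b :: v)) u =
      spsum (fun p q => ssum (lsh a F) p [] * ssum G q (b :: v)) u +
      spsum (fun p q => spsum (fun p' q' =>
        ssum (lsh a F) p (b :: p') * ssum G q q') v) u).
    { rewrite <- spsum_plus. apply spsum_ext. intros p q. apply spsum_cons. }
    assert (E2 : spsum (fun p q => spsum (fun p' q' =>
        ssum F (a :: p) p' * ssum G q q') (b :: v)) u =
      spsum (fun p q => ssum (lsh a F) p [] * ssum G q (b :: v)) u +
      spsum (fun p q => spsum (fun p' q' =>
        ssum (lsh a F) p (b :: p') * ssum G q q') v) u +
      spsum (fun p q => spsum (fun p' q' =>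
        ssum (lsh b F) (a :: p) p' * ssum G q q') v) u).
    { rewrite <- !spsum_plus. apply spsum_ext. intros p q.
      rewrite spsum_cons, !ssum_nil_r. unfold lsh at 1.
      rewrite <- Cplus_assoc, <- spsum_plus. f_equal.
      apply spsum_ext. intros p' q'. rewrite ssum_cons. ring. }
    assert (E3 : spsum (fun p q => ssum F [] (b :: p) * ssum G (a :: u) q) v =
      spsum (fun p q => ssum (lsh b F) [] p * ssum G (a :: u) q) v).
    { apply spsum_ext. intros p q. rewrite !ssum_nil_l. reflexivity. }
    rewrite E1, E2, (spsum_cons _ b v), E3, ssum_nil_l.
    rewrite (ssum_cons G). ring.
Qed.

Lemma spsum_scal (c : C) (f : word -> word -> C) (w : word) :
  spsum (fun p q => c * f p q) w = c * spsum f w.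
Proof. apply csum_scal. Qed.

Lemma glike_mul (F G : ncs) : glike F -> glike G -> glike (F ** G).
Proof.
  intros [F1 HF] [G1 HG]; split; [rewrite ncmul_nil, F1, G1; ring|].
  intros u v. rewrite ssum_mul.
  rewrite (spsum_ext _ (fun p q => (F ** G) v * (F p * G q))).
  - rewrite spsum_scal. unfold spsum. fold ((F ** G) u). ring.
  - intros p q.
    rewrite (spsum_ext _ (fun p' q' => (F p * G q) * (F p' * G q'))).
    + rewrite spsum_scal. unfold spsum. fold ((F ** G) v). ring.
    + intros p' q'. rewrite HF, HG. ring.
Qed.

Lemma shuffle_length (u v w : word) :
  In w (shuffle u v) -> length w = (length u + length v)%nat.
Proof.
  enough (H : forall n u v w, (length u + length v <= n)%nat ->
    In w (shuffle u v) -> length w = (length u + length v)%nat).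
  { apply (H (length u + length v)%nat); auto. }
  clear. induction n as [|n IH]; intros u v w L.
  - destruct u, v; simpl in L; try lia. simpl. intros [<-|[]]; reflexivity.
  - destruct u as [|a u]; [simpl; intros [<-|[]]; reflexivity|].
    destruct v as [|b v]; [simpl; intros [<-|[]]; simpl; lia|].
    simpl in L. change (shuffle (a :: u) (b :: v)) with
      (map (cons a) (shuffle u (b :: v)) ++ map (cons b) (shuffle (a :: u) v)).
    intros H; apply in_app_or in H. destruct H as [H|H];
      apply in_map_iff in H; destruct H as [w' [<- H]]; apply IH in H; simpl in *; lia.
Qed.

Lemma ncexp_cons (b : bool) (c : C) (a : bool) (w : word) :
  RtoC (INR (S (length w))) * ncexp b c (a :: w) = if Bool.eqb a b then c * ncexp b c w else 0.
Proof.
  rewrite !ncexp_unfold. cbn [forallb length].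
  destruct (Bool.eqb a b); cbn [andb]; [|ring].
  destruct (forallb _ w); [apply expc_S|ring].
Qed.

Lemma glike_exp (b : bool) (c : C) : glike (ncexp b c).
Proof.
  split; [apply ncexp_nil|].
  enough (H : forall n u v, (length u + length v <= n)%nat ->
    ssum (ncexp b c) u v = ncexp b c u * ncexp b c v).
  { intros u v; apply (H (length u + length v)%nat); auto. }
  induction n as [|n IH]; intros u v L.
  - destruct u, v; simpl in L; try lia. rewrite ssum_nil_l, ncexp_nil. ring.
  - destruct u as [|x u]; [rewrite ssum_nil_l, ncexp_nil; ring|].
    destruct v as [|y v]; [rewrite ssum_nil_r, ncexp_nil; ring|].
    simpl in L.
    (* All words of a shuffle have the same length, so one integer factor serves the whole sum; it
       is split below into the lengths of the two words. *)
    assert (K : forall a u v, (length u + length v <= n)%nat ->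
      RtoC (INR (S (length u + length v))) * ssum (lsh a (ncexp b c)) u v
      = (if Bool.eqb a b then c else 0) * (ncexp b c u * ncexp b c v)).
    { intros a u' v' L'. rewrite <- IH by lia. unfold ssum. rewrite <- !csum_scal.
      apply csum_ext. intros w Hw. apply shuffle_length in Hw. rewrite <- Hw.
      unfold lsh. rewrite ncexp_cons. destruct (Bool.eqb a b); ring. }
    rewrite ssum_cons.
    assert (K1 := K x u (y :: v)). assert (K2 := K y (x :: u) v). simpl length in K1, K2.
    rewrite <- plus_n_Sm in K1. specialize (K1 ltac:(lia)). specialize (K2 ltac:(lia)).
    simpl (S (length u) + length v)%nat in K2.
    assert (D := S_C_neq_0 (S (length u + length v))).
    assert (C1 := ncexp_cons b c x u). assert (C2 := ncexp_cons b c y v).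
    rewrite <- (Cmult_1_l (ssum _ u _ + _)), <- (Cmult_1_l (_ * ncexp b c (y :: v))).
    rewrite <- (Cinv_l _ D), <- !Cmult_assoc. f_equal.
    rewrite Cmult_plus_distr_l, K1, K2.
    replace (INR (S (S (length u + length v)))) with (INR (S (length u)) + INR (S (length v)))%R.
    2:{ rewrite <- plus_INR. f_equal. lia. }
    rewrite RtoC_plus.
    transitivity ((RtoC (INR (S (length u))) * ncexp b c (x :: u)) * ncexp b c (y :: v) +
                  ncexp b c (x :: u) * (RtoC (INR (S (length v))) * ncexp b c (y :: v))).
    + rewrite C1, C2. destruct (Bool.eqb x b), (Bool.eqb y b); ring.
    + ring.
Qed.

(** Inserted before or among the a leading letters, c gives a + 1 copies of one word; inserted
    behind the first letter of x, it leaves only a leading letters c. This is the recursion of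
    shuffle regularization. *)
Lemma ssum_letter (F : ncs) (c : bool) (a : nat) (x : word) :
  (x = [] \/ exists y, x = negb c :: y) ->
  ssum F [c] (repeat c a ++ x) = RtoC (INR (S a)) * F (repeat c (S a) ++ x) +
    match x with
    | [] => 0
    | d :: y => csum (map (fun w => F (repeat c a ++ d :: w)) (shuffle [c] y))
    end.
Proof.
  intros Hx; revert F; induction a as [|a IH]; intros F.
  - cbn [repeat app]. destruct x as [|d y]; [rewrite ssum_nil_r; simpl; ring|].
    rewrite ssum_cons, ssum_nil_l. unfold lsh at 1. simpl (INR 1).
    change (ssum (lsh d F) [c] y) with (csum (map (fun w => F (d :: w)) (shuffle [c] y))).
    ring.
  - cbn [repeat app]. rewrite ssum_cons, ssum_nil_l, IH. unfold lsh.
    cbn [repeat app]. rewrite (S_INR (S a)), RtoC_plus. destruct x; ring.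
Qed.

(** Solving [ssum_letter] for the word with a + 1 leading letters c expresses it through [c] and
    words with a leading letters c. [Q] is a property of the remaining word that survives the
    insertion of c, such as a condition on its other end. *)
Lemma reg_step (J : nat -> ncs) (Zr : ncs) (c : bool) (Q : word -> Prop) :
  (forall j, glike (J j)) -> glike Zr ->
  (forall x w, Q (negb c :: x) -> In w (shuffle [c] x) -> Q (negb c :: w)) ->
  Clim (fun j => J j [c]) (Zr [c]) ->
  (forall x, Q (negb c :: x) -> Clim (fun j => J j (negb c :: x)) (Zr (negb c :: x))) ->
  forall a x, (x = [] \/ exists y, x = negb c :: y /\ Q x) ->
  Clim (fun j => J j (repeat c a ++ x)) (Zr (repeat c a ++ x)).
Proof.
  intros HJ HZ HQ Hc Hadm. induction a as [|a IH]; intros x Hx.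
  - destruct Hx as [->|[y [-> HQy]]]; [|apply Hadm, HQy].
    simpl. destruct HZ as [-> _]. apply Clim_ext with (fun _ => RtoC 1); [|apply Clim_const].
    intros j; symmetry; apply HJ.
  - assert (Hx' : x = [] \/ exists y, x = negb c :: y).
    { destruct Hx as [H|[y [H _]]]; eauto. }
    assert (D := S_C_neq_0 a).
    assert (E : forall F, glike F -> F (repeat c (S a) ++ x) = / RtoC (INR (S a)) *
      (F [c] * F (repeat c a ++ x) - match x with [] => 0 | d :: y =>
        csum (map (fun w => F (repeat c a ++ d :: w)) (shuffle [c] y)) end)).
    { intros F [_ HF]. rewrite <- HF, ssum_letter by assumption.
      set (T := match x with [] => _ | _ => _ end). field. exact D. }
    rewrite E by assumption.
    apply Clim_ext with (fun j => / RtoC (INR (S a)) *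
      (J j [c] * J j (repeat c a ++ x) - match x with [] => 0 | d :: y =>
        csum (map (fun w => J j (repeat c a ++ d :: w)) (shuffle [c] y)) end)).
    { intros j; rewrite E by apply HJ. reflexivity. }
    apply Clim_scal, Clim_minus; [apply Clim_mult; auto|].
    destruct x as [|d y]; [apply Clim_const|].
    destruct Hx as [Hx|[y' [Hx HQy]]]; [discriminate|]. injection Hx as -> <-.
    apply (Clim_csum (fun j w => J j (repeat c a ++ negb c :: w))).
    intros w Hw. apply IH. right. exists w. split; [reflexivity|]. eapply HQ; eauto.
Qed.

Lemma word_split (c : bool) (w : word) :
  exists a x, w = (repeat c a ++ x)%list /\ (x = [] \/ exists y, x = negb c :: y).
Proof.
  induction w as [|b w [a [x [E H]]]].
  - exists 0%nat, []. auto.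
  - destruct (Bool.bool_dec b c) as [->|N].
    + exists (S a), x. rewrite E. auto.
    + exists 0%nat, (b :: w). split; [reflexivity|right]. exists w. f_equal.
      destruct b, c; try reflexivity; exfalso; apply N; reflexivity.
Qed.

Lemma last_snoc {A : Type} (l : list A) (d : A) : l <> [] -> exists y, l = (y ++ [last l d])%list.
Proof.
  intros H. destruct (exists_last H) as [y [a ->]]. exists y. rewrite last_last. reflexivity.
Qed.

Lemma shuffle_letter_last (c : bool) (y w : word) :
  In w (shuffle [c] (y ++ [c])) -> exists y', w = (y' ++ [c])%list.
Proof.
  revert w; induction y as [|b y IH]; intros w; cbn [app].
  - simpl. intros [<-|[<-|[]]]; exists [c]; reflexivity.
  - change (shuffle [c] (b :: y ++ [c])) with
      ([c :: b :: y ++ [c]] ++ map (cons b) (shuffle [c] (y ++ [c])))%list.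
    intros H. apply in_app_or in H. destruct H as [[<-|[]]|H].
    + exists (c :: b :: y). reflexivity.
    + apply in_map_iff in H. destruct H as [w' [<- H]]. apply IH in H.
      destruct H as [y' ->]. exists (b :: y'). reflexivity.
Qed.

(** Two rounds of [reg_step]: trailing letters false are removed on reversed words, with [Q]
    remembering the initial false, and then leading letters true. This leads to admissible words,
    which begin with false and end with true because [PhiKZ] reverses words. *)
Lemma regularization (J : nat -> ncs) (Zr : ncs) :
  (forall j, glike (J j)) -> glike Zr ->
  Clim (fun j => J j [false]) (Zr [false]) -> Clim (fun j => J j [true]) (Zr [true]) ->
  (forall y, Clim (fun j => J j (false :: y ++ [true])) (Zr (false :: y ++ [true]))) ->
  NClim J Zr.
Proof.
  intros HJ HZ H0 H1 Hadm.
  assert (P1 : forall x, Clim (fun j => J j (false :: x)) (Zr (false :: x))).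
  { intros x.
    destruct (word_split false (rev x ++ [false])) as [a [y [E Hy]]].
    assert (E' : false :: x = rev (repeat false a ++ y)).
    { rewrite <- E, rev_app_distr, rev_involutive. reflexivity. }
    rewrite E'.
    apply (reg_step (fun j w => J j (rev w)) (fun w => Zr (rev w))) with
      (c := false) (Q := fun w => exists z, w = (z ++ [false])%list).
    - intros j; apply glike_rev, HJ.
    - apply glike_rev, HZ.
    - simpl negb. intros y' w [[|t z] Hz]; [discriminate|]. injection Hz as <- ->. intros Hw.
      apply shuffle_letter_last in Hw. destruct Hw as [z' ->]. exists (true :: z'). reflexivity.
    - exact H0.
    - simpl negb. intros y' [z Hz]. rewrite Hz, rev_app_distr. cbn [rev app].
      destruct z as [|t z]; [discriminate|]. injection Hz as <- ->. cbn [rev]. apply Hadm.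
    - destruct Hy as [->|[y' ->]]; [left; reflexivity|right]. exists y'. split; [reflexivity|].
      destruct (@last_snoc _ (negb false :: y') true) as [z Ez]; [discriminate|].
      exists z. revert Ez. generalize (last (negb false :: y') true). intros b Ez.
      rewrite Ez in E |- *. apply (f_equal (fun l => last l true)) in E.
      rewrite app_assoc, !last_last in E. rewrite E. reflexivity. }
  intros w. destruct (word_split true w) as [a [y [-> Hy]]].
  apply (reg_step J Zr) with (c := true) (Q := fun _ => True); auto.
  destruct Hy as [->|[y' ->]]; [left; reflexivity|right]. eauto.
Qed.

(** * Complex power series along real curves *)

Lemma Rder_const (c t : R) : is_derive (fun _ : R => c) t 0.
Proof. apply (is_derive_const (V := R_NormedModule)). Qed.

Lemma Rder_plus (f g : R -> R) (t l m : R) : is_derive f t l -> is_derive g t m ->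
  is_derive (fun t => f t + g t)%R t (l + m)%R.
Proof. intros; apply (is_derive_plus (V := R_NormedModule)); assumption. Qed.

Lemma Rder_minus (f g : R -> R) (t l m : R) : is_derive f t l -> is_derive g t m ->
  is_derive (fun t => f t - g t)%R t (l - m)%R.
Proof. intros; apply (is_derive_minus (V := R_NormedModule)); assumption. Qed.

Lemma Rder_mult (f g : R -> R) (t l m : R) : is_derive f t l -> is_derive g t m ->
  is_derive (fun t => f t * g t)%R t (l * g t + f t * m)%R.
Proof. intros; apply (is_derive_mult (K := R_AbsRing)); auto. apply Rmult_comm. Qed.

Lemma Rder_comp (f g : R -> R) (t l m : R) : is_derive f (g t) l -> is_derive g t m ->
  is_derive (fun t => f (g t)) t (m * l)%R.
Proof. intros Hf Hg. exact (is_derive_comp f g t l m Hf Hg). Qed.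

Definition Cder (f : R -> C) (t : R) (l : C) : Prop :=
  is_derive (fun t => Re (f t)) t (Re l) /\ is_derive (fun t => Im (f t)) t (Im l).

Lemma Cder_const (c : C) (t : R) : Cder (fun _ => c) t 0.
Proof. split; [exact (Rder_const (Re c) t)|exact (Rder_const (Im c) t)]. Qed.

Lemma Cder_eq (f : R -> C) (t : R) (l m : C) : Cder f t l -> l = m -> Cder f t m.
Proof. intros H <-; exact H. Qed.

Lemma Cder_ext (f g : R -> C) (t : R) (l : C) : (forall t, f t = g t) -> Cder f t l -> Cder g t l.
Proof. intros H; replace g with f; auto. apply functional_extensionality; auto. Qed.

Lemma Cder_plus (f g : R -> C) (t : R) (l m : C) :
  Cder f t l -> Cder g t m -> Cder (fun t => f t + g t) t (l + m).
Proof. intros [H1 H2] [H3 H4]; split; apply Rder_plus; assumption. Qed.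

Lemma Cder_mult (f g : R -> C) (t : R) (l m : C) :
  Cder f t l -> Cder g t m -> Cder (fun t => f t * g t) t (l * g t + f t * m).
Proof.
  intros [H1 H2] [H3 H4]; split; evar_last.
  - apply (Rder_minus (fun t => (Re (f t) * Re (g t))%R) (fun t => (Im (f t) * Im (g t))%R));
      apply Rder_mult; eassumption.
  - unfold Re, Im, Cmult, Cplus; cbn [fst snd]. ring.
  - apply (Rder_plus (fun t => (Re (f t) * Im (g t))%R) (fun t => (Im (f t) * Re (g t))%R));
      apply Rder_mult; eassumption.
  - unfold Re, Im, Cmult, Cplus; cbn [fst snd]. ring.
Qed.

Lemma Cder_scal (c : C) (f : R -> C) (t : R) (l : C) :
  Cder f t l -> Cder (fun t => c * f t) t (c * l).
Proof.
  intros H. eapply Cder_eq; [apply Cder_mult; [apply Cder_const|exact H]|]. cbv beta. ring.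
Qed.

Lemma Cder_minus (f g : R -> C) (t : R) (l m : C) :
  Cder f t l -> Cder g t m -> Cder (fun t => f t - g t) t (l - m).
Proof.
  intros H1 H2. eapply Cder_ext with (fun t => f t + RtoC (-1) * g t); [intros; ring|].
  eapply Cder_eq; [apply Cder_plus; [exact H1|apply Cder_scal, H2]|]. ring.
Qed.

Lemma Cder_RtoC (f : R -> R) (t l : R) : is_derive f t l -> Cder (fun t => RtoC (f t)) t (RtoC l).
Proof. intros H; split; [exact H|exact (Rder_const 0 t)]. Qed.

Lemma Cder_conj (f : R -> C) (t : R) (l : C) :
  Cder f t l -> Cder (fun t => Cconj (f t)) t (Cconj l).
Proof.
  intros [H1 H2]; split; [exact H1|]. simpl.
  apply (is_derive_opp (V := R_NormedModule)) in H2. exact H2.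
Qed.

Lemma Cder_csum {A : Type} (f : R -> A -> C) (f' : A -> C) (l : list A) (t : R) :
  (forall x, In x l -> Cder (fun t => f t x) t (f' x)) ->
  Cder (fun t => csum (map (f t) l)) t (csum (map f' l)).
Proof.
  induction l as [|x l IH]; intros H; simpl; [apply Cder_const|].
  apply Cder_plus; [apply H; left; reflexivity|apply IH; intros; apply H; right; assumption].
Qed.

Lemma majorant_R (f f' g g' : R -> R) (a b : R) : a <= b ->
  (forall t, a <= t <= b -> is_derive f t (f' t)) ->
  (forall t, a <= t <= b -> is_derive g t (g' t)) ->
  (forall t, a <= t <= b -> f' t <= g' t) ->
  (f b - f a <= g b - g a)%R.
Proof.
  intros Hab Hf Hg Hle.
  destruct (MVT_gen (fun t => g t - f t)%R a b (fun t => g' t - f' t)%R) as [c [Hc E]].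
  - intros t. rewrite Rmin_left, Rmax_right by lra. intros Ht.
    apply (is_derive_minus (V := R_NormedModule)); [apply Hg|apply Hf]; lra.
  - intros t. rewrite Rmin_left, Rmax_right by lra. intros Ht.
    apply continuity_pt_minus; apply derivable_continuous_pt;
      eexists; apply is_derive_Reals; [apply Hg|apply Hf]; exact Ht.
  - rewrite Rmin_left, Rmax_right in Hc by lra. specialize (Hle c Hc).
    assert (0 <= (g' c - f' c) * (b - a))%R by (apply Rmult_le_pos; lra). lra.
Qed.

Lemma Cmod_Re_Im (z : C) (M : R) : Rabs (Re z) <= M -> Rabs (Im z) <= M -> Cmod z <= 2 * M.
Proof.
  intros H1 H2. assert (0 <= M) by (eapply Rle_trans; [apply Rabs_pos|exact H1]).
  eapply Rle_trans; [apply Cmod_2Rmax|].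
  apply Rmult_le_compat; try apply sqrt_pos.
  - eapply Rle_trans; [apply Rabs_pos|apply Rmax_l].
  - apply Rsqr_incr_0_var; [rewrite Rsqr_sqrt by lra; unfold Rsqr|]; lra.
  - apply Rmax_lub; assumption.
Qed.

Lemma im_le_Cmod (z : C) : Rabs (Im z) <= Cmod z.
Proof. eapply Rle_trans; [|apply Rmax_Cmod]. apply Rmax_r. Qed.

(** Replaces integration: a bound on the derivative is integrated by exhibiting a primitive g of it.
    The 2 is a crude sqrt 2 from treating real and imaginary parts separately. *)
Lemma majorant_C (f f' : R -> C) (g g' : R -> R) (a b : R) : a <= b ->
  (forall t, a <= t <= b -> Cder f t (f' t)) ->
  (forall t, a <= t <= b -> is_derive g t (g' t)) ->
  (forall t, a <= t <= b -> Cmod (f' t) <= g' t) ->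
  Cmod (f b - f a) <= 2 * (g b - g a).
Proof.
  intros Hab Hf Hg Hle.
  assert (K : forall h h' : R -> R, (forall t, a <= t <= b -> is_derive h t (h' t)) ->
    (forall t, a <= t <= b -> Rabs (h' t) <= g' t) -> Rabs (h b - h a) <= g b - g a).
  { intros h h' Hh Hb. apply Rabs_le. split.
    - assert (H := majorant_R (fun t => - h t)%R (fun t => - h' t)%R g g' a b Hab).
      cut (- h b - - h a <= g b - g a)%R; [lra|]. apply H; auto.
      + intros t Ht. apply (is_derive_opp (V := R_NormedModule)), Hh, Ht.
      + intros t Ht. specialize (Hb t Ht). apply Rabs_le_between in Hb. lra.
    - apply (majorant_R h h' g g' a b Hab); auto.
      intros t Ht. specialize (Hb t Ht). apply Rabs_le_between in Hb. lra. }
  apply Cmod_Re_Im; rewrite ?re_plus, ?im_plus; simpl.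
  - apply (K (fun t => Re (f t)) (fun t => Re (f' t))).
    + intros t Ht; apply Hf, Ht.
    + intros t Ht; eapply Rle_trans; [apply re_le_Cmod|apply Hle, Ht].
  - apply (K (fun t => Im (f t)) (fun t => Im (f' t))).
    + intros t Ht; apply Hf, Ht.
    + intros t Ht; eapply Rle_trans; [apply im_le_Cmod|apply Hle, Ht].
Qed.

Lemma Cder_zero (f : R -> C) (a b : R) : a <= b ->
  (forall t, a <= t <= b -> Cder f t 0) -> f b = f a.
Proof.
  intros Hab Hf.
  assert (H := majorant_C f (fun _ => 0) (fun _ => 0%R) (fun _ => 0%R) a b Hab Hf).
  assert (Cmod (f b - f a) <= 2 * (0 - 0)).
  { apply H; intros; [apply Rder_const|rewrite Cmod_0; lra]. }
  assert (E : f b - f a = 0). { apply Cmod_eq_0. assert (G := Cmod_ge_0 (f b - f a)). lra. }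
  replace (f b) with (f b - f a + f a) by ring. rewrite E. ring.
Qed.

(** Lets a second-order estimate of an analytic function be used along a real curve, without a
    notion of complex derivative. *)
Lemma Cder_flat (g u : R -> C) (u' : C) (t0 K delta : R) : 0 < delta -> Cder u t0 u' ->
  (forall t, Rabs (t - t0) < delta -> Cmod (g t - g t0) <= K * Cmod (u t - u t0) ^ 2) ->
  Cder g t0 0.
Proof.
  intros Hd [U1 U2] H.
  (* The square of [Cmod] is a polynomial in the coordinates, hence differentiable even at 0, where
     [Cmod] is not. *)
  set (phi := fun t => (K * ((Re (u t) - Re (u t0)) ^ 2 + (Im (u t) - Im (u t0)) ^ 2))%R).
  assert (Hphi : is_derive phi t0 0).
  { unfold phi. apply is_derive_Reals in U1, U2.
    evar_last.
    { apply is_derive_Reals.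
      apply (derivable_pt_lim_scal (fun t => ((Re (u t) - Re (u t0)) ^ 2
        + (Im (u t) - Im (u t0)) ^ 2)%R) K t0).
      apply (derivable_pt_lim_plus (fun t => ((Re (u t) - Re (u t0)) ^ 2)%R)
        (fun t => ((Im (u t) - Im (u t0)) ^ 2)%R)).
      - apply (derivable_pt_lim_comp (fun t => (Re (u t) - Re (u t0))%R) (fun x => (x ^ 2)%R)).
        + apply (derivable_pt_lim_minus (fun t => Re (u t)) (fun _ => Re (u t0)));
            [exact U1|apply derivable_pt_lim_const].
        + apply derivable_pt_lim_pow.
      - apply (derivable_pt_lim_comp (fun t => (Im (u t) - Im (u t0))%R) (fun x => (x ^ 2)%R)).
        + apply (derivable_pt_lim_minus (fun t => Im (u t)) (fun _ => Im (u t0)));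
            [exact U2|apply derivable_pt_lim_const].
        + apply derivable_pt_lim_pow. }
    simpl. unfold zero; simpl. ring. }
  assert (Z0 : phi t0 = 0%R) by (unfold phi; ring).
  assert (B : forall h : R -> R, (forall t, Rabs (t - t0) < delta ->
    Rabs (h t - h t0) <= phi t) -> is_derive h t0 0).
  { intros h Hh. apply is_derive_Reals. apply is_derive_Reals in Hphi.
    intros eps Heps. destruct (Hphi eps Heps) as [d Hd'].
    exists (mkposreal _ (Rmin_stable_in_posreal d (mkposreal _ Hd))).
    simpl. intros x Hx Hlt.
    assert (L1 : Rabs x < d) by (eapply Rlt_le_trans; [exact Hlt|apply Rmin_l]).
    assert (L2 : Rabs x < delta) by (eapply Rlt_le_trans; [exact Hlt|apply Rmin_r]).
    specialize (Hd' x Hx L1). rewrite Z0 in Hd'.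
    eapply Rle_lt_trans; [|exact Hd'].
    rewrite !Rminus_0_r. unfold Rdiv. rewrite !Rabs_mult.
    apply Rmult_le_compat_r; [apply Rabs_pos|].
    eapply Rle_trans; [|apply Rle_abs]. apply Hh. replace (t0 + x - t0)%R with x by ring.
    exact L2. }
  assert (E : forall t, (K * Cmod (u t - u t0) ^ 2)%R = phi t).
  { intros t. unfold phi. rewrite Cmod2_alt.
    unfold Re, Im, Cminus, Cplus, Copp; cbn [fst snd]. ring. }
  split; simpl; apply B; intros t Ht; rewrite <- E; (eapply Rle_trans; [|apply H, Ht]).
  - replace (Re (g t) - Re (g t0))%R with (Re (g t - g t0)) by reflexivity. apply re_le_Cmod.
  - replace (Im (g t) - Im (g t0))%R with (Im (g t - g t0)) by reflexivity. apply im_le_Cmod.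
Qed.

(** * Complex series, and power series with real coefficients in the unit disc *)

Definition CSer (c : nat -> C) : C := (Series (fun n => Re (c n)), Series (fun n => Im (c n))).
Definition Csummable (c : nat -> C) : Prop := ex_series (fun n => Cmod (c n)).

Lemma ex_series_Rscal (c : R) (a : nat -> R) : ex_series a -> ex_series (fun n => c * a n)%R.
Proof. intros H. exact (ex_series_scal_l (K := R_AbsRing) (V := R_NormedModule) c a H). Qed.

Lemma Csummable_Re (c : nat -> C) : Csummable c -> ex_series (fun n => Re (c n)).
Proof.
  intros H. apply (ex_series_le (K := R_AbsRing) (V := R_CompleteNormedModule)
    _ (fun n => Cmod (c n))); [|exact H]. intros n. apply re_le_Cmod.
Qed.

Lemma Csummable_Im (c : nat -> C) : Csummable c -> ex_series (fun n => Im (c n)).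
Proof.
  intros H. apply (ex_series_le (K := R_AbsRing) (V := R_CompleteNormedModule)
    _ (fun n => Cmod (c n))); [|exact H]. intros n. apply im_le_Cmod.
Qed.

Lemma Csummable_le (c : nat -> C) (b : nat -> R) :
  (forall n, Cmod (c n) <= b n) -> ex_series b -> Csummable c.
Proof.
  intros H Hb. apply (ex_series_le (K := R_AbsRing) (V := R_CompleteNormedModule) _ b); auto.
  intros n. unfold norm; simpl. unfold abs; simpl.
  rewrite Rabs_pos_eq by apply Cmod_ge_0. apply H.
Qed.

Lemma CSer_ext (c d : nat -> C) : (forall n, c n = d n) -> CSer c = CSer d.
Proof. intros H; unfold CSer; f_equal; apply Series_ext; intros; rewrite H; reflexivity. Qed.

Lemma CSer_plus (c d : nat -> C) : Csummable c -> Csummable d ->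
  CSer (fun n => c n + d n) = CSer c + CSer d.
Proof.
  intros Hc Hd. unfold CSer, Cplus; simpl. f_equal.
  - apply Series_plus; apply Csummable_Re; assumption.
  - apply Series_plus; apply Csummable_Im; assumption.
Qed.

Lemma CSer_scal (x : C) (c : nat -> C) : Csummable c -> CSer (fun n => x * c n) = x * CSer c.
Proof.
  intros Hc. assert (H1 := Csummable_Re c Hc). assert (H2 := Csummable_Im c Hc).
  destruct x as [x y]. unfold CSer, Cmult; simpl. f_equal.
  - rewrite Series_minus.
    + rewrite <- !Series_scal_l. reflexivity.
    + apply (ex_series_Rscal x), H1.
    + apply (ex_series_Rscal y), H2.
  - rewrite Series_plus.
    + rewrite <- !Series_scal_l. reflexivity.
    + apply (ex_series_Rscal x), H2.
    + apply (ex_series_Rscal y), H1.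
Qed.

Lemma Csummable_plus (c d : nat -> C) :
  Csummable c -> Csummable d -> Csummable (fun n => c n + d n).
Proof.
  intros Hc Hd. apply Csummable_le with (fun n => Cmod (c n) + Cmod (d n))%R.
  - intros n; apply Cmod_triangle.
  - apply (ex_series_plus (K := R_AbsRing) (V := R_NormedModule)); assumption.
Qed.

Lemma Csummable_scal (x : C) (c : nat -> C) : Csummable c -> Csummable (fun n => x * c n).
Proof.
  intros Hc. apply Csummable_le with (fun n => Cmod x * Cmod (c n))%R.
  - intros n; rewrite Cmod_mult; lra.
  - apply (ex_series_Rscal (Cmod x)), Hc.
Qed.

Lemma CSer_shift (c : nat -> C) : Csummable c -> CSer c = c 0%nat + CSer (fun n => c (S n)).
Proof.
  intros Hc. unfold CSer, Cplus; simpl. f_equal.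
  - apply Series_incr_1, Csummable_Re, Hc.
  - apply Series_incr_1, Csummable_Im, Hc.
Qed.

Lemma Csummable_shift (c : nat -> C) : Csummable c -> Csummable (fun n => c (S n)).
Proof. intros H. apply (ex_series_incr_1 (fun n => Cmod (c n))), H. Qed.

Lemma CSer_bound (c : nat -> C) (b : nat -> R) :
  (forall n, Cmod (c n) <= b n) -> ex_series b -> Cmod (CSer c) <= 2 * Series b.
Proof.
  intros H Hb. assert (Hc := Csummable_le c b H Hb).
  assert (K : forall r : nat -> R, (forall n, Rabs (r n) <= b n) -> Rabs (Series r) <= Series b).
  { intros r Hr.
    assert (Ha : ex_series (fun n => Rabs (r n))).
    { apply (ex_series_le (K := R_AbsRing) (V := R_CompleteNormedModule) _ b); auto.
      intros n. unfold norm; simpl. unfold abs; simpl. rewrite Rabs_Rabsolu. apply Hr. }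
    eapply Rle_trans; [apply Series_Rabs, Ha|].
    apply Series_le; auto. intros n; split; [apply Rabs_pos|apply Hr]. }
  apply Cmod_Re_Im; simpl; apply K; intros n; (eapply Rle_trans; [|apply H]).
  - apply re_le_Cmod.
  - apply im_le_Cmod.
Qed.

(** Unlike boundedness of the coefficients, this form of convergence in the disc is stable under
    multiplication by n, hence under differentiation. *)
Definition adm (a : nat -> R) : Prop :=
  forall rho, 0 <= rho < 1 -> ex_series (fun n => Rabs (a n) * rho ^ n)%R.
Definition PSC (a : nat -> R) (u : C) : C := CSer (fun n => RtoC (a n) * u ^ n).

Lemma adm_le (a b : nat -> R) : (forall n, Rabs (a n) <= Rabs (b n)) -> adm b -> adm a.
Proof.
  intros H Hb rho Hr.
  apply (ex_series_le (K := R_AbsRing) (V := R_CompleteNormedModule) _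
    (fun n => Rabs (b n) * rho ^ n)%R); [|apply Hb, Hr].
  intros n. unfold norm; simpl. unfold abs; simpl.
  rewrite Rabs_mult, Rabs_Rabsolu, (Rabs_pos_eq (rho ^ n)) by (apply pow_le; lra).
  apply Rmult_le_compat_r; [apply pow_le; lra|apply H].
Qed.

Lemma adm_bounded (a : nat -> R) (B : R) : (forall n, Rabs (a n) <= B) -> adm a.
Proof.
  intros H. apply adm_le with (fun _ => B).
  - intros n. eapply Rle_trans; [apply H|apply Rle_abs].
  - intros rho Hr. apply (ex_series_Rscal (Rabs B)).
    apply ex_series_geom. rewrite Rabs_pos_eq; lra.
Qed.

Lemma adm_scal (c : R) (a : nat -> R) : adm a -> adm (fun n => c * a n)%R.
Proof.
  intros Ha rho Hr. apply ex_series_ext with (fun n => Rabs c * (Rabs (a n) * rho ^ n))%R.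
  - intros n. rewrite Rabs_mult. symmetry. apply Rmult_assoc.
  - apply (ex_series_Rscal (Rabs c)), Ha, Hr.
Qed.

(** Each of the n terms of (1 - x^n)/(1 - x) = 1 + ... + x^(n-1) is at least x^n. *)
Lemma pow_INR_bound (x : R) (n : nat) : 0 <= x < 1 -> (INR n * x ^ n * (1 - x) <= 1 - x ^ n)%R.
Proof.
  intros Hx. induction n as [|n IH]; [simpl; lra|].
  rewrite S_INR. simpl. assert (0 <= x ^ n) by (apply pow_le; lra).
  assert (x ^ n <= 1) by (rewrite <- (pow1 n); apply pow_incr; lra).
  assert (0 <= (1 - x) * (1 - x * x ^ n))%R by (apply Rmult_le_pos; nra).
  apply Rmult_le_compat_l with (r := x) in IH; [|lra]. nra.
Qed.

Lemma adm_INR (a : nat -> R) : adm a -> adm (fun n => INR n * a n)%R.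
Proof.
  (* A radius s between rho and 1 leaves room: n (rho/s)^n stays bounded while the series still
     converges at s. *)
  intros Ha rho Hr. set (s := ((1 + rho) / 2)%R). assert (Hs : rho < s < 1) by (unfold s; lra).
  set (x := (rho / s)%R).
  assert (Hx : 0 <= x < 1).
  { unfold x. split; [apply Rdiv_le_0_compat; lra|]. apply Rlt_div_l; lra. }
  apply (ex_series_le (K := R_AbsRing) (V := R_CompleteNormedModule) _
    (fun n => / (1 - x) * (Rabs (a n) * s ^ n))%R).
  - intros n. unfold norm; simpl. unfold abs; simpl.
    rewrite Rabs_mult, Rabs_Rabsolu, Rabs_mult, (Rabs_pos_eq (rho ^ n)) by (apply pow_le; lra).
    rewrite (Rabs_pos_eq (INR n)) by apply pos_INR.
    replace (rho ^ n)%R with (x ^ n * s ^ n)%R.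
    2:{ rewrite <- Rpow_mult_distr. f_equal. unfold x. field. lra. }
    assert (H := pow_INR_bound x n Hx). assert (0 <= x ^ n) by (apply pow_le; lra).
    assert (K : (INR n * x ^ n <= / (1 - x))%R).
    { apply Rmult_le_reg_r with (1 - x)%R; [lra|]. rewrite Rinv_l; lra. }
    assert (0 <= Rabs (a n) * s ^ n)%R.
    { apply Rmult_le_pos; [apply Rabs_pos|apply pow_le; lra]. }
    replace (INR n * Rabs (a n) * (x ^ n * s ^ n))%R with
      ((INR n * x ^ n) * (Rabs (a n) * s ^ n))%R by ring.
    apply Rmult_le_compat_r; assumption.
  - apply (ex_series_Rscal (/ (1 - x))%R). apply Ha. lra.
Qed.

Lemma PSC_summable (a : nat -> R) (u : C) : adm a -> Cmod u < 1 ->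
  Csummable (fun n => RtoC (a n) * u ^ n).
Proof.
  intros Ha Hu. apply Csummable_le with (fun n => Rabs (a n) * Cmod u ^ n)%R.
  - intros n. rewrite Cmod_mult, Cmod_R, Cmod_pow. lra.
  - apply Ha. split; [apply Cmod_ge_0|exact Hu].
Qed.

Lemma PSC_plus (a b : nat -> R) (u : C) : adm a -> adm b -> Cmod u < 1 ->
  PSC (fun n => a n + b n)%R u = PSC a u + PSC b u.
Proof.
  intros Ha Hb Hu. unfold PSC. rewrite <- CSer_plus by (apply PSC_summable; assumption).
  apply CSer_ext. intros n. rewrite RtoC_plus. ring.
Qed.

Lemma PSC_scal (c : R) (a : nat -> R) (u : C) : adm a -> Cmod u < 1 ->
  PSC (fun n => c * a n)%R u = RtoC c * PSC a u.
Proof.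
  intros Ha Hu. unfold PSC. rewrite <- CSer_scal by (apply PSC_summable; assumption).
  apply CSer_ext. intros n. rewrite RtoC_mult. ring.
Qed.

Lemma CSer_conj (c : nat -> C) : CSer (fun n => Cconj (c n)) = Cconj (CSer c).
Proof. apply injective_projections; [reflexivity|apply Series_opp]. Qed.

Lemma PSC_conj (a : nat -> R) (u : C) : PSC a (Cconj u) = Cconj (PSC a u).
Proof.
  unfold PSC. rewrite <- CSer_conj. apply CSer_ext. intros n.
  rewrite Cmult_conj, Cconj_RtoC, Cpow_conj. reflexivity.
Qed.

(** Passing to partial sums multiplies a power series by u / (1 - u): up to sign, the origin of the
    coefficient of X_true in the KZ equation. *)
Lemma PSC_partial_sums (a s : nat -> R) (u : C) : adm a -> adm s ->
  s 0%nat = 0%R -> (forall n, s (S n) = (s n + a n)%R) -> Cmod u < 1 ->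
  PSC s u = u * (PSC a u + PSC s u).
Proof.
  intros Ha Hs H0 HS Hu. unfold PSC at 1.
  rewrite CSer_shift by (apply PSC_summable; assumption).
  rewrite H0, (CSer_ext _ (fun n => u * (RtoC (a n) * u ^ n + RtoC (s n) * u ^ n))).
  - assert (A1 := PSC_summable a u Ha Hu). assert (A2 := PSC_summable s u Hs Hu).
    rewrite CSer_scal by (apply Csummable_plus; assumption).
    rewrite CSer_plus by assumption. unfold PSC. ring.
  - intros n. rewrite HS, RtoC_plus. simpl Cpow. ring.
Qed.

(** Second-order Taylor remainder of the n-th power. The extra factors u and rho on the left raise
    the exponents n - 1 and n - 2 to n, so that no truncated subtraction enters the induction. *)
Lemma pow_remainder (u v : C) (rho : R) (n : nat) :
  0 < rho -> Cmod u <= rho -> Cmod v <= rho ->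
  (rho * Cmod (u * (v ^ n - u ^ n) - RtoC (INR n) * u ^ n * (v - u))
   <= INR n * INR n * rho ^ n * Cmod (v - u) ^ 2)%R.
Proof.
  intros Hr Hu Hv. set (d := Cmod (v - u)).
  assert (Hd : 0 <= d) by apply Cmod_ge_0.
  induction n as [|n IH].
  - simpl. replace (u * (1 - 1) - 0 * 1 * (v - u)) with (RtoC 0) by ring.
    rewrite Cmod_0. lra.
  - replace (u * (v ^ S n - u ^ S n) - RtoC (INR (S n)) * u ^ S n * (v - u)) with
      (v * (u * (v ^ n - u ^ n) - RtoC (INR n) * u ^ n * (v - u))
       + RtoC (INR n) * u ^ n * (v - u) ^ 2).
    2:{ rewrite S_INR, RtoC_plus. simpl Cpow. ring. }
    set (Rn := u * (v ^ n - u ^ n) - RtoC (INR n) * u ^ n * (v - u)) in *.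
    assert (Hn : 0 <= INR n) by apply pos_INR.
    assert (P : Cmod u ^ n <= rho ^ n) by (apply pow_incr; split; [apply Cmod_ge_0|exact Hu]).
    assert (P' : 0 <= rho ^ n) by (apply pow_le; lra).
    assert (T : (Cmod (v * Rn + RtoC (INR n) * u ^ n * (v - u) ^ 2)
      <= rho * Cmod Rn + INR n * rho ^ n * d ^ 2)%R).
    { eapply Rle_trans; [apply Cmod_triangle|]. rewrite !Cmod_mult, !Cmod_pow, Cmod_R. fold d.
      rewrite Rabs_pos_eq by exact Hn. apply Rplus_le_compat.
      - apply Rmult_le_compat_r; [apply Cmod_ge_0|exact Hv].
      - apply Rmult_le_compat_r; [apply pow_le, Hd|]. apply Rmult_le_compat_l; assumption. }
    apply Rmult_le_compat_l with (r := rho) in T; [|lra].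
    apply Rmult_le_compat_l with (r := rho) in IH; [|lra].
    rewrite S_INR. simpl (rho ^ S n)%R.
    assert (0 <= (INR n + 1) * (rho * rho ^ n) * d ^ 2)%R.
    { apply Rmult_le_pos; [|apply pow_le, Hd]. apply Rmult_le_pos; [lra|].
      apply Rmult_le_pos; lra. }
    eapply Rle_trans; [exact T|]. nra.
Qed.

(** [pow_remainder] summed over n; the constant depends only on the radius because n^2 a_n is still
    summable there. *)
Lemma PSC_remainder (a : nat -> R) (rho : R) : adm a -> 0 < rho < 1 ->
  exists K, forall u v, Cmod u <= rho -> Cmod v <= rho ->
  Cmod (u * (PSC a v - PSC a u) - PSC (fun n => INR n * a n)%R u * (v - u))
  <= K * Cmod (v - u) ^ 2.
Proof.
  intros Ha Hr. assert (Ha1 := adm_INR _ Ha). assert (Ha2 := adm_INR _ Ha1).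
  set (b := fun n => (Rabs (INR n * (INR n * a n)) * rho ^ n)%R).
  assert (Hb : ex_series b) by (apply Ha2; lra).
  exists (2 * (/ rho * Series b))%R. intros u v Hu Hv.
  assert (Su := PSC_summable a u Ha ltac:(lra)).
  assert (Sv := PSC_summable a v Ha ltac:(lra)).
  assert (S1 := PSC_summable _ u Ha1 ltac:(lra)).
  set (d2 := (Cmod (v - u) ^ 2)%R).
  assert (E : u * (PSC a v - PSC a u) - PSC (fun n => INR n * a n)%R u * (v - u) =
    CSer (fun n => (u * (RtoC (a n) * v ^ n) + (- u) * (RtoC (a n) * u ^ n))
       + (u - v) * (RtoC (INR n * a n) * u ^ n))).
  { rewrite !CSer_plus, !CSer_scal; auto using Csummable_plus, Csummable_scal.
    unfold PSC. ring. }
  rewrite E.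
  eapply Rle_trans; [apply (CSer_bound _ (fun n => / rho * d2 * b n)%R)|].
  - intros n.
    replace (u * (RtoC (a n) * v ^ n) + - u * (RtoC (a n) * u ^ n)
      + (u - v) * (RtoC (INR n * a n) * u ^ n)) with
      (RtoC (a n) * (u * (v ^ n - u ^ n) - RtoC (INR n) * u ^ n * (v - u))).
    2:{ rewrite RtoC_mult. ring. }
    rewrite Cmod_mult, Cmod_R.
    assert (P := pow_remainder u v rho n (proj1 Hr) Hu Hv). fold d2 in P.
    unfold b. rewrite !Rabs_mult, (Rabs_pos_eq (INR n)) by apply pos_INR.
    apply Rmult_le_reg_l with rho; [lra|].
    replace (rho * (/ rho * d2 * (INR n * (INR n * Rabs (a n)) * rho ^ n)))%R with
      (Rabs (a n) * (INR n * INR n * rho ^ n * d2))%R by (field; lra).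
    rewrite (Rmult_comm rho), Rmult_assoc. apply Rmult_le_compat_l; [apply Rabs_pos|].
    rewrite Rmult_comm. exact P.
  - apply (ex_series_Rscal (/ rho * d2)%R), Hb.
  - rewrite Series_scal_l. apply Req_le. ring.
Qed.

Definition cexp (z : C) : C := (exp (Re z) * cos (Im z), exp (Re z) * sin (Im z))%R.

Lemma Cmod_cexp (z : C) : Cmod (cexp z) = exp (Re z).
Proof.
  assert (E : (Cmod (cexp z) ^ 2)%R = (exp (Re z) ^ 2)%R).
  { rewrite Cmod2_alt. assert (H := sin2_cos2 (Im z)). unfold Rsqr in H.
    transitivity (exp (Re z) ^ 2 *
      (sin (Im z) * sin (Im z) + cos (Im z) * cos (Im z)))%R; [|rewrite H; ring].
    unfold cexp, Re, Im; cbn [fst snd]. ring. }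
  apply Rsqr_inj; [apply Cmod_ge_0|left; apply exp_pos|]. rewrite !Rsqr_pow2. exact E.
Qed.

Lemma cexp_neq_0 (z : C) : cexp z <> 0.
Proof.
  intros H. assert (E := Cmod_cexp z). rewrite H, Cmod_0 in E.
  assert (G := exp_pos (Re z)). lra.
Qed.

Lemma Cder_cexp (z : R -> C) (t : R) (z' : C) : Cder z t z' ->
  Cder (fun t => cexp (z t)) t (z' * cexp (z t)).
Proof.
  intros [H1 H2]. split; evar_last.
  - apply (Rder_mult (fun t => exp (Re (z t))) (fun t => cos (Im (z t)))).
    + apply (Rder_comp exp); [apply is_derive_exp|exact H1].
    + apply (Rder_comp cos); [apply is_derive_cos|exact H2].
  - unfold cexp, Re, Im, Cmult; cbn [fst snd]. ring.
  - apply (Rder_mult (fun t => exp (Re (z t))) (fun t => sin (Im (z t)))).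
    + apply (Rder_comp exp); [apply is_derive_exp|exact H1].
    + apply (Rder_comp sin); [apply is_derive_sin|exact H2].
  - unfold cexp, Re, Im, Cmult; cbn [fst snd]. ring.
Qed.

(** In the logarithmic coordinate u^n has derivative n u^n, with no shift of index, which keeps the
    recurrences for coefficients simple. *)
Lemma Cder_PSC (a : nat -> R) (z : R -> C) (t : R) (z' : C) : adm a -> Cder z t z' ->
  Re (z t) < 0 ->
  Cder (fun t => PSC a (cexp (z t))) t (z' * PSC (fun n => INR n * a n)%R (cexp (z t))).
Proof.
  (* A disc of radius exp m < 1 contains exp (z s) for all s near t, so one remainder constant
     serves. *)
  intros Ha Hz Hneg. set (m := (Re (z t) / 2)%R).
  assert (Hm : exp m < 1) by (rewrite <- exp_0; apply exp_increasing; unfold m; lra).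
  destruct (PSC_remainder a (exp m) Ha) as [K HK]; [split; [apply exp_pos|exact Hm]|].
  assert (Cont : exists delta, 0 < delta /\ forall s, Rabs (s - t) < delta -> Re (z s) < m).
  { destruct Hz as [H1 _]. apply is_derive_Reals in H1.
    assert (Hc : continuity_pt (fun t => Re (z t)) t).
    { apply derivable_continuous_pt. eexists; exact H1. }
    destruct (Hc (m - Re (z t))%R) as [d [Hd Hd']]; [unfold m; lra|].
    exists d; split; [exact Hd|]. intros s Hs.
    destruct (Req_dec s t) as [->|N]; [unfold m; lra|].
    specialize (Hd' s). simpl in Hd'. unfold R_dist in Hd'.
    assert (L : Rabs (Re (z s) - Re (z t)) < m - Re (z t)).
    { apply Hd'. split; [split; [exact I|auto]|exact Hs]. }
    apply Rabs_lt_between in L. lra. }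
  destruct Cont as [delta [Hd Hlt]].
  assert (U := Cder_cexp z t z' Hz). set (u := fun s => cexp (z s)) in *.
  assert (N := cexp_neq_0 (z t)).
  set (Q := PSC (fun n => INR n * a n)%R (u t)).
  (* Subtracting the tangent Q u leaves a quadratic remainder; the factor u t, inherited from
     [pow_remainder], is divided out at the end. *)
  assert (F := Cder_flat (fun s => u t * PSC a (u s) - Q * u s) u _ t K delta Hd U).
  assert (G : Cder (fun s => u t * PSC a (u s) - Q * u s) t 0).
  { apply F. intros s Hs.
    replace (u t * PSC a (u s) - Q * u s - (u t * PSC a (u t) - Q * u t)) with
      (u t * (PSC a (u s) - PSC a (u t)) - Q * (u s - u t)) by ring.
    apply HK; unfold u; rewrite Cmod_cexp.
    - left. apply exp_increasing. unfold m; lra.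
    - left. apply exp_increasing, Hlt, Hs. }
  apply Cder_ext with (fun s => / u t * ((u t * PSC a (u s) - Q * u s) + Q * u s)).
  { intros s. unfold u. field. exact N. }
  eapply Cder_eq; [apply Cder_scal, Cder_plus; [exact G|apply Cder_scal, U]|].
  fold (u t) Q. field. exact N.
Qed.

(** * The local solution of the KZ equation *)

Definition NCder (F : R -> ncs) (t : R) (F' : ncs) : Prop :=
  forall w, Cder (fun t => F t w) t (F' w).

Lemma NCder_eq (F : R -> ncs) (t : R) (F' F'' : ncs) : NCder F t F' -> F' = F'' -> NCder F t F''.
Proof. intros H <-; exact H. Qed.

Lemma NCder_mul (F G : R -> ncs) (t : R) (F' G' : ncs) :
  NCder F t F' -> NCder G t G' ->
  NCder (fun t => F t ** G t) t (ncadd (F' ** G t) (F t ** G')).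
Proof.
  intros HF HG w. unfold ncmul, ncadd. rewrite <- csum_plus.
  apply (Cder_csum (fun t i => F t (firstn i w) * G t (skipn i w))).
  intros i _. apply Cder_mult; [apply HF|apply HG].
Qed.

Lemma NCder_S (F : R -> ncs) (t : R) (F' : ncs) :
  NCder F t F' -> NCder (fun t => ncS (F t)) t (ncS F').
Proof. intros H w. apply Cder_scal, H. Qed.

Lemma NCder_swap (F : R -> ncs) (t : R) (F' : ncs) :
  NCder F t F' -> NCder (fun t => ncswap (F t)) t (ncswap F').
Proof. intros H w. apply H. Qed.

Lemma NCder_conj (F : R -> ncs) (t : R) (F' : ncs) :
  NCder F t F' -> NCder (fun t => ncconj (F t)) t (ncconj F').
Proof. intros H w. apply Cder_conj, H. Qed.

Lemma NCder_sg (F : R -> ncs) (t : R) (F' : ncs) :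
  NCder F t F' -> NCder (fun t => sg (F t)) t (sg F').
Proof.
  intros H w. unfold sg. revert F F' H. induction w as [|a w IH]; intros F F' H; [apply H|].
  assert (K : forall b, Cder (fun t => sg_at w (lsh b (F t))) t (sg_at w (lsh b F'))).
  { intros b. apply IH. intros v. apply H. }
  destruct a; simpl; [apply Cder_minus; apply K|].
  eapply Cder_ext; [|eapply Cder_eq; [apply Cder_scal with (c := RtoC (-1)), (K false)|]].
  - intros s; cbv beta; ring.
  - ring.
Qed.

Lemma Cder_expc (z : R -> C) (t : R) (z' : C) (n : nat) : Cder z t z' ->
  Cder (fun t => expc (z t) (S n)) t (z' * expc (z t) n).
Proof.
  intros Hz.
  assert (E : forall c n, expc c (S n) = / RtoC (INR (S n)) * (c * expc c n)).
  { intros c m. rewrite <- expc_S, Cmult_assoc, Cinv_l by apply S_C_neq_0. ring. }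
  induction n as [|n IH].
  - apply Cder_ext with z; [|eapply Cder_eq; [exact Hz|]].
    + intros s. unfold expc; simpl. field.
    + unfold expc; simpl. field.
  - eapply Cder_ext; [intros s; symmetry; apply E|].
    eapply Cder_eq; [apply Cder_scal, Cder_mult; [exact Hz|exact IH]|].
    cbv beta. rewrite (S_INR (S n)), RtoC_plus.
    transitivity (/ (RtoC (INR (S n)) + 1) * (z' * expc (z t) (S n) + z' * (z t * expc (z t) n)));
      [ring|]. rewrite <- expc_S.
    assert (D := S_C_neq_0 (S n)). rewrite (S_INR (S n)), RtoC_plus in D. field. exact D.
Qed.

Lemma NCder_exp (b : bool) (z : R -> C) (t : R) (z' : C) : Cder z t z' ->
  NCder (fun t => ncexp b (z t)) t (ncscal z' (nclet b ** ncexp b (z t))).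
Proof.
  intros Hz [|a w]; unfold ncscal.
  - rewrite ncmul_let_l_nil. apply Cder_ext with (fun _ => 1).
    + intros s; symmetry; apply ncexp_nil.
    + eapply Cder_eq; [apply Cder_const|ring].
  - rewrite ncmul_let_l, ncexp_unfold.
    apply Cder_ext with (fun t => if forallb (fun x => Bool.eqb x b) (a :: w)
      then expc (z t) (S (length w)) else 0); [reflexivity|].
    cbn [forallb]. destruct (Bool.eqb a b), (forallb _ w); cbn [andb].
    + apply Cder_expc, Hz.
    + eapply Cder_eq; [apply Cder_const|ring].
    + eapply Cder_eq; [apply Cder_const|ring].
    + eapply Cder_eq; [apply Cder_const|ring].
Qed.

(** The device for integrating identities from u = 0: the function is constant on the negative axis
    of log u, and its value is read off along a sequence. *)
Lemma Cder_zero_lim (f : R -> C) (l : C) (s : nat -> R) :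
  (forall t, t < 0 -> Cder f t 0) -> (forall j, s j < 0) ->
  is_lim_seq s m_infty -> Clim (fun j => f (s j)) l ->
  forall t, t < 0 -> f t = l.
Proof.
  intros Hf Hs Hlim Hl t Ht.
  assert (E : forall a b, a < 0 -> b < 0 -> f b = f a).
  { intros a b Ha Hb. destruct (Rle_dec a b) as [L|L].
    - apply Cder_zero; [exact L|]. intros; apply Hf; lra.
    - symmetry. apply Cder_zero; [lra|]. intros; apply Hf; lra. }
  eapply Clim_unique; [|exact Hl].
  apply Clim_ext with (fun _ => f t); [|apply Clim_const].
  intros j. apply E; [apply Hs|exact Ht].
Qed.

(** The n-th term is excluded, which matches the strict inequalities in [mzv_partial]. *)
Definition psum (a : nat -> R) (n : nat) : R := rsum (map a (seq 0 n)).

Lemma rsum_app (l l' : list R) : rsum (l ++ l') = (rsum l + rsum l')%R.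
Proof. induction l as [|x l IH]; simpl; [|rewrite IH]; ring. Qed.

Lemma psum_S (a : nat -> R) (n : nat) : psum a (S n) = (psum a n + a n)%R.
Proof. unfold psum. rewrite seq_S, map_app, rsum_app. simpl. ring. Qed.

(* Coefficient of [u ^ n] in the solution [L] of
   [u L' = (X_false + u / (u - 1) X_true) L - L X_false], [L(0) = 1];
   the fuel is the length of the word. The letters false and true carry the residues at [u = 0]
   and [u = 1]; as [u = 1 - z], these are [X_1] and [X_0] in the series [PhiRS]. *)
Fixpoint lcoef_fuel (f : nat) (w : word) (n : nat) : R :=
  match f with
  | O => match n with O => 1 | S _ => 0 end
  | S f' =>
    match n with
    | O => 0
    | S _ =>
      ((match w with
        | [] => 0
        | false :: v => lcoef_fuel f' v n
        | true :: v => - psum (lcoef_fuel f' v) n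
        end) - (if last w true then 0 else lcoef_fuel f' (removelast w) n)) / INR n
    end
  end.
Definition lcoef (w : word) : nat -> R := lcoef_fuel (length w) w.

Lemma lcoef_0 (w : word) : lcoef w 0 = match w with [] => 1%R | _ => 0%R end.
Proof. destruct w; reflexivity. Qed.

Lemma length_removelast (a : bool) (v : word) : length (removelast (a :: v)) = length v.
Proof.
  rewrite removelast_firstn_len, length_firstn. simpl. lia.
Qed.

(** Multiplied out by n, the recurrence holds for n = 0 as well: at the word [false] the two
    contributions of X_false cancel, since the constant term 1 commutes with X_false. *)
Lemma lcoef_rec (a : bool) (v : word) (n : nat) :
  (INR n * lcoef (a :: v) n = (if a then - psum (lcoef v) n else lcoef v n)
    - (if last (a :: v) true then 0 else lcoef (removelast (a :: v)) n))%R.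
Proof.
  destruct n as [|n].
  - rewrite !lcoef_0. destruct v as [|b v].
    + destruct a; unfold psum; simpl; ring.
    + change (removelast (a :: b :: v)) with (a :: removelast (b :: v)).
      destruct a, (last _ _); unfold psum; simpl; ring.
  - unfold lcoef at 1.
    cbn [length lcoef_fuel].
    unfold lcoef. rewrite length_removelast. destruct a; field; apply not_0_INR; lia.
Qed.

Lemma psum_bound (a : nat -> R) (B : R) (n : nat) :
  (forall m, Rabs (a m) <= B) -> (Rabs (psum a n) <= INR n * B)%R.
Proof.
  intros H. induction n as [|n IH].
  - unfold psum; simpl. rewrite Rabs_R0. lra.
  - rewrite psum_S, S_INR. eapply Rle_trans; [apply Rabs_triang|]. specialize (H n). lra.
Qed.

(** The division by n compensates a partial sum of n bounded terms; two such contributions per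
    letter give the powers of 2. *)
Lemma lcoef_bound (w : word) (n : nat) : Rabs (lcoef w n) <= 2 ^ length w.
Proof.
  revert n. remember (length w) as k eqn:Hk. revert w Hk.
  induction k as [|k IH]; intros w Hk n.
  - destruct w; [|discriminate]. destruct n; unfold lcoef; simpl; rewrite ?Rabs_R0, ?Rabs_R1; lra.
  - destruct w as [|a v]; [discriminate|]. injection Hk as Hk.
    assert (P : (0 < 2 ^ k)%R) by (apply pow_lt; lra).
    destruct n as [|n].
    { rewrite lcoef_0, Rabs_R0. apply pow_le; lra. }
    assert (Hn : (1 <= INR (S n))%R) by (rewrite S_INR; assert (H := pos_INR n); lra).
    apply Rmult_le_reg_l with (INR (S n)); [lra|].
    rewrite <- (Rabs_pos_eq (INR (S n))) at 1 by lra.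
    rewrite <- Rabs_mult, lcoef_rec.
    assert (B1 : Rabs (if a then - psum (lcoef v) (S n) else lcoef v (S n))
                 <= INR (S n) * 2 ^ k).
    { destruct a.
      - rewrite Rabs_Ropp. apply psum_bound. apply IH, Hk.
      - eapply Rle_trans; [apply IH, Hk|]. nra. }
    assert (B2 : Rabs (if last (a :: v) true then 0 else lcoef (removelast (a :: v)) (S n))
                 <= INR (S n) * 2 ^ k).
    { destruct (last _ _); [rewrite Rabs_R0; nra|].
      eapply Rle_trans; [apply IH|nra]. rewrite length_removelast. exact Hk. }
    unfold Rminus. eapply Rle_trans; [apply Rabs_triang|]. rewrite Rabs_Ropp. simpl pow. lra.
Qed.

Lemma adm_lcoef (w : word) : adm (lcoef w).
Proof. apply adm_bounded with (2 ^ length w)%R, lcoef_bound. Qed.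

Lemma adm_psum_lcoef (w : word) : adm (psum (lcoef w)).
Proof.
  apply adm_le with (fun n => INR n * 2 ^ length w)%R.
  - intros n. eapply Rle_trans; [apply psum_bound, lcoef_bound|apply Rle_abs].
  - apply (adm_INR (fun _ => (2 ^ length w)%R)). apply adm_bounded with (Rabs (2 ^ length w)).
    intros; lra.
Qed.

Definition Lser (u : C) : ncs := fun w => PSC (lcoef w) u.

(** The connection in the coordinate log u, whence the factor u. *)
Definition KZop (u : C) : ncs := ncadd (nclet false) (ncscal (u / (u - 1)) (nclet true)).

Lemma ncmul_let_r_last (b : bool) (F : ncs) (w : word) :
  (F ** nclet b) w = if Bool.eqb (last w (negb b)) b then F (removelast w) else 0.
Proof.
  destruct w as [|a v].
  - rewrite ncmul_let_r_nil. destruct b; reflexivity.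
  - destruct (@exists_last _ (a :: v)) as [x [c ->]]; [discriminate|].
    rewrite ncmul_let_r, last_last, removelast_last. reflexivity.
Qed.

Lemma Cmod_lt_1_neq (u : C) : Cmod u < 1 -> 1 - u <> 0.
Proof.
  intros H E. assert (u = 1) as -> by (replace u with (1 - (1 - u)) by ring; rewrite E; ring).
  rewrite Cmod_1 in H. lra.
Qed.

Lemma Lser_ode (u : C) (w : word) : Cmod u < 1 ->
  PSC (fun n => INR n * lcoef w n)%R u =
  (KZop u ** Lser u) w - (Lser u ** nclet false) w.
Proof.
  intros Hu. unfold KZop. rewrite ncmul_add_l, ncmul_scal_l. unfold ncadd, ncscal.
  destruct w as [|a v].
  - rewrite !ncmul_let_l_nil, ncmul_let_r_nil.
    transitivity (PSC (fun n => 0 * lcoef [] n)%R u).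
    + apply CSer_ext. intros n. f_equal. f_equal. destruct n as [|n].
      * simpl INR. ring.
      * change (lcoef [] (S n)) with 0%R. ring.
    + rewrite (PSC_scal 0 (lcoef [])) by (auto using adm_lcoef). ring.
  - rewrite !ncmul_let_l, ncmul_let_r_last.
    (* Absent terms get the coefficient 0 and present ones 1 or -1, so that linearity covers all
       cases at once. *)
    set (hd := fun n => (if a then -1 * psum (lcoef v) n else 1 * lcoef v n)%R).
    set (tl := fun n => ((if last (a :: v) true then 0 else 1)
      * lcoef (removelast (a :: v)) n)%R).
    assert (Ahd : adm hd).
    { unfold hd. destruct a; apply adm_scal; [apply adm_psum_lcoef|apply adm_lcoef]. }
    assert (Atl : adm tl) by (apply adm_scal, adm_lcoef).
    transitivity (PSC (fun n => hd n + -1 * tl n)%R u).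
    { apply CSer_ext. intros n. do 2 f_equal. rewrite lcoef_rec. unfold hd, tl.
      destruct a, (last _ _); ring. }
    rewrite PSC_plus, PSC_scal by (auto using adm_scal).
    assert (E2 : PSC tl u = if Bool.eqb (last (a :: v) (negb false)) false
      then Lser u (removelast (a :: v)) else 0).
    { unfold tl. rewrite PSC_scal by (auto using adm_lcoef). simpl negb.
      destruct (last (a :: v) true); simpl Bool.eqb; cbv iota; unfold Lser; ring. }
    rewrite E2.
    assert (E1 : PSC hd u = if a then u / (u - 1) * Lser u v else Lser u v).
    { unfold hd. destruct a; rewrite PSC_scal by (auto using adm_psum_lcoef, adm_lcoef).
      - assert (E := PSC_partial_sums (lcoef v) (psum (lcoef v)) u (adm_lcoef v)
          (adm_psum_lcoef v) eq_refl (psum_S _) Hu).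
        assert (N := Cmod_lt_1_neq u Hu).
        assert (N' : u - 1 <> 0).
        { intros E0. apply N. replace (1 - u) with (- (u - 1)) by ring. rewrite E0. ring. }
        replace (PSC (psum (lcoef v)) u) with (u / (1 - u) * PSC (lcoef v) u).
        + unfold Lser. field. split; assumption.
        + set (p := PSC (psum (lcoef v)) u) in *. set (q := PSC (lcoef v) u) in *.
          apply (f_equal (fun x => (x - u * p) / (1 - u))) in E.
          transitivity ((u * (q + p) - u * p) / (1 - u)); [field; exact N|].
          rewrite <- E. field. exact N.
      - unfold Lser. ring. }
    rewrite E1. destruct a; simpl Bool.eqb; cbv iota; ring.
Qed.

Lemma PSC_const (a : nat -> R) (u : C) : (forall n, a (S n) = 0%R) -> adm a -> Cmod u < 1 ->
  PSC a u = RtoC (a 0%nat).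
Proof.
  intros H Ha Hu. unfold PSC. rewrite CSer_shift by (apply PSC_summable; assumption).
  rewrite (CSer_ext _ (fun n => 0 * (RtoC (a (S n)) * u ^ S n))).
  - rewrite CSer_scal; [simpl; ring|].
    apply (Csummable_shift (fun n => RtoC (a n) * u ^ n)), PSC_summable; assumption.
  - intros n. rewrite H. ring.
Qed.

Lemma Lser_near_one (u : C) (w : word) : Cmod u < 1 ->
  Cmod (Lser u w - ncone w) <= 2 * (2 ^ length w * Cmod u / (1 - Cmod u)).
Proof.
  intros Hu. assert (H0 := Cmod_ge_0 u). destruct w as [|a v].
  - unfold Lser. rewrite PSC_const by (auto using adm_lcoef). unfold ncone.
    change (lcoef [] 0) with 1%R. replace (1 - 1) with (RtoC 0) by ring. rewrite Cmod_0.
    apply Rmult_le_pos; [lra|]. apply Rdiv_le_0_compat; [simpl; lra|lra].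
  - unfold Lser, PSC. rewrite CSer_shift by (apply PSC_summable; auto using adm_lcoef).
    rewrite lcoef_0. unfold ncone.
    set (w := a :: v). set (B := (2 ^ length w)%R).
    match goal with |- Cmod ?x <= _ =>
      replace x with (CSer (fun n => RtoC (lcoef w (S n)) * u ^ S n)) by ring end.
    eapply Rle_trans; [apply (CSer_bound _ (fun n => (B * Cmod u) * Cmod u ^ n)%R)|].
    + intros n. rewrite Cmod_mult, Cmod_R, Cmod_pow. simpl pow. rewrite Rmult_assoc.
      apply Rmult_le_compat_r; [|apply lcoef_bound].
      apply Rmult_le_pos; [|apply pow_le]; exact H0.
    + apply ex_series_Rscal, ex_series_geom. rewrite Rabs_pos_eq; assumption.
    + rewrite Series_scal_l, Series_geom by (rewrite Rabs_pos_eq; assumption).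
      apply Req_le. unfold Rdiv. ring.
Qed.

(* In the logarithmic coordinate [z] with [u = exp z], so that [u ^ X_false = exp (z X_false)] is
   single-valued. *)
Definition Gsol (z : C) : ncs := Lser (cexp z) ** ncexp false z.

Lemma NCder_Lser (z : R -> C) (t : R) (z' : C) : Cder z t z' -> Re (z t) < 0 ->
  NCder (fun t => Lser (cexp (z t))) t
    (ncscal z' (ncadd (KZop (cexp (z t)) ** Lser (cexp (z t)))
      (ncscal (-1) (Lser (cexp (z t)) ** nclet false)))).
Proof.
  intros Hz Hneg w.
  eapply Cder_eq; [apply Cder_PSC; eauto using adm_lcoef|].
  rewrite Lser_ode.
  - unfold ncscal, ncadd. ring.
  - rewrite Cmod_cexp, <- exp_0. apply exp_increasing, Hneg.
Qed.

(** The term - L X_false in the equation of [Lser] cancels against the derivative of u^X_false. *)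
Lemma NCder_Gsol (z : R -> C) (t : R) (z' : C) : Cder z t z' -> Re (z t) < 0 ->
  NCder (fun t => Gsol (z t)) t (ncscal z' (KZop (cexp (z t)) ** Gsol (z t))).
Proof.
  intros Hz Hneg. unfold Gsol.
  eapply NCder_eq; [apply NCder_mul; [apply NCder_Lser; eassumption|apply NCder_exp, Hz]|].
  rewrite ncmul_scal_l, ncmul_scal_r, ncmul_add_l, ncmul_scal_l, !ncmul_assoc.
  apply functional_extensionality; intros w; unfold ncscal, ncadd. ring.
Qed.

(** Letters are primitive: multiplying a character by one gives a derivation. The letter uses up a
    position, so multiplicativity of F is asked on shorter pairs only, as inductions on length
    require. *)
Lemma ssum_let_l (c : bool) (F : ncs) (u v : word) : F [] = 1 ->
  (forall u' v', (length u' + length v' < length u + length v)%nat ->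
     ssum F u' v' = F u' * F v') ->
  ssum (nclet c ** F) u v = (nclet c ** F) u * F v + F u * (nclet c ** F) v.
Proof.
  intros F1 HF. destruct u as [|a u].
  { rewrite ssum_nil_l, ncmul_let_l_nil, F1. ring. }
  destruct v as [|b v].
  { rewrite ssum_nil_r, ncmul_let_l_nil, F1. ring. }
  assert (E : forall a, lsh a (nclet c ** F) = ncscal (if Bool.eqb a c then 1 else 0) F).
  { intros d; apply functional_extensionality; intros w. unfold lsh, ncscal.
    rewrite ncmul_let_l. destruct (Bool.eqb d c); ring. }
  rewrite ssum_cons, !E, !ssum_scal, !ncmul_let_l, !HF by (simpl; lia).
  destruct (Bool.eqb a c), (Bool.eqb b c); ring.
Qed.

Lemma ssum_let_r (c : bool) (F : ncs) (u v : word) : F [] = 1 ->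
  (forall u' v', (length u' + length v' < length u + length v)%nat ->
     ssum F u' v' = F u' * F v') ->
  ssum (F ** nclet c) u v = (F ** nclet c) u * F v + F u * (F ** nclet c) v.
Proof.
  intros F1 HF. destruct u as [|a0 u0].
  { rewrite ssum_nil_l, ncmul_let_r_nil, F1. ring. }
  destruct v as [|b0 v0].
  { rewrite ssum_nil_r, ncmul_let_r_nil, F1. ring. }
  destruct (@exists_last _ (a0 :: u0)) as [u [a Eu]]; [discriminate|].
  destruct (@exists_last _ (b0 :: v0)) as [v [b Ev]]; [discriminate|].
  rewrite Eu, Ev in *.
  assert (E : forall a, rsh a (F ** nclet c) = ncscal (if Bool.eqb a c then 1 else 0) F).
  { intros d; apply functional_extensionality; intros w. unfold rsh, ncscal.
    rewrite ncmul_let_r. destruct (Bool.eqb d c); ring. }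
  rewrite ssum_snoc, !E, !ssum_scal, !ncmul_let_r, !HF by (rewrite !length_app; simpl; lia).
  destruct (Bool.eqb a c), (Bool.eqb b c); ring.
Qed.

Lemma cexp_RtoC (t : R) : cexp (RtoC t) = RtoC (exp t).
Proof.
  unfold cexp, RtoC, Re, Im; cbn [fst snd]. rewrite cos_0, sin_0. f_equal; ring.
Qed.

Lemma neg_seq (j : nat) : (- (INR j + 1) < 0)%R.
Proof. assert (H := pos_INR j). lra. Qed.

Lemma neg_seq_lim : is_lim_seq (fun j => - (INR j + 1))%R m_infty.
Proof.
  apply (is_lim_seq_opp _ p_infty).
  apply is_lim_seq_ext with (fun j => INR (S j)); [intros; apply S_INR|].
  apply (is_lim_seq_incr_1 INR p_infty), is_lim_seq_INR.
Qed.

Lemma exp_neg_seq_lim : is_lim_seq (fun j => exp (- (INR j + 1)))%R 0%R.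
Proof.
  apply (is_lim_comp_seq exp _ m_infty 0%R).
  - apply is_lim_exp_m.
  - exists 0%nat. intros; discriminate.
  - apply neg_seq_lim.
Qed.

Lemma exp_neg_lt_1 (t : R) : t < 0 -> 0 < exp t < 1.
Proof.
  intros H; split; [apply exp_pos|]. rewrite <- exp_0. apply exp_increasing, H.
Qed.

Lemma Clim_bound (f : nat -> C) (l : C) (b : nat -> R) :
  (forall j, Cmod (f j - l) <= b j) -> is_lim_seq b 0%R -> Clim f l.
Proof.
  intros H Hb.
  assert (K : forall (h : nat -> R) (m : R), (forall j, Rabs (h j - m) <= b j) ->
    is_lim_seq h m).
  { intros h m Hh.
    apply is_lim_seq_le_le with (fun j => m - b j)%R (fun j => m + b j)%R.
    - intros j. specialize (Hh j). apply Rabs_le_between in Hh. lra.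
    - replace (Finite m) with (Finite (m - 0)%R) by (f_equal; ring).
      apply is_lim_seq_minus'; [apply is_lim_seq_const|exact Hb].
    - replace (Finite m) with (Finite (m + 0)%R) by (f_equal; ring).
      apply is_lim_seq_plus'; [apply is_lim_seq_const|exact Hb]. }
  split; apply K; intros j; (eapply Rle_trans; [|apply H]).
  - replace (Re (f j) - Re l)%R with (Re (f j - l)) by reflexivity. apply re_le_Cmod.
  - replace (Im (f j) - Im l)%R with (Im (f j - l)) by reflexivity. apply im_le_Cmod.
Qed.

Lemma exp_m1_le_half : exp (-1) <= / 2.
Proof.
  replace (-1)%R with (- (1))%R by ring. rewrite exp_Ropp. apply Rinv_le_contravar; [lra|].
  assert (H := exp_ineq1_le 1). lra.
Qed.

Lemma exp_neg_seq_half (j : nat) : exp (- (INR j + 1)) <= / 2.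
Proof.
  eapply Rle_trans; [|apply exp_m1_le_half].
  assert (H := pos_INR j). destruct (Req_dec (- (INR j + 1)) (-1)) as [->|N]; [lra|].
  left. apply exp_increasing. lra.
Qed.

Lemma NClim_Lser : NClim (fun j => Lser (cexp (RtoC (- (INR j + 1))))) ncone.
Proof.
  (* The 4 bounds 2 / (1 - e) for e at most 1/2. *)
  intros w. apply Clim_bound with (fun j => (4 * 2 ^ length w) * exp (- (INR j + 1)))%R.
  - intros j. assert (H := exp_neg_lt_1 _ (neg_seq j)). assert (H2 := exp_neg_seq_half j).
    rewrite cexp_RtoC. set (e := exp (- (INR j + 1))) in *.
    assert (E : Cmod (RtoC e) = e) by (rewrite Cmod_R, Rabs_pos_eq; lra).
    eapply Rle_trans; [apply Lser_near_one; lra|]. rewrite E.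
    assert (P : (0 < 2 ^ length w)%R) by (apply pow_lt; lra).
    apply Rmult_le_reg_r with (1 - e)%R; [lra|]. unfold Rdiv.
    replace (2 * (2 ^ length w * e * / (1 - e)) * (1 - e))%R with (2 * (2 ^ length w * e))%R
      by (field; lra).
    assert (0 < 2 ^ length w * e)%R by (apply Rmult_lt_0_compat; lra).
    nra.
  - replace (Finite 0) with (Rbar_mult (4 * 2 ^ length w)%R (Finite 0)).
    + apply is_lim_seq_scal_l, exp_neg_seq_lim.
    + simpl. f_equal. ring.
Qed.

Lemma Cder_id (t : R) : Cder (fun t => RtoC t) t 1.
Proof. apply Cder_RtoC. apply (is_derive_id (K := R_AbsRing)). Qed.

Lemma Cder_ssum (F : R -> ncs) (t : R) (F' : ncs) (u v : word) : NCder F t F' ->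
  Cder (fun t => ssum (F t) u v) t (ssum F' u v).
Proof. intros H. apply (Cder_csum (fun t w => F t w)). intros w _. apply H. Qed.

(** By induction on the total length the defect of multiplicativity has zero derivative, every term
    of the equation acting as a derivation; the defect tends to 0 at u = 0. *)
Lemma Lser_glike (t : R) : t < 0 -> glike (Lser (cexp (RtoC t))).
Proof.
  set (F := fun t => Lser (cexp (RtoC t))).
  assert (F1 : forall t, t < 0 -> F t [] = 1).
  { intros s Hs. unfold F, Lser. rewrite PSC_const; auto using adm_lcoef.
    rewrite Cmod_cexp. apply exp_neg_lt_1, Hs. }
  enough (H : forall n u v t, (length u + length v < n)%nat -> t < 0 ->
    ssum (F t) u v = F t u * F t v).
  { intros Ht. split; [apply F1, Ht|]. intros u v.
    apply (H (S (length u + length v))); [lia|exact Ht]. }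
  induction n as [|n IH]; intros u v s L Hs; [lia|].
  enough (E : ssum (F s) u v - F s u * F s v = 0).
  { replace (ssum (F s) u v) with (ssum (F s) u v - F s u * F s v + F s u * F s v) by ring.
    rewrite E. ring. }
  apply (Cder_zero_lim (fun t => ssum (F t) u v - F t u * F t v) 0
    (fun j => - (INR j + 1))%R); auto using neg_seq, neg_seq_lim.
  - intros x Hx.
    assert (D := NCder_Lser RtoC x 1 (Cder_id x) Hx). fold (F x) in D.
    eapply Cder_eq.
    { apply Cder_minus; [apply Cder_ssum, D|]. apply Cder_mult; apply D. }
    unfold KZop. rewrite ncmul_add_l, ncmul_scal_l.
    rewrite ssum_scal, !ssum_add, !ssum_scal.
    rewrite !ssum_let_l, ssum_let_r;
      try (apply F1, Hx); try (intros; apply IH; [lia|exact Hx]).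
    unfold ncscal, ncadd. fold (F x). cbv beta. ring.
  - replace (RtoC 0) with (ssum ncone u v - ncone u * ncone v).
    + apply Clim_minus.
      * apply (Clim_csum (fun j w => F (- (INR j + 1))%R w)). intros w _. apply NClim_Lser.
      * apply Clim_mult; apply NClim_Lser.
    + rewrite <- (ncexp_0 true). destruct (glike_exp true 0) as [_ ->]. ring.
Qed.

Lemma Gsol_glike (t : R) : t < 0 -> glike (Gsol (RtoC t)).
Proof. intros Ht. apply glike_mul; [apply Lser_glike, Ht|apply glike_exp]. Qed.

Lemma ncS_KZop (u : C) : ncS (KZop u) = ncscal (-1) (KZop u).
Proof.
  unfold KZop. rewrite ncS_add, ncS_scal, !ncS_let.
  apply functional_extensionality; intros w; unfold ncadd, ncscal; ring.
Qed.

(** The connection terms cancel, so T = S(L) L - 1 satisfies T' = X_false T - T X_false. At a word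
    this involves T only at shorter words, hence vanishes by induction. *)
Lemma ncS_Lser (t : R) : t < 0 -> ncS (Lser (cexp (RtoC t))) ** Lser (cexp (RtoC t)) = ncone.
Proof.
  set (F := fun t => Lser (cexp (RtoC t))). intros Ht. fold (F t).
  set (T := fun t => ncadd (ncS (F t) ** F t) (ncscal (-1) ncone)).
  assert (D : forall t, t < 0 -> NCder (fun t => ncS (F t) ** F t) t
    (ncadd (nclet false ** T t) (ncscal (-1) (T t ** nclet false)))).
  { intros x Hx. assert (D := NCder_Lser RtoC x 1 (Cder_id x) Hx).
    eapply NCder_eq; [apply NCder_mul; [apply NCder_S, D|exact D]|].
    fold (F x). rewrite !ncS_scal, ncS_add, ncS_scal, !ncS_mul, ncS_KZop, ncS_let.
    unfold T.
    repeat rewrite ?ncmul_add_l, ?ncmul_add_r, ?ncmul_scal_l, ?ncmul_scal_r, ?ncmul_assoc,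
      ?ncmul_1_l, ?ncmul_1_r.
    apply functional_extensionality; intros w; unfold ncadd, ncscal; ring. }
  enough (H : forall n w t, (length w < n)%nat -> t < 0 -> (ncS (F t) ** F t) w = ncone w).
  { apply functional_extensionality; intros w. apply (H (S (length w))); [lia|exact Ht]. }
  induction n as [|n IH]; intros w s L Hs; [lia|].
  apply (Cder_zero_lim (fun t => (ncS (F t) ** F t) w) (ncone w)
    (fun j => - (INR j + 1))%R); auto using neg_seq, neg_seq_lim.
  - intros x Hx. eapply Cder_eq; [apply (D x Hx)|].
    assert (Z0 : forall v, (length v < n)%nat -> T x v = 0).
    { intros v Lv. unfold T, ncadd, ncscal. rewrite IH by assumption. ring. }
    unfold ncadd, ncscal. rewrite ncmul_let_r_last. destruct w as [|a v].
    + rewrite ncmul_let_l_nil. simpl. ring.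
    + simpl in L. rewrite ncmul_let_l, !Z0 by (rewrite ?length_removelast; lia).
      destruct (Bool.eqb a false), (Bool.eqb (last _ _) false); ring.
  - assert (E : ncone = ncS ncone ** ncone) by (rewrite ncS_one, ncmul_1_l; reflexivity).
    enough (L' : NClim (fun j => ncS (F (- (INR j + 1))%R) ** F (- (INR j + 1))%R)
      (ncS ncone ** ncone)) by (rewrite <- E in L'; apply L').
    apply (NClim_mul (fun j => ncS (F (- (INR j + 1))%R)) (fun j => F (- (INR j + 1))%R));
      [apply NClim_S|]; apply NClim_Lser.
Qed.

Lemma ncS_Gsol (t : R) : t < 0 -> ncS (Gsol (RtoC t)) ** Gsol (RtoC t) = ncone.
Proof.
  intros Ht. unfold Gsol. rewrite ncS_mul, ncmul_assoc, <- (ncmul_assoc _ (ncS (Lser _))).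
  rewrite ncS_Lser by exact Ht. rewrite ncmul_1_r, ncS_exp. apply ncexp_inv'.
Qed.

(** * Asymptotics at u = 1: the KZ associator *)

Lemma rsum_plus {A : Type} (f g : A -> R) (l : list A) :
  rsum (map (fun x => f x + g x)%R l) = (rsum (map f l) + rsum (map g l))%R.
Proof. induction l as [|x l IH]; simpl; [|rewrite IH]; ring. Qed.

Lemma rsum_scal {A : Type} (c : R) (f : A -> R) (l : list A) :
  rsum (map (fun x => c * f x)%R l) = (c * rsum (map f l))%R.
Proof. induction l as [|x l IH]; simpl; [|rewrite IH]; ring. Qed.

Lemma rsum_ext {A : Type} (f g : A -> R) (l : list A) :
  (forall x, In x l -> f x = g x) -> rsum (map f l) = rsum (map g l).
Proof.
  induction l as [|x l IH]; simpl; intros H; auto. rewrite (H x), IH; auto.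
Qed.

Lemma rsum_triangle (f : nat -> nat -> R) (a N : nat) :
  rsum (map (fun i => rsum (map (f i) (seq (S i) (N - S i)))) (seq (S a) (N - S a))) =
  rsum (map (fun n => rsum (map (fun i => f i n) (seq (S a) (n - S a)))) (seq (S a) (N - S a))).
Proof.
  induction N as [|N IH]; [reflexivity|].
  destruct (Compare_dec.le_lt_dec (S a) N) as [L|L].
  - replace (S N - S a)%nat with (S (N - S a)) by lia.
    rewrite seq_S, !map_app, !rsum_app. replace (S a + (N - S a))%nat with N by lia.
    rewrite <- IH. cbn [map rsum]. rewrite Nat.sub_diag. cbn [seq map rsum].
    rewrite (rsum_ext _ (fun i => rsum (map (f i) (seq (S i) (N - S i))) + f i N)%R).
    + rewrite rsum_plus. ring.
    + intros i Hi. apply in_seq in Hi. replace (S N - S i)%nat with (S (N - S i)) by lia.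
      rewrite seq_S, map_app, rsum_app. replace (S i + (N - S i))%nat with N by lia.
      simpl. ring.
  - replace (S N - S a)%nat with 0%nat by lia. reflexivity.
Qed.

(** [mzv_partial] recurses on the smallest summation index, the coefficients of [Lser] on the
    largest; an exchange of summations links the two. *)
Lemma mzv_partial_snoc (k : list nat) (q a N : nat) :
  mzv_partial (k ++ [q]) a N =
  rsum (map (fun n => / (INR n ^ q) * mzv_partial k a n)%R (seq (S a) (N - S a))).
Proof.
  revert a N; induction k as [|k1 k IH]; intros a N; [reflexivity|].
  cbn [app mzv_partial].
  rewrite (rsum_ext _ (fun i => rsum (map (fun n =>
    / (INR n ^ q) * (/ (INR i ^ k1) * mzv_partial k i n))%R (seq (S i) (N - S i))))).
  - rewrite rsum_triangle. apply rsum_ext. intros n _. rewrite rsum_scal. reflexivity.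
  - intros i _. rewrite IH, <- rsum_scal. apply rsum_ext. intros n _. ring.
Qed.

Lemma ek_app (k k' : list nat) : ek (k ++ k') = (ek k ++ ek k')%list.
Proof.
  induction k as [|k1 k IH]; simpl; [reflexivity|]. rewrite IH, app_assoc. reflexivity.
Qed.

Lemma rev_repeat {A : Type} (x : A) (n : nat) : rev (repeat x n) = repeat x n.
Proof.
  induction n as [|n IH]; [reflexivity|]. simpl. rewrite IH. symmetry. apply repeat_cons.
Qed.

Lemma rev_ek_snoc (k : list nat) (q : nat) :
  rev (ek (k ++ [q])) = (repeat false (q - 1) ++ true :: rev (ek k))%list.
Proof.
  rewrite ek_app, rev_app_distr. simpl. rewrite app_nil_r, rev_repeat, <- app_assoc.
  reflexivity.
Qed.

Lemma last_rev_ek (k : list nat) : last (rev (ek k)) true = true.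
Proof. destruct k; [reflexivity|]. simpl. apply last_last. Qed.

(** Each leading false divides by n. The final letter true switches off the term - L X_false, so the
    coefficient is a pure iterated sum. *)
Lemma lcoef_block (m : nat) (v : word) (n : nat) : last (true :: v) true = true ->
  (INR n ^ S m * lcoef (repeat false m ++ true :: v) n = - psum (lcoef v) n)%R.
Proof.
  intros Hv. induction m as [|m IH].
  - cbn [repeat app]. rewrite <- tech_pow_Rmult, pow_O, Rmult_1_r, lcoef_rec, Hv. ring.
  - cbn [repeat app]. rewrite <- IH, <- (tech_pow_Rmult (INR n) (S m)).
    rewrite (Rmult_comm (INR n)), Rmult_assoc, lcoef_rec.
    assert (E : last (false :: repeat false m ++ true :: v) true = true).
    { destruct (@exists_last _ (true :: v)) as [y [b Eb]]; [discriminate|].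
      rewrite Eb, last_last in Hv. rewrite Eb, app_comm_cons, app_assoc, last_last. exact Hv. }
    rewrite E. ring.
Qed.

(** Each letter true contributes a factor -1 through - [psum]. For N = 0 the empty index would fail:
    its [psum] is 0 and its [mzv_partial] is 1. *)
Lemma lcoef_ek_psum (k : list nat) : is_index k -> forall N, (1 <= N)%nat ->
  psum (lcoef (rev (ek k))) N = ((-1) ^ dep k * mzv_partial k 0 N)%R.
Proof.
  induction k as [|q k IH] using rev_ind; intros Hk N HN.
  - unfold psum. destruct N as [|N]; [lia|]. cbn [seq map rsum rev ek].
    rewrite <- seq_shift, map_map.
    rewrite (rsum_ext _ (fun _ => 0 * 0)%R), rsum_scal.
    + unfold lcoef; simpl. ring.
    + intros; unfold lcoef; simpl. ring.
  - apply Forall_app in Hk. destruct Hk as [Hk Hq]. inversion Hq as [|? ? Hq' _]; subst.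
    specialize (IH Hk). rewrite mzv_partial_snoc, rev_ek_snoc.
    unfold psum. destruct N as [|N]; [lia|].
    change (seq 0 (S N)) with (0%nat :: seq 1 N). cbn [map rsum].
    replace (S N - 1)%nat with N by lia.
    rewrite lcoef_0. replace (match (repeat false (q - 1) ++ true :: rev (ek k))%list with
      [] => 1%R | _ => 0%R end) with 0%R by (destruct (repeat false (q - 1)); reflexivity).
    rewrite <- rsum_scal, Rplus_0_l. apply rsum_ext. intros n Hn. apply in_seq in Hn.
    assert (Hn0 : INR n <> 0%R) by (apply not_0_INR; lia).
    assert (E := lcoef_block (q - 1) (rev (ek k)) n).
    replace (S (q - 1)) with q in E by lia.
    apply Rmult_eq_reg_l with (INR n ^ q)%R; [|apply pow_nonzero, Hn0].
    rewrite E.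
    + rewrite IH by lia. unfold dep. rewrite length_app. simpl length.
      rewrite pow_add. simpl. field. apply pow_nonzero, Hn0.
    + assert (L := last_rev_ek k). destruct (rev (ek k)); [reflexivity|exact L].
Qed.

Lemma mzv_partial_pos (k : list nat) (a N : nat) : 0 <= mzv_partial k a N.
Proof.
  revert a; induction k as [|k1 k IH]; intros a; simpl; [lra|].
  assert (P : forall l : list nat, (forall n, In n l -> (0 < n)%nat) ->
    0 <= rsum (map (fun n => / (INR n ^ k1) * mzv_partial k n N)%R l)).
  { induction l as [|n l IHl]; intros Hl; simpl; [lra|].
    apply Rplus_le_le_0_compat; [|apply IHl; intros; apply Hl; right; assumption].
    apply Rmult_le_pos; [|apply IH]. left. apply Rinv_0_lt_compat, pow_lt, lt_0_INR, Hl.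
    left; reflexivity. }
  apply P. intros n Hn. apply in_seq in Hn. lia.
Qed.

Lemma mzv_partial_snoc_S (k : list nat) (q N : nat) : (1 <= N)%nat ->
  mzv_partial (k ++ [q]) 0 (S N) =
  (mzv_partial (k ++ [q]) 0 N + / (INR N ^ q) * mzv_partial k 0 N)%R.
Proof.
  intros HN. rewrite !mzv_partial_snoc. replace (S N - 1)%nat with (S (N - 1)) by lia.
  rewrite seq_S, map_app, rsum_app. replace (1 + (N - 1))%nat with N by lia. simpl. ring.
Qed.

Lemma inv_pow_le (x : R) (p q : nat) : 1 <= x -> (p <= q)%nat -> / (x ^ q) <= / (x ^ p).
Proof.
  intros Hx Hpq. apply Rinv_le_contravar; [apply pow_lt; lra|]. apply Rle_pow; assumption.
Qed.

(** The true growth is polylogarithmic; the square root is chosen because 1/sqrt(n) is at most 2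
    (sqrt(n) - sqrt(n - 1)), so that the induction telescopes. *)
Lemma mzv_partial_sqrt (k : list nat) : is_index k -> forall N, (1 <= N)%nat ->
  mzv_partial k 0 N <= 2 ^ length k * sqrt (INR N).
Proof.
  induction k as [|q k IH] using rev_ind; intros Hk N HN.
  - simpl. rewrite Rmult_1_l, <- sqrt_1. apply sqrt_le_1_alt.
    change 1%R with (INR 1). apply le_INR, HN.
  - apply Forall_app in Hk. destruct Hk as [Hk Hq]. inversion Hq as [|? ? Hq' _]; subst.
    specialize (IH Hk). rewrite length_app. simpl length. rewrite pow_add, pow_1.
    set (B := (2 ^ length k)%R) in *. assert (HB : 0 < B) by (apply pow_lt; lra).
    destruct N as [|N]; [lia|]. clear HN.
    enough (H : mzv_partial (k ++ [q]) 0 (S N) <= B * 2 * sqrt (INR N)).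
    { eapply Rle_trans; [exact H|]. apply Rmult_le_compat_l; [lra|].
      apply sqrt_le_1_alt, le_INR; lia. }
    induction N as [|N IHN].
    + rewrite mzv_partial_snoc. simpl. rewrite sqrt_0. lra.
    + rewrite mzv_partial_snoc_S by lia.
      specialize (IH (S N) ltac:(lia)).
      assert (Hs : (1 <= INR (S N))%R) by (rewrite S_INR; assert (H := pos_INR N); lra).
      assert (H1 := inv_pow_le _ 1 q Hs Hq'). rewrite pow_1 in H1.
      assert (P := mzv_partial_pos k 0 (S N)).
      set (s := sqrt (INR (S N))) in *. set (s' := sqrt (INR N)) in *.
      assert (Hs2 : (s * s = INR (S N))%R) by (apply sqrt_sqrt; lra).
      assert (Hs2' : (s' * s' = INR N)%R) by (apply sqrt_sqrt, pos_INR).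
      assert (Ps : 0 < s) by (apply sqrt_lt_R0; lra).
      assert (Ps' : 0 <= s') by apply sqrt_pos.
      assert (Hle : s' <= s) by (apply sqrt_le_1_alt, le_INR; lia).
      rewrite S_INR in Hs2.
      assert (T : (/ (INR (S N) ^ q) * mzv_partial k 0 (S N) <= B * / s)%R).
      { replace (B * / s)%R with (/ (s * s) * (B * s))%R by (field; lra).
        apply Rmult_le_compat; [|exact P| |exact IH].
        - left. apply Rinv_0_lt_compat, pow_lt. lra.
        - rewrite Hs2, <- S_INR. exact H1. }
      assert (U : (/ s <= 2 * (s - s'))%R).
      { apply Rmult_le_reg_l with s; [exact Ps|]. rewrite Rinv_r by lra. nra. }
      nra.
Qed.

(** By [mzv_partial_sqrt] the increments are of order n^(-3/2), dominated by differences of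
    4/sqrt(n); the induction therefore carries the sharper bound with the factor 1 - 1/sqrt(n). *)
Lemma mzv_partial_bounded (k : list nat) (q : nat) : is_index k -> (2 <= q)%nat ->
  forall N, mzv_partial (k ++ [q]) 0 N <= 4 * 2 ^ length k.
Proof.
  intros Hk Hq N. set (B := (2 ^ length k)%R). assert (HB : 0 < B) by (apply pow_lt; lra).
  destruct N as [|N].
  { rewrite mzv_partial_snoc. simpl. lra. }
  enough (H : mzv_partial (k ++ [q]) 0 (S N) <= 4 * B * (1 - / sqrt (INR (S N)))).
  { assert (0 < / sqrt (INR (S N))).
    { apply Rinv_0_lt_compat, sqrt_lt_R0, lt_0_INR. lia. }
    nra. }
  induction N as [|N IHN].
  - rewrite mzv_partial_snoc. simpl. rewrite sqrt_1, Rinv_1. lra.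
  - rewrite mzv_partial_snoc_S by lia.
    assert (IH := mzv_partial_sqrt k Hk (S N) ltac:(lia)). fold B in IH.
    assert (Hs : (1 <= INR (S N))%R) by (rewrite S_INR; assert (H := pos_INR N); lra).
    assert (H1 := inv_pow_le _ 2 q Hs Hq).
    assert (P := mzv_partial_pos k 0 (S N)).
    rewrite (S_INR (S N)) in *. set (x := INR (S N)) in *.
    set (s := sqrt x) in *. set (t := sqrt (x + 1)%R).
    assert (Hs2 : (s * s = x)%R) by (apply sqrt_sqrt; lra).
    assert (Ht2 : (t * t = x + 1)%R) by (apply sqrt_sqrt; lra).
    assert (Ps : 1 <= s) by (rewrite <- sqrt_1; apply sqrt_le_1_alt; exact Hs).
    assert (Hle : s <= t) by (apply sqrt_le_1_alt; lra).
    assert (Hle2 : t <= 3 / 2 * s) by nra.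
    assert (T : (/ (x ^ q) * mzv_partial k 0 (S N) <= B * / (s * s * s))%R).
    { replace (B * / (s * s * s))%R with (/ (x ^ 2) * (B * s))%R.
      - apply Rmult_le_compat; [|exact P|exact H1|exact IH].
        left. apply Rinv_0_lt_compat, pow_lt. lra.
      - rewrite <- Hs2. field. lra. }
    assert (U : (/ (s * s * s) <= 4 * (/ s - / t))%R).
    { assert (E : (/ s - / t = / (s * t * (s + t)))%R).
      { replace (/ s - / t)%R with ((t * t - s * s) / (s * t * (s + t)))%R by (field; lra).
        replace (t * t - s * s)%R with 1%R by lra. unfold Rdiv. ring. }
      rewrite E.
      replace (4 * / (s * t * (s + t)))%R with (/ (s * t * (s + t) / 4))%R
        by (field; repeat split; nra).
      apply Rinv_le_contravar; [|nra].
      apply Rdiv_lt_0_compat; [|lra]. repeat apply Rmult_lt_0_compat; lra. }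
    nra.
Qed.

Lemma mzv_partial_cv (k : list nat) (q : nat) : is_index k -> (2 <= q)%nat ->
  is_lim_seq (mzv_partial (k ++ [q]) 0) (zeta (k ++ [q])).
Proof.
  intros Hk Hq.
  assert (H : ex_finite_lim_seq (mzv_partial (k ++ [q]) 0)).
  { apply ex_finite_lim_seq_incr with (4 * 2 ^ length k)%R.
    - intros n. destruct n as [|n].
      + rewrite !mzv_partial_snoc. simpl. lra.
      + rewrite (mzv_partial_snoc_S k q (S n)) by lia.
        assert (P := mzv_partial_pos k 0 (S n)).
        assert (0 < / (INR (S n) ^ q))%R.
        { apply Rinv_0_lt_compat, pow_lt, lt_0_INR. lia. }
        nra.
    - apply mzv_partial_bounded; assumption. }
  destruct H as [l Hl]. unfold zeta.
  change (fun N => mzv_partial (k ++ [q]) 0 N) with (mzv_partial (k ++ [q]) 0).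
  rewrite (is_lim_seq_unique _ _ Hl). exact Hl.
Qed.

Lemma psum_sum_n (a : nat -> R) (n : nat) : psum a (S n) = sum_n a n.
Proof.
  induction n as [|n IH].
  - rewrite sum_O. unfold psum; simpl. ring.
  - rewrite sum_Sn, <- IH, psum_S. reflexivity.
Qed.

Lemma Series_ge_psum (b : nat -> R) (N : nat) : (forall n, 0 <= b n) -> ex_series b ->
  psum b N <= Series b.
Proof.
  intros Hb Hex.
  assert (M : forall n, psum b n <= psum b (S n)).
  { intros n. rewrite psum_S. specialize (Hb n). lra. }
  eapply Rle_trans; [apply M|]. rewrite psum_sum_n.
  apply (is_lim_seq_incr_compare (sum_n b)).
  - apply Series_correct in Hex. exact Hex.
  - intros n. rewrite <- !psum_sum_n. apply M.
Qed.

Lemma Series_le_bound (b : nat -> R) (M : R) : ex_series b ->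
  (forall N, psum b N <= M) -> Series b <= M.
Proof.
  intros Hex HM.
  apply (is_lim_seq_le (sum_n b) (fun _ => M) (Series b) M).
  - intros n. rewrite <- psum_sum_n. apply HM.
  - apply Series_correct in Hex. exact Hex.
  - apply is_lim_seq_const.
Qed.

Lemma psum_lim (f : nat -> nat -> R) (g : nat -> R) (N : nat) :
  (forall n, is_lim_seq (fun j => f j n) (g n)) ->
  is_lim_seq (fun j => psum (f j) N) (psum g N).
Proof.
  intros H. induction N as [|N IH].
  - apply is_lim_seq_const.
  - rewrite psum_S. apply is_lim_seq_ext with (fun j => psum (f j) N + f j N)%R.
    + intros j. rewrite psum_S. reflexivity.
    + apply is_lim_seq_plus'; auto.
Qed.

Lemma pow_lim (x : nat -> R) (l : R) (n : nat) : is_lim_seq x l ->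
  is_lim_seq (fun j => x j ^ n)%R (l ^ n)%R.
Proof.
  intros H. induction n as [|n IH]; [apply is_lim_seq_const|].
  simpl. apply is_lim_seq_mult'; assumption.
Qed.

(** Abel's theorem; for nonnegative coefficients it follows by monotonicity, with l as upper bound
    and a truncation at N as lower bound. *)
Lemma Abel_nonneg (a x : nat -> R) (l : R) : (forall n, 0 <= a n) ->
  is_lim_seq (psum a) l -> (forall j, 0 <= x j < 1) -> is_lim_seq x 1%R -> adm a ->
  is_lim_seq (fun j => Series (fun n => a n * x j ^ n)%R) l.
Proof.
  intros Ha Hl Hx Hx1 Hadm.
  assert (Hex : forall j, ex_series (fun n => a n * x j ^ n)%R).
  { intros j. apply ex_series_ext with (2 := Hadm (x j) (Hx j)).
    intros n. rewrite Rabs_pos_eq; auto. }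
  assert (Hm : forall N, psum a N <= l).
  { intros N. apply (is_lim_seq_incr_compare (psum a)); [exact Hl|].
    intros n. rewrite psum_S. specialize (Ha n). lra. }
  assert (Hp : forall j n, 0 <= x j ^ n <= 1).
  { intros j n. specialize (Hx j). split; [apply pow_le; lra|].
    rewrite <- (pow1 n). apply pow_incr. lra. }
  apply is_lim_seq_spec. intros eps.
  apply is_lim_seq_spec in Hl.
  assert (He2 : 0 < eps / 2) by (destruct eps; simpl; lra).
  destruct (Hl (mkposreal _ He2)) as [N HN]. specialize (HN N (le_n N)). simpl in HN.
  assert (HT : is_lim_seq (fun j => psum (fun n => a n * x j ^ n)%R N) (psum a N)).
  { replace (psum a N) with (psum (fun n => a n * 1 ^ n)%R N).
    - apply (psum_lim (fun j n => a n * x j ^ n)%R). intros n.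
      apply is_lim_seq_mult'; [apply is_lim_seq_const|apply pow_lim, Hx1].
    - unfold psum. apply rsum_ext. intros n _. rewrite pow1. ring. }
  apply is_lim_seq_spec in HT. destruct (HT (mkposreal _ He2)) as [j0 Hj0].
  exists j0. intros j Hj. specialize (Hj0 j Hj). simpl in Hj0.
  assert (U : Series (fun n => a n * x j ^ n)%R <= l).
  { apply Series_le_bound; [apply Hex|]. intros M. eapply Rle_trans; [|apply (Hm M)].
    induction M as [|M IH]; [unfold psum; simpl; lra|].
    rewrite !psum_S. apply Rplus_le_compat; [exact IH|].
    specialize (Ha M). specialize (Hp j M). nra. }
  assert (V := Series_ge_psum (fun n => a n * x j ^ n)%R N
    (fun n => Rmult_le_pos _ _ (Ha n) (proj1 (Hp j n))) (Hex j)).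
  apply Rabs_lt_between in HN, Hj0. apply Rabs_lt_between. lra.
Qed.

Lemma PSC_RtoC (a : nat -> R) (x : R) : PSC a (RtoC x) = RtoC (Series (fun n => a n * x ^ n)%R).
Proof.
  assert (E : forall n, RtoC (a n) * RtoC x ^ n = RtoC (a n * x ^ n)).
  { intros n. rewrite <- RtoC_pow, <- RtoC_mult. reflexivity. }
  unfold PSC. rewrite (CSer_ext _ _ E). unfold CSer, RtoC. f_equal.
  cbn [Im snd]. rewrite (Series_ext _ (fun n => 0 * 0)%R) by (intros; simpl; ring).
  rewrite Series_scal_l. ring.
Qed.

(** A word ending in true is cut into blocks false^(q - 1) true, the first of which belongs to the
    last entry of the index; a leading false thus means q >= 2. The default of [hd] excludes the
    empty word from that clause. *)
Lemma word_index (w : word) : last w true = true ->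
  exists k, is_index k /\ w = rev (ek k) /\
    (hd true w = false -> exists k' q, k = (k' ++ [q])%list /\ (2 <= q)%nat).
Proof.
  enough (H : forall n w, (length w <= n)%nat -> last w true = true ->
    exists k, is_index k /\ w = rev (ek k) /\
    (hd true w = false -> exists k' q, k = (k' ++ [q])%list /\ (2 <= q)%nat)).
  { apply (H (length w)); auto. }
  clear w. induction n as [|n IH]; intros w L Hw.
  - destruct w; [|simpl in L; lia]. exists []. repeat split; [constructor|discriminate].
  - destruct w as [|c w'].
    { exists []. repeat split; [constructor|discriminate]. }
    destruct (word_split false (c :: w')) as [a [x [E Hx]]]. rewrite E in *.
    destruct Hx as [->|[v ->]].
    { exfalso. rewrite app_nil_r in *. destruct a as [|a]; [discriminate|].
      simpl repeat in Hw. rewrite (repeat_cons a false) in Hw. rewrite last_last in Hw.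
      discriminate. }
    cbn [negb] in *. rewrite length_app in L. simpl in L.
    destruct (IH v) as [k [Hk [Ek _]]]; [lia| |].
    { destruct v as [|b v]; [reflexivity|].
      destruct (@exists_last _ (b :: v)) as [y [d Ed]]; [discriminate|].
      rewrite Ed, app_comm_cons, app_assoc, !last_last in *. exact Hw. }
    exists (k ++ [S a])%list. split; [|split].
    + apply Forall_app. split; [exact Hk|]. constructor; [lia|constructor].
    + rewrite rev_ek_snoc, <- Ek. simpl. rewrite Nat.sub_0_r. reflexivity.
    + intros Hh. exists k, (S a). split; [reflexivity|].
      destruct a as [|a]; [discriminate Hh|lia].
Qed.

(** With this choice - ln(epsj) is exactly j + 1, the exponent of the regularizing factors. [lxj j]
    is the logarithmic coordinate of u = 1 - epsj. *)
Definition epsj (j : nat) : R := exp (- (INR j + 1)).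
Definition lxj (j : nat) : R := ln (1 - epsj j).

Lemma epsj_bounds (j : nat) : 0 < epsj j <= / 2.
Proof. split; [apply exp_pos|apply exp_neg_seq_half]. Qed.

Lemma epsj_lim : is_lim_seq epsj 0%R.
Proof. apply exp_neg_seq_lim. Qed.

Lemma exp_lxj (j : nat) : exp (lxj j) = (1 - epsj j)%R.
Proof. apply exp_ln. assert (H := epsj_bounds j). lra. Qed.

Lemma lxj_neg (j : nat) : lxj j < 0.
Proof.
  unfold lxj. rewrite <- ln_1. assert (H := epsj_bounds j). apply ln_increasing; lra.
Qed.

Lemma xj_lim : is_lim_seq (fun j => 1 - epsj j)%R 1%R.
Proof.
  replace (Finite 1) with (Finite (1 - 0)%R) by (f_equal; ring).
  apply is_lim_seq_minus'; [apply is_lim_seq_const|apply epsj_lim].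
Qed.

Lemma lxj_lim : is_lim_seq lxj 0%R.
Proof.
  rewrite <- ln_1. apply is_lim_seq_continuous; [|apply xj_lim].
  apply derivable_continuous_pt. exists (/ 1)%R. apply derivable_pt_lim_ln. lra.
Qed.

Definition Jseq (j : nat) : ncs := ncexp true (RtoC (INR j + 1)) ** Gsol (RtoC (lxj j)).

Lemma Jseq_glike (j : nat) : glike (Jseq j).
Proof. apply glike_mul; [apply glike_exp|apply Gsol_glike, lxj_neg]. Qed.

(** A regularizing exponential is invisible on words beginning with the other letter; together with
    the mirror statement, admissible words are left untouched. *)
Lemma ncexp_mul_other (b : bool) (c : C) (F : ncs) (w : word) :
  (ncexp b c ** F) (negb b :: w) = F (negb b :: w).
Proof.
  rewrite ncmul_cons, ncexp_nil.
  replace (lsh (negb b) (ncexp b c)) with (ncscal 0 F).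
  - rewrite ncmul_scal_l. unfold ncscal. ring.
  - apply functional_extensionality; intros v. unfold lsh, ncscal. rewrite ncexp_unfold.
    destruct b; simpl; ring.
Qed.

Lemma ncmul_exp_other (b : bool) (c : C) (F : ncs) (w : word) :
  (F ** ncexp b c) (w ++ [negb b]) = F (w ++ [negb b]).
Proof.
  rewrite ncmul_snoc, ncexp_nil.
  replace (rsh (negb b) (ncexp b c)) with (ncscal 0 F).
  - rewrite ncmul_scal_r. unfold ncscal. ring.
  - apply functional_extensionality; intros v. unfold rsh, ncscal. rewrite ncexp_unfold.
    rewrite forallb_app. replace (forallb _ [negb b]) with false by (destruct b; reflexivity).
    rewrite Bool.andb_false_r. ring.
Qed.

Lemma ncmul_letter (F G : ncs) (a : bool) : (F ** G) [a] = F [] * G [a] + F [a] * G [].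
Proof. rewrite ncmul_cons, ncmul_nil. reflexivity. Qed.

Lemma Lser_nil (u : C) : Cmod u < 1 -> Lser u [] = 1.
Proof. intros Hu. unfold Lser. rewrite PSC_const; auto using adm_lcoef. Qed.

Lemma Cmod_cexp_lt (z : C) : Re z < 0 -> Cmod (cexp z) < 1.
Proof. intros H. rewrite Cmod_cexp, <- exp_0. apply exp_increasing, H. Qed.

Lemma Lser_false (u : C) : Cmod u < 1 -> Lser u [false] = 0.
Proof.
  intros Hu. assert (E : forall n, lcoef [false] n = (0 * lcoef [] n)%R).
  { intros n. destruct n as [|n]; [unfold lcoef; simpl; ring|].
    apply Rmult_eq_reg_l with (INR (S n)); [|apply not_0_INR; lia].
    rewrite lcoef_rec. simpl last. cbv iota. simpl removelast. ring. }
  unfold Lser, PSC. rewrite (CSer_ext _ (fun n => RtoC (0 * lcoef [] n) * u ^ n)).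
  - fold (PSC (fun n => 0 * lcoef [] n)%R u).
    rewrite (PSC_scal 0 (lcoef [])) by auto using adm_lcoef. ring.
  - intros n. rewrite E. reflexivity.
Qed.

(** This logarithm is the divergence at u = 1 that the factor exp((j + 1) X_true) of [Jseq]
    removes. *)
Lemma Lser_true (t : R) : t < 0 -> Lser (cexp (RtoC t)) [true] = RtoC (ln (1 - exp t)).
Proof.
  intros Ht. enough (E : Lser (cexp (RtoC t)) [true] - RtoC (ln (1 - exp t)) = 0).
  { replace (Lser (cexp (RtoC t)) [true]) with
      (Lser (cexp (RtoC t)) [true] - RtoC (ln (1 - exp t)) + RtoC (ln (1 - exp t))) by ring.
    rewrite E. ring. }
  apply (Cder_zero_lim (fun t => Lser (cexp (RtoC t)) [true] - RtoC (ln (1 - exp t))) 0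
    (fun j => - (INR j + 1))%R); auto using neg_seq, neg_seq_lim.
  - intros x Hx. assert (Hb := exp_neg_lt_1 x Hx).
    eapply Cder_eq.
    { apply Cder_minus; [apply (NCder_Lser RtoC x 1 (Cder_id x) Hx)|].
      apply Cder_RtoC, (Rder_comp ln (fun t => 1 - exp t)%R).
      - apply is_derive_Reals, derivable_pt_lim_ln. lra.
      - apply (Rder_minus (fun _ => 1%R) exp); [apply Rder_const|apply is_derive_exp]. }
    unfold KZop. rewrite ncmul_add_l, ncmul_scal_l. unfold ncscal, ncadd.
    rewrite !ncmul_let_l, ncmul_let_r_last. simpl Bool.eqb. cbv iota.
    rewrite Lser_nil by (apply Cmod_cexp_lt, Hx).
    rewrite cexp_RtoC. rewrite RtoC_mult, RtoC_inv, !RtoC_minus by lra. set (e := RtoC (exp x)).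
    assert (N : 1 - e <> 0).
    { apply Cmod_lt_1_neq. unfold e. rewrite Cmod_R, Rabs_pos_eq; lra. }
    assert (N' : e - 1 <> 0).
    { intros E0. apply N. replace (1 - e) with (- (e - 1)) by ring. rewrite E0. ring. }
    field. split; assumption.
  - replace (RtoC 0) with (ncone [true] - RtoC (ln (1 - 0))).
    + apply Clim_minus; [apply NClim_Lser|]. split; cbn [Re Im RtoC fst snd].
      * rewrite Rminus_0_r, ln_1. apply lxj_lim.
      * apply is_lim_seq_const.
    + rewrite Rminus_0_r, ln_1. unfold ncone. ring.
Qed.

Lemma Clim_RtoC (f : nat -> R) (l : R) : is_lim_seq f l -> Clim (fun j => RtoC (f j)) (RtoC l).
Proof. intros H; split; [exact H|apply is_lim_seq_const]. Qed.

Lemma Jseq_lim (Z : word -> C) : Zsh_spec Z -> NClim Jseq (PhiKZ Z).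
Proof.
  intros [Z1 [Zsh [Zadm [Z0f Z0t]]]]. unfold PhiKZ.
  assert (Hu : forall j, Cmod (cexp (RtoC (lxj j))) < 1).
  { intros j. apply Cmod_cexp_lt, lxj_neg. }
  apply regularization.
  - apply Jseq_glike.
  - apply (glike_rev Z). split; [exact Z1|exact Zsh].
  - cbn [rev app]. rewrite Z0f. unfold Jseq, Gsol.
    apply Clim_ext with (fun j => RtoC (lxj j)); [|apply Clim_RtoC, lxj_lim].
    intros j. rewrite (ncexp_mul_other true), ncmul_letter, Lser_false, Lser_nil by apply Hu.
    rewrite ncexp_unfold. cbn. unfold expc. simpl. field.
  - cbn [rev app]. rewrite Z0t. unfold Jseq, Gsol.
    apply Clim_ext with (fun _ => RtoC 0); [|apply Clim_const].
    intros j. rewrite ncmul_letter, ncmul_letter, ncmul_nil, Lser_nil by apply Hu.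
    rewrite Lser_true by apply lxj_neg. rewrite exp_lxj, !ncexp_nil, !ncexp_unfold.
    replace (1 - (1 - epsj j))%R with (epsj j) by ring. unfold epsj. rewrite ln_exp.
    cbn. unfold expc. simpl. rewrite !RtoC_opp, !RtoC_plus. field.
  - intros y. destruct (word_index (false :: y ++ [true])) as [k [Hk [Ek Hq]]].
    { rewrite app_comm_cons, last_last. reflexivity. }
    destruct (Hq eq_refl) as [k' [q [-> Hq2]]]. clear Hq.
    rewrite Ek, rev_involutive, Zadm; [|exact Hk|].
    2:{ right. rewrite last_last. exact Hq2. }
    apply Forall_app in Hk. destruct Hk as [Hk' Hk2].
    set (k := (k' ++ [q])%list) in *. set (w := rev (ek k)) in *.
    (* Removing the sign (-1)^dep makes the coefficients nonnegative, as [Abel_nonneg] needs. *)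
    set (a := fun n => ((-1) ^ dep k * lcoef w n)%R).
    assert (Sq : ((-1) ^ dep k * (-1) ^ dep k = 1)%R).
    { rewrite <- Rpow_mult_distr. replace (-1 * -1)%R with 1%R by ring. apply pow1. }
    assert (Hpa : forall N, (1 <= N)%nat -> psum a N = mzv_partial k 0 N).
    { intros N HN. unfold psum, a. rewrite rsum_scal. fold (psum (lcoef w) N).
      unfold w. rewrite lcoef_ek_psum; [|apply Forall_app; split; assumption|exact HN].
      rewrite <- Rmult_assoc, Sq. ring. }
    assert (Ha : forall n, 0 <= a n).
    { intros [|n].
      - unfold a. rewrite lcoef_0, <- Ek. lra.
      - enough (psum a (S n) <= psum a (S (S n))) by (rewrite (psum_S a (S n)) in *; lra).
        rewrite !Hpa by lia. unfold k. rewrite (mzv_partial_snoc_S k' q (S n)) by lia.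
        assert (P := mzv_partial_pos k' 0 (S n)).
        assert (0 < / (INR (S n) ^ q))%R.
        { apply Rinv_0_lt_compat, pow_lt, lt_0_INR. lia. }
        nra. }
    assert (HA := Abel_nonneg a (fun j => 1 - epsj j)%R (zeta k) Ha).
    apply Clim_ext with (fun j => RtoC ((-1) ^ dep k *
      Series (fun n => a n * (1 - epsj j) ^ n))%R).
    + intros j. rewrite <- Ek. unfold Jseq. rewrite (ncexp_mul_other true). simpl negb.
      rewrite Ek. unfold Gsol. rewrite <- Ek, app_comm_cons.
      rewrite (ncmul_exp_other false). simpl negb. rewrite <- app_comm_cons, Ek.
      unfold Lser. rewrite cexp_RtoC, exp_lxj, PSC_RtoC. f_equal.
      rewrite <- Series_scal_l. apply Series_ext. intros n. unfold a.
      rewrite <- !Rmult_assoc, Sq. ring.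
    + apply Clim_RtoC.
      replace (Finite ((-1) ^ dep k * zeta k)) with
        (Rbar_mult ((-1) ^ dep k)%R (Finite (zeta k))) by reflexivity.
      apply is_lim_seq_scal_l. apply HA.
      * apply is_lim_seq_incr_1. apply is_lim_seq_ext with (fun n => mzv_partial k 0 (S n)).
        { intros n. rewrite Hpa by lia. reflexivity. }
        apply (is_lim_seq_incr_1 (mzv_partial k 0)). apply mzv_partial_cv; assumption.
      * intros j. assert (H := epsj_bounds j). lra.
      * apply xj_lim.
      * apply adm_scal, adm_lcoef.
Qed.

(** * Duality *)

(** The 5 is 1 + 4: by [ln_eps_bound], ln(epsj + th) - ln(epsj) is at most 4 + (j + 1). *)
Definition lam (j : nat) : R := (INR j + 5)%R.

(* Domination by [g] up to a power of [lam j], which is comparable to [ln (/ epsj j)],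
   uniformly for theta in [0, PI]. *)
Definition bnd (g : nat -> R -> R) (f : nat -> R -> C) : Prop :=
  exists M k, 0 <= M /\
    forall j th, 0 <= th <= PI -> Cmod (f j th) <= M * lam j ^ k * g j th.

Lemma lam_ge_1 (j : nat) : 1 <= lam j.
Proof. unfold lam. assert (H := pos_INR j). lra. Qed.

Lemma lam_pow_ge_1 (j k : nat) : 1 <= lam j ^ k.
Proof. apply pow_R1_Rle, lam_ge_1. Qed.

Lemma NClim_ext (F G : nat -> ncs) (H : ncs) :
  (forall j, F j = G j) -> NClim G H -> NClim F H.
Proof. intros E HG w. apply Clim_ext with (2 := HG w). intros j; rewrite E; reflexivity. Qed.

Lemma bnd_ext (g : nat -> R -> R) (f f' : nat -> R -> C) :
  (forall j th, f j th = f' j th) -> bnd g f -> bnd g f'.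
Proof. intros E [M [k [HM H]]]. exists M, k. split; auto. intros. rewrite <- E. auto. Qed.

Lemma bnd_mult (g h : nat -> R -> R) (f f' : nat -> R -> C) :
  bnd g f -> bnd h f' -> bnd (fun j th => g j th * h j th)%R (fun j th => f j th * f' j th).
Proof.
  intros [M [k [HM H]]] [M' [k' [HM' H']]]. exists (M * M')%R, (k + k')%nat. split.
  - apply Rmult_le_pos; assumption.
  - intros j th Hth. rewrite Cmod_mult, pow_add.
    replace (M * M' * (lam j ^ k * lam j ^ k') * (g j th * h j th))%R with
      ((M * lam j ^ k * g j th) * (M' * lam j ^ k' * h j th))%R by ring.
    apply Rmult_le_compat; try apply Cmod_ge_0; auto.
Qed.

Lemma bnd_plus (g : nat -> R -> R) (f f' : nat -> R -> C) :
  (forall j th, 0 <= th <= PI -> 0 <= g j th) ->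
  bnd g f -> bnd g f' -> bnd g (fun j th => f j th + f' j th).
Proof.
  intros Hg [M [k [HM H]]] [M' [k' [HM' H']]]. exists (M + M')%R, (k + k')%nat. split; [lra|].
  intros j th Hth. eapply Rle_trans; [apply Cmod_triangle|].
  specialize (H j th Hth). specialize (H' j th Hth). specialize (Hg j th Hth).
  rewrite pow_add. assert (L1 := lam_pow_ge_1 j k). assert (L2 := lam_pow_ge_1 j k').
  set (a := (lam j ^ k)%R) in *. set (b := (lam j ^ k')%R) in *. set (c := g j th) in *.
  assert (A1 : (M * a * c <= M * (a * b) * c)%R).
  { apply Rmult_le_compat_r; [exact Hg|]. apply Rmult_le_compat_l; [exact HM|]. nra. }
  assert (A2 : (M' * b * c <= M' * (a * b) * c)%R).
  { apply Rmult_le_compat_r; [exact Hg|]. apply Rmult_le_compat_l; [exact HM'|]. nra. }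
  rewrite !Rmult_plus_distr_r. lra.
Qed.

Lemma bnd_csum {A : Type} (g : nat -> R -> R) (f : nat -> R -> A -> C) (l : list A) :
  (forall j th, 0 <= th <= PI -> 0 <= g j th) ->
  (forall x, In x l -> bnd g (fun j th => f j th x)) ->
  bnd g (fun j th => csum (map (f j th) l)).
Proof.
  intros Hg. induction l as [|x l IH]; intros H; simpl.
  - exists 0%R, 0%nat. split; [lra|]. intros j th Hth. rewrite Cmod_0. simpl. lra.
  - apply bnd_plus; [exact Hg|apply H; left; reflexivity|].
    apply IH. intros y Hy. apply H. right. exact Hy.
Qed.

Definition one2 (j : nat) (th : R) : R := 1.
Definition Nbnd (g : nat -> R -> R) (F : nat -> R -> ncs) : Prop :=
  forall w, bnd g (fun j th => F j th w).

Lemma one2_pos (j : nat) (th : R) : 0 <= th <= PI -> 0 <= one2 j th.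
Proof. intros _; unfold one2; lra. Qed.

Lemma Nbnd_mul (g h : nat -> R -> R) (F G : nat -> R -> ncs) :
  (forall j th, 0 <= th <= PI -> 0 <= g j th) ->
  (forall j th, 0 <= th <= PI -> 0 <= h j th) ->
  Nbnd g F -> Nbnd h G ->
  Nbnd (fun j th => g j th * h j th)%R (fun j th => F j th ** G j th).
Proof.
  intros Hg Hh HF HG w. unfold ncmul.
  apply (bnd_csum _ (fun j th i => F j th (firstn i w) * G j th (skipn i w))).
  - intros j th Hth. apply Rmult_le_pos; auto.
  - intros i _. apply (bnd_mult g h (fun j th => F j th (firstn i w))); auto.
Qed.

Lemma bnd_weaken (g h : nat -> R -> R) (f : nat -> R -> C) :
  (forall j th, 0 <= th <= PI -> g j th <= h j th) -> bnd g f -> bnd h f.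
Proof.
  intros Hgh [M [k [HM H]]]. exists M, k. split; [exact HM|]. intros j th Hth.
  eapply Rle_trans; [apply H, Hth|]. apply Rmult_le_compat_l; [|auto].
  apply Rmult_le_pos; [exact HM|]. assert (L := lam_pow_ge_1 j k). lra.
Qed.

Lemma Nbnd_mul_1 (F G : nat -> R -> ncs) :
  Nbnd one2 F -> Nbnd one2 G -> Nbnd one2 (fun j th => F j th ** G j th).
Proof.
  intros HF HG w. eapply bnd_weaken; [|apply (Nbnd_mul one2 one2 F G); auto using one2_pos].
  intros; unfold one2; lra.
Qed.

Lemma Cmod_expc (c : C) (n : nat) : Cmod (expc c n) <= Cmod c ^ n.
Proof.
  unfold expc. rewrite Cmod_div by apply fact_C_neq_0. rewrite Cmod_pow, Cmod_R.
  rewrite Rabs_pos_eq by apply pos_INR.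
  assert (H : (1 <= INR (Factorial.fact n))%R).
  { change 1%R with (INR 1). apply le_INR, Factorial.lt_O_fact. }
  assert (P : 0 <= Cmod c ^ n) by (apply pow_le, Cmod_ge_0).
  apply Rmult_le_reg_r with (INR (Factorial.fact n)); [lra|].
  unfold Rdiv. rewrite Rmult_assoc, Rinv_l by lra. nra.
Qed.

Lemma Nbnd_exp (b : bool) (c : nat -> R -> C) :
  (forall j th, 0 <= th <= PI -> Cmod (c j th) <= lam j) ->
  Nbnd one2 (fun j th => ncexp b (c j th)).
Proof.
  intros H w. exists 1%R, (length w). split; [lra|]. intros j th Hth.
  assert (L := lam_pow_ge_1 j (length w)). unfold one2.
  rewrite ncexp_unfold. destruct (forallb _ w); [|rewrite Cmod_0; lra].
  eapply Rle_trans; [apply Cmod_expc|]. rewrite Rmult_1_l, Rmult_1_r.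
  apply pow_incr. split; [apply Cmod_ge_0|auto].
Qed.

(** From exp(s/m) >= s/m, raised to the power m. *)
Lemma exp_ge_pow (s : R) (m : nat) : 0 <= s -> (0 < m)%nat ->
  (s ^ m <= INR m ^ m * exp s)%R.
Proof.
  intros Hs Hm. assert (Hm' : 0 < INR m) by (apply lt_0_INR, Hm).
  assert (E : (exp s = exp (s / INR m) ^ m)%R).
  { rewrite <- Rpower_pow by apply exp_pos. unfold Rpower. rewrite ln_exp. f_equal.
    field. lra. }
  rewrite E, <- Rpow_mult_distr. apply pow_incr. split; [exact Hs|].
  assert (H := exp_ineq1_le (s / INR m)).
  apply Rmult_le_compat_l with (r := INR m) in H; [|lra].
  replace (INR m * (1 + s / INR m))%R with (INR m + s)%R in H by (field; lra). lra.
Qed.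

Lemma lam_eps_lim (k : nat) : is_lim_seq (fun j => lam j ^ k * epsj j)%R 0%R.
Proof.
  (* One power more than k leaves a factor 1/lam; exp 4 is the product of exp(lam) and epsj. *)
  set (m := S k). set (K := (INR m ^ m * exp 4)%R).
  apply is_lim_seq_le_le with (fun _ => 0%R) (fun j => K * / lam j)%R.
  - intros j. assert (L := lam_ge_1 j). assert (P := lam_pow_ge_1 j k).
    assert (He := epsj_bounds j). split; [apply Rmult_le_pos; lra|].
    apply Rmult_le_reg_r with (lam j); [lra|].
    rewrite (Rmult_assoc K), Rinv_l, Rmult_1_r by lra.
    assert (H := exp_ge_pow (lam j) m ltac:(lra) ltac:(unfold m; lia)).
    assert (E : (exp (lam j) * epsj j = exp 4)%R).
    { unfold epsj. rewrite <- exp_plus. f_equal. unfold lam. ring. }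
    apply Rmult_le_compat_r with (r := epsj j) in H; [|lra].
    rewrite Rmult_assoc, E in H. fold K in H. unfold m in H.
    rewrite <- tech_pow_Rmult in H. lra.
  - apply is_lim_seq_const.
  - replace (Finite 0) with (Rbar_mult K (Rbar_inv p_infty)) by (simpl; f_equal; ring).
    apply is_lim_seq_scal_l. apply is_lim_seq_inv; [|discriminate].
    unfold lam. replace p_infty with (Rbar_plus p_infty (Finite 5)) by reflexivity.
    apply is_lim_seq_plus with p_infty 5%R.
    + apply is_lim_seq_INR.
    + apply is_lim_seq_const.
    + reflexivity.
Qed.

Definition eps2 (j : nat) (th : R) : R := epsj j.

Lemma eps2_pos (j : nat) (th : R) : 0 <= th <= PI -> 0 <= eps2 j th.
Proof. intros _; unfold eps2. assert (H := epsj_bounds j). lra. Qed.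

Lemma bnd_eps_lim (f : nat -> R -> C) (th : R) : 0 <= th <= PI -> bnd eps2 f ->
  Clim (fun j => f j th) 0.
Proof.
  intros Hth [M [k [HM H]]].
  apply Clim_bound with (fun j => M * (lam j ^ k * epsj j))%R.
  - intros j. replace (f j th - 0) with (f j th) by ring.
    rewrite <- Rmult_assoc. apply H, Hth.
  - replace (Finite 0) with (Rbar_mult M (Finite 0)) by (simpl; f_equal; ring).
    apply is_lim_seq_scal_l, lam_eps_lim.
Qed.

(** The conjugating exponentials may diverge, but on a fixed word at most like a power of [lam j],
    which the factor epsj in Q - 1 outweighs. *)
Lemma conj_near_one (b : bool) (c : nat -> C) (Q : nat -> ncs) :
  (forall j, Cmod (c j) <= lam j) ->
  (forall w, bnd eps2 (fun j _ => Q j w - ncone w)) ->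
  NClim (fun j => ncexp b (c j) ** Q j ** ncexp b (- c j)) ncone.
Proof.
  intros Hc HQ w.
  set (D := fun j : nat => ncadd (Q j) (ncscal (-1) ncone)).
  assert (HD : Nbnd eps2 (fun j _ => D j)).
  { intros v. apply bnd_ext with (2 := HQ v). intros j _. unfold D, ncadd, ncscal. ring. }
  assert (He : Nbnd one2 (fun j _ => ncexp b (c j))) by (apply Nbnd_exp; auto).
  assert (He' : Nbnd one2 (fun j _ => ncexp b (- c j))).
  { apply Nbnd_exp. intros; rewrite Cmod_opp; auto. }
  apply Clim_ext with (fun j =>
    (ncexp b (c j) ** D j ** ncexp b (- c j)) w + ncone w).
  { intros j. unfold D. rewrite ncmul_add_r, ncmul_scal_r, ncmul_1_r, ncmul_add_l,
      ncmul_scal_l, ncexp_inv. unfold ncadd, ncscal. ring. }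
  replace (ncone w) with (0 + ncone w) at 1 by ring.
  apply Clim_plus; [|apply Clim_const].
  assert (P1 := one2_pos). assert (P2 := eps2_pos).
  apply (bnd_eps_lim (fun j _ => (ncexp b (c j) ** D j ** ncexp b (- c j)) w) 0).
  { assert (H := PI_RGT_0). lra. }
  eapply bnd_weaken; [|apply (Nbnd_mul (fun j th => one2 j th * eps2 j th)%R one2
    (fun j _ => ncexp b (c j) ** D j)); auto].
  - intros j th _. unfold one2. lra.
  - intros j th Hth. apply Rmult_le_pos; auto.
  - apply (Nbnd_mul one2 eps2); auto.
Qed.

Lemma Lser_eps (w : word) :
  bnd eps2 (fun j _ => Lser (cexp (RtoC (- (INR j + 1)))) w - ncone w).
Proof.
  exists (4 * 2 ^ length w)%R, 0%nat. assert (P : 0 < 2 ^ length w) by (apply pow_lt; lra).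
  split; [lra|]. intros j th _. rewrite cexp_RtoC. fold (epsj j).
  assert (H := epsj_bounds j). unfold eps2.
  assert (E : Cmod (RtoC (epsj j)) = epsj j) by (rewrite Cmod_R, Rabs_pos_eq; lra).
  eapply Rle_trans; [apply Lser_near_one; lra|]. rewrite E.
  set (e := epsj j) in *. simpl pow at 3.
  apply Rmult_le_reg_r with (1 - e)%R; [lra|]. unfold Rdiv.
  replace (2 * (2 ^ length w * e * / (1 - e)) * (1 - e))%R with (2 * (2 ^ length w * e))%R
    by (field; lra).
  assert (0 < 2 ^ length w * e)%R by (apply Rmult_lt_0_compat; lra).
  nra.
Qed.

(** Invariance of the connection under u -> 1 - u with exchanged residues; - u / (1 - u) is the
    derivative of log(1 - u) with respect to log u. *)
Lemma ncswap_KZop (u : C) : u <> 0 -> 1 - u <> 0 ->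
  ncscal (- u / (1 - u)) (ncswap (KZop (1 - u))) = KZop u.
Proof.
  intros H0 H1. unfold KZop. rewrite ncswap_add, ncswap_scal, !ncswap_let.
  assert (H2 : u - 1 <> 0).
  { intros E. apply H1. replace (1 - u) with (- (u - 1)) by ring. rewrite E. ring. }
  replace ((1 - u) / (1 - u - 1)) with (- (1 - u) / u).
  2:{ field. split; [|exact H0]. replace (1 - u - 1) with (- u) by ring.
      intros E. apply H0. replace u with (- - u) by ring. rewrite E. ring. }
  apply functional_extensionality; intros w; unfold ncadd, ncscal; simpl negb.
  field. repeat split; assumption.
Qed.

Lemma lam_ge_INR (j : nat) : Cmod (RtoC (INR j + 1)) <= lam j.
Proof. assert (H := pos_INR j). rewrite Cmod_R, Rabs_pos_eq; unfold lam; lra. Qed.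

(* [Gsol t] and the swapped solution [Gsol (ln (1 - exp t))] solve the same equation, so their
   ratio is constant; it is computed at [exp t = 1 - epsj j] and at [exp t = epsj j]. *)
Lemma PhiKZ_duality (Z : word -> C) : Zsh_spec Z ->
  ncS (ncswap (PhiKZ Z)) = PhiKZ Z.
Proof.
  intros HZ. assert (HJ := Jseq_lim Z HZ).
  set (y := fun t => ln (1 - exp t)).
  set (K := fun t => ncS (ncswap (Gsol (RtoC (y t)))) ** Gsol (RtoC t)).
  assert (Hy : forall t, t < 0 -> y t < 0).
  { intros t Ht. assert (H := exp_neg_lt_1 t Ht). unfold y. rewrite <- ln_1.
    apply ln_increasing; lra. }
  assert (HK : forall t, t < 0 -> NCder K t (fun _ => 0)).
  { intros t Ht. assert (H := exp_neg_lt_1 t Ht).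
    assert (Dy : Cder (fun t => RtoC (y t)) t (- RtoC (exp t) / (1 - RtoC (exp t)))).
    { eapply Cder_eq.
      - apply Cder_RtoC, (Rder_comp ln (fun t => 1 - exp t)%R).
        + apply is_derive_Reals, derivable_pt_lim_ln. lra.
        + apply (Rder_minus (fun _ => 1%R) exp); [apply Rder_const|apply is_derive_exp].
      - rewrite RtoC_mult, RtoC_inv, !RtoC_minus by lra. unfold Cdiv. ring. }
    assert (D1 := NCder_Gsol _ t _ Dy (Hy t Ht)).
    assert (D2 := NCder_Gsol RtoC t 1 (Cder_id t) Ht).
    eapply NCder_eq; [apply NCder_mul; [apply NCder_S, NCder_swap, D1|exact D2]|].
    rewrite ncswap_scal, ncswap_mul, <- ncmul_scal_l.
    assert (Ey : cexp (RtoC (y t)) = 1 - cexp (RtoC t)).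
    { rewrite !cexp_RtoC, <- RtoC_minus. f_equal. apply exp_ln. lra. }
    rewrite Ey, cexp_RtoC. rewrite ncswap_KZop.
    - rewrite ncS_mul, ncS_KZop, ncmul_scal_r, ncmul_scal_l, ncmul_scal_r, ncmul_assoc.
      apply functional_extensionality; intros w; unfold ncadd, ncscal. ring.
    - rewrite <- cexp_RtoC. apply cexp_neq_0.
    - apply Cmod_lt_1_neq. rewrite <- cexp_RtoC. apply Cmod_cexp_lt, Ht. }
  assert (Kc : forall s t, s < 0 -> t < 0 -> K s = K t).
  { intros s t Hs Ht. apply functional_extensionality; intros w.
    destruct (Rle_dec s t) as [L|L]; [symmetry|].
    - apply (Cder_zero (fun t => K t w)); [exact L|]. intros; apply HK; lra.
    - apply (Cder_zero (fun t => K t w)); [lra|]. intros; apply HK; lra. }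
  set (Le := fun j : nat => Lser (cexp (RtoC (- (INR j + 1))))).
  assert (y1 : forall j, y (- (INR j + 1))%R = lxj j) by reflexivity.
  assert (y2 : forall j, y (lxj j) = (- (INR j + 1))%R).
  { intros j. unfold y. rewrite exp_lxj. replace (1 - (1 - epsj j))%R with (epsj j) by ring.
    apply ln_exp. }
  apply (NClim_unique (fun j => K (lxj j))).
  (* Evaluated at u = epsj: the swapped solution sits at 1 - epsj and gives the associator, while
     [Gsol] is close to u^X_false; the factor left over from [Jseq] completes that power to a
     conjugation. *)
  - assert (E : forall j, K (lxj j) = ncS (ncswap (Jseq j)) **
      (ncexp false (RtoC (INR j + 1)) ** Le j ** ncexp false (- RtoC (INR j + 1)))).
    { intros j. rewrite (Kc _ (- (INR j + 1))%R) by auto using lxj_neg, neg_seq.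
      unfold K. rewrite y1. unfold Jseq. rewrite ncswap_mul, ncswap_exp, ncS_mul, ncS_exp.
      unfold Gsol at 2. fold (Le j). rewrite RtoC_opp. simpl negb.
      rewrite !ncmul_assoc. rewrite <- (ncmul_assoc _ (ncexp false (- RtoC (INR j + 1)))
        (ncexp false (RtoC (INR j + 1)))).
      rewrite ncexp_inv', ncmul_1_r. reflexivity. }
    apply (NClim_ext _ _ _ E).
    rewrite <- (ncmul_1_r (ncS (ncswap (PhiKZ Z)))).
    apply NClim_mul; [apply NClim_S, NClim_swap, HJ|].
    apply conj_near_one; [apply lam_ge_INR|apply Lser_eps].
  (* At u = 1 - epsj the two solutions exchange their roles. *)
  - assert (E : forall j, K (lxj j) = (ncexp true (RtoC (INR j + 1)) ** ncS (ncswap (Le j))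
      ** ncexp true (- RtoC (INR j + 1))) ** Jseq j).
    { intros j. unfold K. rewrite y2. unfold Gsol at 1. fold (Le j). rewrite RtoC_opp.
      rewrite ncswap_mul, ncswap_exp, ncS_mul, ncS_exp. simpl negb.
      replace (- - RtoC (INR j + 1)) with (RtoC (INR j + 1)) by ring.
      unfold Jseq. rewrite !ncmul_assoc. rewrite <- (ncmul_assoc _ (ncexp true (- RtoC (INR j + 1)))
        (ncexp true (RtoC (INR j + 1)))).
      rewrite ncexp_inv', ncmul_1_r. reflexivity. }
    apply (NClim_ext _ _ _ E).
    rewrite <- (ncmul_1_l (PhiKZ Z)). apply NClim_mul; [|exact HJ].
    apply conj_near_one; [apply lam_ge_INR|].
    intros w. destruct (Lser_eps (map negb (rev w))) as [M [k [HM H]]].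
    exists M, k. split; [exact HM|]. intros j th Hth. specialize (H j th Hth).
    assert (E1 : ncone w = ncS (ncswap ncone) w).
    { rewrite <- (ncexp_0 true) at 2. rewrite ncswap_exp, ncexp_0, ncS_one. reflexivity. }
    rewrite E1. unfold ncS, ncswap. fold (Le j) in H.
    match goal with |- Cmod ?x <= _ => replace x with (RtoC (-1) ^ length w *
      (Le j (map negb (rev w)) - ncone (map negb (rev w)))) by ring end.
    rewrite Cmod_mult, Cmod_pow, Cmod_R. replace (Rabs (-1)) with 1%R.
    + rewrite pow1, Rmult_1_l. exact H.
    + rewrite Rabs_left; lra.
Qed.

Lemma ncS_Jseq (j : nat) : ncS (Jseq j) ** Jseq j = ncone.
Proof.
  unfold Jseq. rewrite ncS_mul, ncS_exp, ncmul_assoc.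
  rewrite <- (ncmul_assoc _ (ncexp true (- RtoC (INR j + 1)))
        (ncexp true (RtoC (INR j + 1)))).
  rewrite ncexp_inv', ncmul_1_r. apply ncS_Gsol, lxj_neg.
Qed.

(** The antipode inverts [Jseq], and in the limit duality turns the antipode into the letter
    swap. *)
Lemma PhiKZ_swap_inverse (Z : word -> C) : Zsh_spec Z ->
  PhiKZ Z ** ncswap (PhiKZ Z) = ncone /\ ncswap (PhiKZ Z) ** PhiKZ Z = ncone.
Proof.
  intros HZ. assert (HJ := Jseq_lim Z HZ). assert (D := PhiKZ_duality Z HZ).
  set (P := PhiKZ Z) in *.
  assert (E : ncS P = ncswap P) by (rewrite <- D at 1; apply ncS_invol).
  assert (I : ncswap P ** P = ncone).
  { rewrite <- E. apply (NClim_unique (fun j => ncS (Jseq j) ** Jseq j)).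
    - apply NClim_mul; [apply NClim_S|]; exact HJ.
    - apply (NClim_ext _ _ _ ncS_Jseq). apply NClim_const. }
  split; [|exact I].
  rewrite <- (ncswap_invol P) at 1. rewrite <- ncswap_mul, I.
  rewrite <- (ncexp_0 true). rewrite ncswap_exp, !ncexp_0. reflexivity.
Qed.

Lemma cexp_conj (z : C) : cexp (Cconj z) = Cconj (cexp z).
Proof.
  unfold cexp, Cconj, Re, Im; cbn [fst snd]. rewrite cos_neg, sin_neg. f_equal; ring.
Qed.

Lemma ncconj_Lser (u : C) : ncconj (Lser u) = Lser (Cconj u).
Proof. apply functional_extensionality; intros w. symmetry. apply PSC_conj. Qed.

Lemma ncconj_Gsol (z : C) : ncconj (Gsol z) = Gsol (Cconj z).
Proof.
  unfold Gsol. rewrite ncconj_mul, ncconj_Lser, ncconj_exp, cexp_conj. reflexivity.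
Qed.

Lemma ncconj_Jseq (j : nat) : ncconj (Jseq j) = Jseq j.
Proof.
  unfold Jseq. rewrite ncconj_mul, ncconj_exp, ncconj_Gsol, !Cconj_RtoC. reflexivity.
Qed.

Lemma ncconj_PhiKZ (Z : word -> C) : Zsh_spec Z -> ncconj (PhiKZ Z) = PhiKZ Z.
Proof.
  intros HZ. assert (HJ := Jseq_lim Z HZ). apply (NClim_unique Jseq); [|exact HJ].
  apply (NClim_ext _ (fun j => ncconj (Jseq j))).
  - intros j. symmetry. apply ncconj_Jseq.
  - apply NClim_conj, HJ.
Qed.

(** * Half-turn around the unit circle *)

(** From sin x >= x - x^3/6 and x <= 2, where only pi <= 4 is used. *)
Lemma sin_ge_third (x : R) : 0 <= x <= PI / 2 -> x / 3 <= sin x.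
Proof.
  intros Hx. assert (HP := PI_4). assert (HP0 := PI_RGT_0).
  assert (H := proj1 (sin_bound x 0 ltac:(lra) ltac:(lra))).
  unfold sin_approx, sin_term in H. simpl in H.
  eapply Rle_trans; [|exact H]. nra.
Qed.

Definition rj (j : nat) : R := (1 - epsj j)%R.
(** Squared distance from r e^(i th) to 1, the denominator of the Poisson kernel. *)
Definition Dj (j : nat) (th : R) : R := (1 - 2 * rj j * cos th + rj j * rj j)%R.

(** With e = epsj the squared distance is e^2 + 4 r sin^2(th/2); as r >= 1/2 and sin(th/2) >= th/6,
    it is at least e^2 + th^2/18, whence 36. *)
Lemma Dj_lower (j : nat) (th : R) : 0 <= th <= PI ->
  ((epsj j + th) * (epsj j + th) <= 36 * Dj j th)%R.
Proof.
  intros Hth. assert (He := epsj_bounds j).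
  assert (Hs := sin_ge_third (th / 2)%R ltac:(lra)).
  assert (E : (cos th = 1 - 2 * (sin (th / 2) * sin (th / 2)))%R).
  { replace th with (2 * (th / 2))%R at 1 by field. rewrite cos_2a_sin. ring. }
  unfold Dj. rewrite E. unfold rj. set (s := sin (th / 2)) in *. set (e := epsj j) in *.
  assert (Hss : (th / 2 / 3 * (th / 2 / 3) <= s * s)%R) by (apply Rmult_le_compat; lra).
  assert (th * th <= 36 * (s * s))%R by lra.
  assert (0 <= (e - th) * (e - th))%R by apply Rle_0_sqr.
  assert (0 <= (1 - 2 * e) * (s * s))%R by (apply Rmult_le_pos; [lra|apply Rle_0_sqr]).
  nra.
Qed.

Definition zc (j : nat) (th : R) : C := (lxj j, th).
Definition uc (j : nat) (th : R) : C := cexp (zc j th).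
Definition Gc (j : nat) (th : R) : ncs := Gsol (zc j th).

Lemma uc_eq (j : nat) (th : R) : uc j th = (rj j * cos th, rj j * sin th)%R.
Proof. unfold uc, cexp, zc, Re, Im; cbn [fst snd]. rewrite exp_lxj. reflexivity. Qed.

Lemma Dj_Cmod (j : nat) (th : R) : (Cmod (uc j th - 1) ^ 2 = Dj j th)%R.
Proof.
  rewrite Cmod2_alt, uc_eq. unfold Dj.
  assert (E := sin2_cos2 th). unfold Rsqr in E.
  unfold Re, Im, Cminus, Cplus, Copp, RtoC; cbn [fst snd].
  transitivity (1 - 2 * rj j * cos th
    + rj j * rj j * (sin th * sin th + cos th * cos th))%R; [ring|rewrite E; ring].
Qed.

Lemma Cder_zc (j : nat) (th : R) : Cder (zc j) th Ci.
Proof.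
  split; cbn [Re Im zc fst snd Ci]; [apply Rder_const|].
  apply (is_derive_id (K := R_AbsRing)).
Qed.

Lemma NCder_Gc (j : nat) (th : R) :
  NCder (Gc j) th (ncscal Ci (KZop (uc j th) ** Gc j th)).
Proof. apply (NCder_Gsol (zc j) th Ci); [apply Cder_zc|apply lxj_neg]. Qed.

Lemma epsj_th_pos (j : nat) (th : R) : 0 <= th -> 0 < epsj j + th.
Proof. intros H; assert (He := epsj_bounds j); lra. Qed.

Lemma KZ_coef_bound (j : nat) (th : R) : 0 <= th <= PI ->
  Cmod (uc j th / (uc j th - 1)) <= 6 / (epsj j + th).
Proof.
  intros Hth. assert (Hp := epsj_th_pos j th (proj1 Hth)).
  assert (HD := Dj_lower j th Hth). rewrite <- Dj_Cmod in HD.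
  set (m := Cmod (uc j th - 1)) in *. assert (Hm : 0 <= m) by apply Cmod_ge_0.
  assert (L : epsj j + th <= 6 * m) by nra.
  assert (N : uc j th - 1 <> 0) by (apply Cmod_gt_0; fold m; lra).
  rewrite Cmod_div by exact N. fold m.
  assert (Cmod (uc j th) <= 1) by (left; apply Cmod_cexp_lt, lxj_neg).
  assert (H0 := Cmod_ge_0 (uc j th)).
  apply Rle_trans with (/ m)%R.
  - unfold Rdiv. rewrite <- (Rmult_1_l (/ m)) at 2. apply Rmult_le_compat_r; [|exact H].
    left; apply Rinv_0_lt_compat; lra.
  - apply Rmult_le_reg_r with (m * (epsj j + th))%R; [apply Rmult_lt_0_compat; lra|].
    replace (/ m * (m * (epsj j + th)))%R with (epsj j + th)%R by (field; lra).
    replace (6 / (epsj j + th) * (m * (epsj j + th)))%R with (6 * m)%R by (field; lra).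
    exact L.
Qed.

(** Lets the constant coefficient of X_false share the bound of the singular one; epsj + th is at
    most 1/2 + 4. *)
Lemma one_bound (j : nat) (th : R) : 0 <= th <= PI -> 1 <= 6 / (epsj j + th).
Proof.
  intros Hth. assert (Hp := epsj_th_pos j th (proj1 Hth)). assert (He := epsj_bounds j).
  assert (HP := PI_4). apply Rmult_le_reg_r with (epsj j + th)%R; [exact Hp|].
  unfold Rdiv. rewrite Rmult_assoc, Rinv_l by lra. lra.
Qed.

Lemma ln_eps_bound (j : nat) (th : R) : 0 <= th <= PI ->
  0 <= ln (epsj j + th) - ln (epsj j + 0) <= lam j.
Proof.
  intros Hth. assert (He := epsj_bounds j). assert (HP := PI_4). rewrite Rplus_0_r. split.
  - destruct (Req_dec th 0) as [->|N]; [rewrite Rplus_0_r; lra|].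
    assert (ln (epsj j) < ln (epsj j + th)) by (apply ln_increasing; lra). lra.
  - unfold epsj at 2. rewrite ln_exp.
    assert (H : ln (epsj j + th) <= 4).
    { assert (X := exp_ineq1_le (ln (epsj j + th))). rewrite exp_ln in X by lra. lra. }
    unfold lam. lra.
Qed.

Lemma Cder_ln_eps (j : nat) (c th : R) : 0 <= th ->
  is_derive (fun t => c * ln (epsj j + t))%R th (c / (epsj j + th))%R.
Proof.
  intros Hth. assert (Hp := epsj_th_pos j th Hth). evar_last.
  - apply (Rder_mult (fun _ => c) (fun t => ln (epsj j + t))).
    + apply Rder_const.
    + apply (Rder_comp ln (fun t => epsj j + t)%R).
      * apply is_derive_Reals, derivable_pt_lim_ln, Hp.
      * apply (Rder_plus (fun _ => epsj j) (fun t => t)); [apply Rder_const|].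
        apply (is_derive_id (K := R_AbsRing)).
  - unfold one; simpl. field. lra.
Qed.

Lemma Clim_bnd (f : nat -> C) (l : C) : Clim f l -> bnd one2 (fun j _ => f j).
Proof.
  assert (K : forall (h : nat -> R) (m : R), is_lim_seq h m ->
    exists M, 0 <= M /\ forall j, Rabs (h j) <= M).
  { intros h m H. destruct (filterlim_bounded h) as [M HM]; [exists m; exact H|].
    exists M. split; [|exact HM]. eapply Rle_trans; [apply Rabs_pos|apply (HM 0%nat)]. }
  intros [H1 H2]. apply K in H1, H2. destruct H1 as [M1 [P1 H1]], H2 as [M2 [P2 H2]].
  exists (2 * (M1 + M2))%R, 0%nat. split; [lra|]. intros j th _. unfold one2. simpl pow.
  rewrite !Rmult_1_r. apply Cmod_Re_Im.
  - specialize (H1 j). lra.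
  - specialize (H2 j). lra.
Qed.

Lemma Gc_0 (j : nat) : Gc j 0 = ncexp true (- RtoC (INR j + 1)) ** Jseq j.
Proof.
  unfold Jseq. rewrite ncmul_assoc, ncexp_inv', ncmul_1_l. reflexivity.
Qed.

Lemma PI_bounds : 0 <= 0 <= PI /\ 0 <= PI <= PI.
Proof. assert (H := PI_RGT_0). lra. Qed.

(** Induction on the word: a letter taken off on the left costs one integration against 1/(epsj +
    th), that is one factor [lam j]. At th = 0 the value is a diverging exponential times the
    convergent [Jseq], hence on each word of at most polynomial size in [lam j]. *)
Lemma Gc_bnd (Phi : ncs) : NClim Jseq Phi -> Nbnd one2 Gc.
Proof.
  intros HJ.
  assert (H0 : Nbnd one2 (fun j _ => Gc j 0)).
  { intros w. apply bnd_ext with (fun j _ => (ncexp true (- RtoC (INR j + 1)) ** Jseq j) w).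
    { intros j _. rewrite Gc_0. reflexivity. }
    apply (Nbnd_mul_1 (fun j _ => ncexp true (- RtoC (INR j + 1))) (fun j _ => Jseq j)).
    - apply Nbnd_exp. intros j th _. rewrite Cmod_opp. apply lam_ge_INR.
    - intros v. eapply Clim_bnd, HJ. }
  intros w. induction w as [|a v IH].
  - exists 1%R, 0%nat. split; [lra|]. intros j th _. unfold Gc, Gsol, one2.
    rewrite ncmul_nil, ncexp_nil, Lser_nil by apply Cmod_cexp_lt, lxj_neg.
    rewrite Cmult_1_l, Cmod_1. simpl. lra.
  - apply bnd_ext with (fun j th => Gc j 0 (a :: v) + (Gc j th (a :: v) - Gc j 0 (a :: v))).
    { intros; ring. }
    apply bnd_plus; [apply one2_pos|apply (H0 (a :: v))|].
    destruct IH as [M [k [HM IH]]]. exists (12 * M)%R, (S k). split; [lra|].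
    intros j th Hth. set (B := (M * lam j ^ k)%R).
    assert (HB : 0 <= B).
    { apply Rmult_le_pos; [exact HM|]. assert (L := lam_pow_ge_1 j k). lra. }
    eapply Rle_trans.
    + apply (majorant_C (fun th => Gc j th (a :: v))
        (fun th => ncscal Ci (KZop (uc j th) ** Gc j th) (a :: v))
        (fun t => 6 * B * ln (epsj j + t))%R (fun t => 6 * B / (epsj j + t))%R 0 th (proj1 Hth)).
      * intros t _. apply NCder_Gc.
      * intros t Ht. apply Cder_ln_eps, Ht.
      * intros t Ht. assert (Ht' : 0 <= t <= PI) by lra.
        specialize (IH j t Ht'). unfold one2 in IH. rewrite Rmult_1_r in IH. fold B in IH.
        unfold KZop. rewrite ncmul_add_l, ncmul_scal_l. unfold ncscal, ncadd.
        rewrite !ncmul_let_l, Cmod_mult, Cmod_Ci, Rmult_1_l.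
        assert (K1 := KZ_coef_bound j t Ht'). assert (K2 := one_bound j t Ht').
        replace (6 * B / (epsj j + t))%R with (6 / (epsj j + t) * B)%R
          by (unfold Rdiv; ring).
        destruct a; simpl Bool.eqb; cbv iota.
        -- rewrite Cplus_0_l, Cmod_mult.
           apply Rmult_le_compat; auto using Cmod_ge_0.
        -- rewrite Cmult_0_r, Cplus_0_r. rewrite <- (Rmult_1_l (Cmod _)).
           apply Rmult_le_compat; auto using Cmod_ge_0; lra.
    + assert (L := ln_eps_bound j th Hth). unfold one2. rewrite Rmult_1_r.
      rewrite <- tech_pow_Rmult.
      replace (12 * M * (lam j * lam j ^ k))%R with (12 * B * lam j)%R by (unfold B; ring).
      rewrite <- Rmult_minus_distr_l. rewrite <- Rmult_assoc.
      replace (2 * (6 * B))%R with (12 * B)%R by ring.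
      apply Rmult_le_compat_l; lra.
Qed.

(* [beta j th = PI - th + 2 arg (1 - uc j th)] vanishes when [|u| = 1]; minus its derivative is
   the Poisson kernel, which is the defect of [u / (u - 1) + conj (u / (u - 1)) = 1]. *)
Definition beta (j : nat) (th : R) : R :=
  (PI - th - 2 * atan (rj j * sin th / (1 - rj j * cos th)))%R.

Lemma rj_bounds (j : nat) : / 2 <= rj j < 1.
Proof. assert (H := epsj_bounds j). unfold rj. lra. Qed.

Lemma one_minus_rcos_pos (j : nat) (th : R) : 0 < 1 - rj j * cos th.
Proof.
  assert (H := rj_bounds j). assert (B := COS_bound th). nra.
Qed.

Lemma Dj_pos (j : nat) (th : R) : 0 < Dj j th.
Proof.
  assert (H := rj_bounds j). assert (B := COS_bound th). unfold Dj.
  assert (0 < (1 - rj j) * (1 - rj j))%R by (apply Rmult_lt_0_compat; lra).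
  assert (0 <= rj j * (1 - cos th))%R by (apply Rmult_le_pos; lra). nra.
Qed.

Lemma beta_der (j : nat) (th : R) :
  is_derive (beta j) th (- ((1 - rj j * rj j) / Dj j th))%R.
Proof.
  assert (N := one_minus_rcos_pos j th). assert (HD := Dj_pos j th).
  evar_last.
  - apply (Rder_minus (fun t => PI - t)%R
      (fun t => 2 * atan (rj j * sin t / (1 - rj j * cos t)))%R).
    + apply (Rder_minus (fun _ => PI) (fun t => t)); [apply Rder_const|].
      apply (is_derive_id (K := R_AbsRing)).
    + apply (Rder_mult (fun _ => 2) (fun t => atan (rj j * sin t / (1 - rj j * cos t)))%R);
        [apply Rder_const|].
      apply (Rder_comp atan (fun t => rj j * sin t / (1 - rj j * cos t))%R).
      * apply is_derive_Reals, derivable_pt_lim_atan.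
      * apply (is_derive_div (fun t => rj j * sin t)%R (fun t => 1 - rj j * cos t)%R).
        -- apply (Rder_mult (fun _ => rj j) sin); [apply Rder_const|apply is_derive_sin].
        -- apply (Rder_minus (fun _ => 1%R) (fun t => rj j * cos t)%R); [apply Rder_const|].
           apply (Rder_mult (fun _ => rj j) cos); [apply Rder_const|apply is_derive_cos].
        -- lra.
  - unfold one; simpl. unfold Rsqr.
    assert (E := sin2_cos2 th). unfold Rsqr in E.
    assert (ED : (Dj j th = (1 - rj j * cos th) * (1 - rj j * cos th)
      + rj j * sin th * (rj j * sin th))%R).
    { unfold Dj. transitivity (1 - 2 * rj j * cos th
        + rj j * rj j * (sin th * sin th + cos th * cos th))%R; [rewrite E|]; ring. }
    set (r := rj j) in *. set (c := cos th) in *. set (s := sin th) in *.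
    assert (Hss : (s * s = 1 - c * c)%R) by lra.
    assert (ED2 : (Dj j th = 1 - 2 * r * c + r * r)%R) by reflexivity.
    replace (1 + r * s / (1 - r * c) * (r * s / (1 - r * c)))%R with
      (Dj j th / ((1 - r * c) * (1 - r * c)))%R by (rewrite ED; field; lra).
    set (D := Dj j th) in *.
    apply Rmult_eq_reg_r with D; [|lra]. field_simplify; [|lra..].
    replace (s ^ 2)%R with (1 - c ^ 2)%R by (simpl pow; lra).
    replace ((1 - c ^ 2) * r ^ 2 + r ^ 2 * c ^ 2 - 2 * r * c + 1)%R with D
      by (rewrite ED2; ring).
    field. lra.
Qed.

Lemma beta_0 (j : nat) : beta j 0 = PI.
Proof.
  unfold beta. rewrite sin_0, Rmult_0_r. unfold Rdiv. rewrite Rmult_0_l, atan_0. ring.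
Qed.

Lemma beta_PI (j : nat) : beta j PI = 0%R.
Proof.
  unfold beta. rewrite sin_PI, Rmult_0_r. unfold Rdiv. rewrite Rmult_0_l, atan_0. ring.
Qed.

(** Integrating backwards from pi, where [beta] vanishes, gains the factor epsj. The kernel is at
    most 2 epsj / D, and D is at least (epsj + t)^2 / 36, whence 72. *)
Lemma beta_bound (j : nat) (th : R) : 0 <= th <= PI ->
  Rabs (beta j th) <= 72 * epsj j / (epsj j + th).
Proof.
  intros Hth. assert (He := epsj_bounds j). assert (Hp := epsj_th_pos j th (proj1 Hth)).
  assert (Hr := rj_bounds j).
  assert (P0 : forall t, 0 <= (1 - rj j * rj j) / Dj j t).
  { intros t. apply Rdiv_le_0_compat; [nra|apply Dj_pos]. }
  assert (L : 0 <= beta j th).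
  { assert (H := majorant_R (beta j) _ (fun _ => 0%R) (fun _ => 0%R) th PI (proj2 Hth)
      (fun t _ => beta_der j t)). rewrite beta_PI in H.
    enough (0 - beta j th <= 0 - 0)%R by lra. apply H.
    - intros; apply Rder_const.
    - intros t _. specialize (P0 t). lra. }
  rewrite Rabs_pos_eq by exact L.
  assert (H := majorant_R (fun t => - beta j t)%R (fun t => (1 - rj j * rj j) / Dj j t)%R
    (fun t => - (72 * epsj j * / (epsj j + t)))%R
    (fun t => 72 * epsj j / ((epsj j + t) * (epsj j + t)))%R th PI (proj2 Hth)).
  cbv beta in H. rewrite beta_PI in H.
  assert (0 < 72 * epsj j * / (epsj j + PI))%R.
  { apply Rmult_lt_0_compat; [lra|]. apply Rinv_0_lt_compat. assert (X := PI_RGT_0). lra. }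
  unfold Rdiv in *. enough (- 0 - - beta j th <= - (72 * epsj j * / (epsj j + PI))
    - - (72 * epsj j * / (epsj j + th)))%R by lra.
  apply H.
  - intros t _. evar_last.
    + apply (is_derive_opp (V := R_NormedModule)), beta_der.
    + unfold opp; simpl. unfold Rdiv. ring.
  - intros t Ht. assert (Ht' := epsj_th_pos j t ltac:(lra)). evar_last.
    + apply (is_derive_opp (V := R_NormedModule)).
      apply (Rder_mult (fun _ => (72 * epsj j)%R) (fun t => / (epsj j + t))%R);
        [apply Rder_const|].
      apply (is_derive_inv (fun t => epsj j + t)%R).
      * apply (Rder_plus (fun _ => epsj j) (fun t => t)); [apply Rder_const|].
        apply (is_derive_id (K := R_AbsRing)).
      * lra.
    + unfold opp, one; simpl. field. lra.
  - intros t Ht. assert (Ht' := epsj_th_pos j t ltac:(lra)).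
    assert (HD := Dj_lower j t ltac:(lra)). assert (HD0 := Dj_pos j t).
    set (D := Dj j t) in *. set (x := (epsj j + t)%R) in *.
    assert (N : (1 - rj j * rj j <= 2 * epsj j)%R) by (unfold rj; nra).
    assert (Hx : 0 < x * x) by (apply Rmult_lt_0_compat; lra).
    apply Rle_trans with (2 * epsj j * / D)%R.
    + apply Rmult_le_compat_r; [left; apply Rinv_0_lt_compat, HD0|exact N].
    + replace (72 * epsj j * / (x * x))%R with (2 * epsj j * (36 * / (x * x)))%R by ring.
      apply Rmult_le_compat_l; [lra|].
      replace (36 * / (x * x))%R with (/ (x * x / 36))%R by (field; lra).
      apply Rinv_le_contravar; lra.
Qed.

(** Its derivative cancels the Poisson defect along X_true, with which it commutes. [Rc] stands for
    the inverse of the solution reflected by conjugation and [sg]. *)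
Definition ec (j : nat) (th : R) : ncs := ncexp true (0, - beta j th)%R.
Definition Rc (j : nat) (th : R) : ncs := ncS (ncconj (sg (Gc j th))).
(* On [|u| = 1] one would have [ec = 1] and [Fc] constant. *)
Definition Fc (j : nat) (th : R) : ncs := Rc j th ** (ec j th ** Gc j th).
(** The commutator of [ec] with X_false, the part of the defect that [ec] cannot remove. *)
Definition Bc (j : nat) (th : R) : ncs :=
  ncadd (ec j th ** nclet false) (ncscal (-1) (nclet false ** ec j th)).

Lemma KZ_coef_re (j : nat) (th : R) :
  uc j th / (uc j th - 1) + Cconj (uc j th / (uc j th - 1)) - 1
  = RtoC (- ((1 - rj j * rj j) / Dj j th)).
Proof.
  assert (HD := Dj_pos j th). assert (HC := Dj_Cmod j th).
  assert (N : uc j th - 1 <> 0).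
  { apply Cmod_gt_0. destruct (Rle_lt_or_eq_dec _ _ (Cmod_ge_0 (uc j th - 1))) as [L|L]; auto.
    rewrite <- L in HC. simpl in HC. lra. }
  set (u := uc j th) in *.
  assert (E : u / (u - 1) = u * Cconj (u - 1) / RtoC (Dj j th)).
  { rewrite <- HC, Cmod2_conj. field. split; [|exact N].
    intros E0. apply N. rewrite <- (Cconj_conj (u - 1)), E0. apply Cconj_RtoC. }
  rewrite E. unfold Cdiv. rewrite <- RtoC_inv by lra.
  assert (E2 := sin2_cos2 th). unfold Rsqr in E2.
  unfold u. rewrite uc_eq.
  apply injective_projections; unfold Cconj, Cminus, Cplus, Copp, Cmult, RtoC; cbn [fst snd].
  - apply Rmult_eq_reg_r with (Dj j th); [|lra]. field_simplify; [|lra..].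
    unfold Dj. set (c := cos th) in *. set (s := sin th) in *. set (r := rj j) in *.
    assert (Hss : (s * s = 1 - c * c)%R) by lra. simpl pow. nra.
  - ring.
Qed.

(** The X_false terms of the solution and of its reflection would cancel but for the factor [ec]
    between them. The X_true terms add up to a + conj a - 1, minus the Poisson kernel, which the
    derivative of [ec] cancels. *)
Lemma NCder_Fc (j : nat) (th : R) :
  NCder (Fc j) th (ncscal Ci (Rc j th ** (Bc j th ** Gc j th))).
Proof.
  assert (DG := NCder_Gc j th).
  assert (De : NCder (ec j) th (ncscal (0, (1 - rj j * rj j) / Dj j th)%R
    (nclet true ** ec j th))).
  { apply (NCder_exp true (fun th => (0, - beta j th)%R)).
    split; cbn [Re Im fst snd]; [apply Rder_const|]. evar_last.
    - apply (is_derive_opp (V := R_NormedModule)), beta_der.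
    - unfold opp; simpl. ring. }
  eapply NCder_eq.
  { apply NCder_mul; [apply NCder_S, NCder_conj, NCder_sg, DG|].
    apply NCder_mul; [exact De|exact DG]. }
  assert (EK := KZ_coef_re j th).
  set (a := uc j th / (uc j th - 1)) in *.
  assert (EA : ncconj (sg (ncscal Ci (KZop (uc j th) ** Gc j th))) =
    ncscal (- Ci) (ncadd (ncscal (-1) (nclet false)) (ncscal (Cconj a - 1) (nclet true))
      ** ncconj (sg (Gc j th)))).
  { rewrite sg_scal, sg_mul. unfold KZop. fold a.
    rewrite sg_add, sg_scal, sg_let_false, sg_let_true.
    replace (ncconj (ncscal Ci _)) with (ncscal (- Ci) (ncconj
      (ncadd (ncscal (-1) (ncadd (nclet false) (nclet true))) (ncscal a (nclet true))
       ** sg (Gc j th)))).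
    2:{ apply functional_extensionality; intros w. unfold ncconj, ncscal.
        rewrite Cmult_conj. f_equal. unfold Cconj, Ci, Copp; simpl. f_equal; ring. }
    rewrite ncconj_mul. do 2 f_equal.
    apply functional_extensionality; intros w. unfold ncconj, ncadd, ncscal.
    rewrite !Cplus_conj, !Cmult_conj, Cplus_conj, Cconj_RtoC.
    assert (L : forall b, Cconj (nclet b w) = nclet b w).
    { intros b. unfold nclet. destruct w as [|x [|]]; try apply Cconj_RtoC.
      destruct (Bool.eqb x b); apply Cconj_RtoC. }
    rewrite !L. ring. }
  rewrite EA, ncS_scal, ncS_mul, ncS_add, !ncS_scal, !ncS_let. fold (Rc j th).
  unfold Bc, KZop. fold a.
  replace (0, (1 - rj j * rj j) / Dj j th)%R with (- Ci * (a + Cconj a - 1)).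
  2:{ rewrite EK. unfold Ci, Copp, Cmult, RtoC; cbn [fst snd]. f_equal; ring. }
  assert (Ecomm : ec j th ** nclet true = nclet true ** ec j th) by apply ncexp_let_comm.
  repeat rewrite ?ncmul_add_l, ?ncmul_add_r, ?ncmul_scal_l, ?ncmul_scal_r, ?ncmul_assoc.
  rewrite <- (ncmul_assoc _ (ec j th) (nclet true)), Ecomm, !ncmul_assoc.
  apply functional_extensionality; intros w; unfold ncadd, ncscal. ring.
Qed.

(** The size of [beta]; unlike that of the Poisson kernel, its integral over the half circle tends
    to 0. *)
Definition kern (j : nat) (th : R) : R := (epsj j / (epsj j + th))%R.

Lemma kern_pos (j : nat) (th : R) : 0 <= th <= PI -> 0 <= kern j th.
Proof.
  intros Hth. assert (He := epsj_bounds j). apply Rdiv_le_0_compat; [lra|].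
  apply epsj_th_pos, Hth.
Qed.

Lemma kern_le_1 (j : nat) (th : R) : 0 <= th <= PI -> kern j th <= 1.
Proof.
  intros Hth. assert (He := epsj_bounds j). assert (Hp := epsj_th_pos j th (proj1 Hth)).
  unfold kern. apply Rmult_le_reg_r with (epsj j + th)%R; [exact Hp|].
  unfold Rdiv. rewrite Rmult_assoc, Rinv_l by lra. lra.
Qed.

(** One factor [beta] of the power gives [kern]; the others are bounded by 72, as [kern] is at most
    1. *)
Lemma ec_bnd (a : bool) (v : word) : bnd kern (fun j th => ec j th (a :: v)).
Proof.
  exists (72 ^ S (length v))%R, 0%nat. split; [apply pow_le; lra|].
  intros j th Hth. simpl (lam j ^ 0)%R. rewrite Rmult_1_r.
  assert (K0 := kern_pos j th Hth). assert (K1 := kern_le_1 j th Hth).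
  assert (P : 0 <= 72 ^ S (length v)) by (apply pow_le; lra).
  unfold ec. rewrite ncexp_unfold. destruct (forallb _ _).
  2:{ rewrite Cmod_0. apply Rmult_le_pos; assumption. }
  eapply Rle_trans; [apply Cmod_expc|]. cbn [length].
  assert (B : Cmod (0, - beta j th)%R <= 72 * kern j th).
  { replace (0, - beta j th)%R with (- Ci * RtoC (beta j th)).
    - rewrite Cmod_mult, Cmod_opp, Cmod_Ci, Cmod_R, Rmult_1_l.
      eapply Rle_trans; [apply beta_bound, Hth|]. unfold kern, Rdiv. apply Req_le. ring.
    - unfold Ci, Copp, Cmult, RtoC; cbn [fst snd]. f_equal; ring. }
  rewrite <- !tech_pow_Rmult. assert (M0 := Cmod_ge_0 (0, - beta j th)%R).
  assert (Pl : Cmod (0, - beta j th)%R ^ length v <= 72 ^ length v).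
  { apply pow_incr. split; [exact M0|]. lra. }
  replace (72 * 72 ^ length v * kern j th)%R with ((72 * kern j th) * 72 ^ length v)%R by ring.
  apply Rmult_le_compat; auto. apply pow_le, M0.
Qed.

Lemma bnd_zero (g : nat -> R -> R) : bnd g (fun _ _ => 0).
Proof.
  exists 0%R, 0%nat. split; [lra|]. intros j th _. rewrite Cmod_0. simpl. lra.
Qed.

Lemma bnd_scal (g : nat -> R -> R) (c : C) (f : nat -> R -> C) :
  bnd g f -> bnd g (fun j th => c * f j th).
Proof.
  intros [M [k [HM H]]]. exists (Cmod c * M)%R, k. split.
  - apply Rmult_le_pos; [apply Cmod_ge_0|exact HM].
  - intros j th Hth. rewrite Cmod_mult, !Rmult_assoc, <- (Rmult_assoc M).
    apply Rmult_le_compat_l; [apply Cmod_ge_0|auto].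
Qed.

(** On words of length at most 1 the constant terms 1 of [ec] cancel in the commutator; on longer
    words only nonconstant coefficients of [ec] occur. *)
Lemma Bc_bnd : Nbnd kern Bc.
Proof.
  intros w. unfold Bc, ncadd, ncscal.
  destruct w as [|a [|b v]].
  - apply bnd_ext with (fun _ _ => RtoC 0); [|apply bnd_zero].
    intros j th. rewrite ncmul_let_l_nil, ncmul_let_r_nil. ring.
  - apply bnd_ext with (fun _ _ => RtoC 0); [|apply bnd_zero].
    intros j th. rewrite ncmul_let_l, ncmul_let_r_last. simpl.
    unfold ec. rewrite ncexp_nil. destruct a; simpl; ring.
  - apply bnd_plus; [apply kern_pos| |apply bnd_scal].
    + apply bnd_ext with (fun j th => if Bool.eqb (last (a :: b :: v) true) false
        then ec j th (a :: removelast (b :: v)) else 0).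
      { intros j th. rewrite ncmul_let_r_last. reflexivity. }
      destruct (Bool.eqb _ _); [apply ec_bnd|apply bnd_zero].
    + apply bnd_ext with (fun j th => if Bool.eqb a false then ec j th (b :: v) else 0).
      { intros j th. rewrite ncmul_let_l. reflexivity. }
      destruct (Bool.eqb _ _); [apply ec_bnd|apply bnd_zero].
Qed.

Lemma Nbnd_S (g : nat -> R -> R) (F : nat -> R -> ncs) :
  Nbnd g F -> Nbnd g (fun j th => ncS (F j th)).
Proof. intros H w. apply bnd_scal, H. Qed.

Lemma Nbnd_conj (g : nat -> R -> R) (F : nat -> R -> ncs) :
  Nbnd g F -> Nbnd g (fun j th => ncconj (F j th)).
Proof.
  intros H w. destruct (H w) as [M [k [HM HH]]]. exists M, k. split; [exact HM|].
  intros j th Hth. unfold ncconj. rewrite Cmod_conj. auto.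
Qed.

Lemma Nbnd_sg (g : nat -> R -> R) (F : nat -> R -> ncs) :
  (forall j th, 0 <= th <= PI -> 0 <= g j th) ->
  Nbnd g F -> Nbnd g (fun j th => sg (F j th)).
Proof.
  intros Hg H w. unfold sg. revert F H. induction w as [|a w IH]; intros F H; [apply H|].
  assert (K : forall b, bnd g (fun j th => sg_at w (lsh b (F j th)))).
  { intros b. apply (IH (fun j th => lsh b (F j th))). intros v. apply H. }
  destruct a.
  - apply bnd_ext with (fun j th => sg_at w (lsh true (F j th))
      + RtoC (-1) * sg_at w (lsh false (F j th))).
    { intros; simpl; ring. }
    apply bnd_plus; [exact Hg|apply K|apply bnd_scal, K].
  - apply bnd_ext with (fun j th => RtoC (-1) * sg_at w (lsh false (F j th))).
    { intros; simpl; ring. }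
    apply bnd_scal, K.
Qed.

(** The derivative is at most [kern] times a power of [lam], so integration over the half circle
    gives epsj times one power more. *)
Lemma Fc_increment (Phi : ncs) : NClim Jseq Phi ->
  forall w, Clim (fun j => Fc j PI w - Fc j 0 w) 0.
Proof.
  intros HJ w. assert (HG := Gc_bnd Phi HJ).
  assert (HR : Nbnd one2 Rc).
  { apply (Nbnd_S one2 (fun j th => ncconj (sg (Gc j th)))).
    apply (Nbnd_conj one2 (fun j th => sg (Gc j th))).
    apply (Nbnd_sg one2 Gc); [apply one2_pos|exact HG]. }
  assert (HF : bnd kern (fun j th => ncscal Ci (Rc j th ** (Bc j th ** Gc j th)) w)).
  { apply bnd_scal. assert (P1 := one2_pos). assert (P2 := kern_pos).
    eapply bnd_weaken; [|apply (Nbnd_mul one2 (fun j th => kern j th * one2 j th)%R Rc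
      (fun j th => Bc j th ** Gc j th)); auto].
    - intros j th _. unfold one2. lra.
    - intros j th Hth. apply Rmult_le_pos; auto.
    - apply (Nbnd_mul kern one2); auto using Bc_bnd. }
  destruct HF as [M [k [HM HF]]].
  apply (bnd_eps_lim (fun j _ => Fc j PI w - Fc j 0 w) 0 (proj1 PI_bounds)).
  exists (2 * M)%R, (S k). split; [lra|]. intros j th _. unfold eps2.
  set (B := (M * lam j ^ k * epsj j)%R).
  assert (He := epsj_bounds j). assert (L := lam_pow_ge_1 j k).
  assert (HB : 0 <= B) by (repeat apply Rmult_le_pos; lra).
  eapply Rle_trans.
  - apply (majorant_C (fun th => Fc j th w)
      (fun th => ncscal Ci (Rc j th ** (Bc j th ** Gc j th)) w)
      (fun t => B * ln (epsj j + t))%R (fun t => B / (epsj j + t))%R 0 PI).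
    + apply PI_bounds.
    + intros t _. apply NCder_Fc.
    + intros t Ht. apply Cder_ln_eps, Ht.
    + intros t Ht. eapply Rle_trans; [apply HF, Ht|]. unfold kern, B. apply Req_le.
      unfold Rdiv. ring.
  - assert (X := ln_eps_bound j PI (proj2 PI_bounds)).
    rewrite <- Rmult_minus_distr_l, <- tech_pow_Rmult.
    replace (2 * M * (lam j * lam j ^ k) * epsj j)%R with (2 * (B * lam j))%R
      by (unfold B; ring).
    apply Rmult_le_compat_l; [lra|]. apply Rmult_le_compat_l; lra.
Qed.

Lemma ncconj_Gc_0 (j : nat) : ncconj (Gc j 0) = Gc j 0.
Proof. unfold Gc. rewrite ncconj_Gsol. f_equal. apply Cconj_RtoC. Qed.

(** [sg] fixes X_true, so the diverging factor exp(-(j + 1) X_true) and its antipode cancel across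
    [ec], here exp(-i pi X_true), which commutes with them. *)
Lemma Fc_0 (j : nat) : Fc j 0 =
  ncS (sg (Jseq j)) ** ncexp true (0, - PI)%R ** Jseq j.
Proof.
  unfold Fc, Rc, ec. rewrite sg_conj, ncconj_Gc_0, beta_0, Gc_0.
  rewrite sg_mul, sg_exp_true, ncS_mul, ncS_exp, !ncmul_assoc.
  rewrite <- (ncmul_assoc _ _ (ncexp true (0, - PI)%R)), ncexp_comm, !ncmul_assoc.
  rewrite <- (ncmul_assoc _ _ (ncexp true (- RtoC (INR j + 1)))).
  rewrite ncexp_inv', ncmul_1_r. reflexivity.
Qed.

(** The endpoint u = - r is real, so the only non-real ingredient is log u = ln r + i pi. *)
Lemma Fc_PI (j : nat) : exists B, ncconj B = B /\
  Fc j PI = sg (ncexp false (0, PI)%R) ** B ** ncexp false (0, PI)%R.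
Proof.
  set (Q := Lser (RtoC (- rj j)) ** ncexp false (RtoC (lxj j))).
  assert (HQ : ncconj Q = Q).
  { unfold Q. rewrite ncconj_mul, ncconj_Lser, ncconj_exp, !Cconj_RtoC. reflexivity. }
  assert (EG : Gc j PI = Q ** ncexp false (0, PI)%R).
  { unfold Gc, Gsol, Q. rewrite <- ncmul_assoc, ncexp_add. f_equal; f_equal.
    - change (cexp (zc j PI)) with (uc j PI). rewrite uc_eq, cos_PI, sin_PI.
      unfold RtoC. f_equal; ring.
    - unfold zc, RtoC, Cplus; cbn [fst snd]. f_equal; ring. }
  exists (ncS (sg Q) ** Q). split.
  - rewrite ncconj_mul, ncconj_S, sg_conj, HQ. reflexivity.
  - unfold Fc, Rc, ec. rewrite beta_PI, EG.
    replace (0, - 0)%R with (RtoC 0) by (unfold RtoC; f_equal; ring).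
    rewrite ncexp_0, ncmul_1_l, sg_conj, ncconj_mul, HQ, ncconj_exp, sg_mul, ncS_mul.
    rewrite <- !sg_S, ncS_exp.
    replace (- Cconj (0, PI)%R) with (0, PI)%R.
    + rewrite !ncmul_assoc. reflexivity.
    + unfold Cconj, Copp; cbn [fst snd]. f_equal; ring.
Qed.

(* Both sides are complex conjugate: the relation says that the limit of [Fc j PI], conjugated to
   the base point [u = -1], is real. *)
Lemma half_circle_relation (Z : word -> C) : Zsh_spec Z ->
  let Phi := PhiKZ Z in let Psi := ncswap Phi in
  sg (ncexp false (0, - PI)%R) ** sg Psi ** ncexp true (0, - PI)%R ** Phi
    ** ncexp false (0, - PI)%R =
  sg (ncexp false (0, PI)%R) ** sg Psi ** ncexp true (0, PI)%R ** Phi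
    ** ncexp false (0, PI)%R.
Proof.
  intros HZ Phi Psi. assert (HJ := Jseq_lim Z HZ). fold Phi in HJ.
  assert (ES : ncS Phi = Psi).
  { unfold Psi, Phi. rewrite <- (PhiKZ_duality Z HZ) at 1. apply ncS_invol. }
  set (E := ncexp false (0, PI)%R). set (E' := ncexp false (0, - PI)%R).
  set (F0 := sg Psi ** ncexp true (0, - PI)%R ** Phi).
  assert (L0 : NClim (fun j => Fc j 0) F0).
  { apply (NClim_ext _ _ _ Fc_0). apply NClim_mul; [apply NClim_mul|exact HJ].
    - rewrite <- ES, sg_S. apply NClim_S, NClim_sg, HJ.
    - apply NClim_const. }
  assert (L1 : NClim (fun j => Fc j PI) F0).
  { intros w. apply Clim_ext with (fun j => (Fc j PI w - Fc j 0 w) + Fc j 0 w).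
    - intros; ring.
    - replace (F0 w) with (0 + F0 w) by ring. apply Clim_plus; [|apply L0].
      apply (Fc_increment Phi HJ). }
  assert (EE : E' ** E = ncone /\ E ** E' = ncone).
  { unfold E, E'. rewrite !ncexp_add, <- (ncexp_0 false).
    split; f_equal; unfold Cplus, RtoC; cbn [fst snd]; f_equal; ring. }
  destruct EE as [EE1 EE2].
  assert (sEE : sg E' ** sg E = ncone) by (rewrite <- sg_mul, EE1; apply sg_one).
  set (H := fun j => sg E' ** Fc j PI ** E').
  assert (Hreal : forall j, ncconj (H j) = H j).
  { intros j. unfold H. destruct (Fc_PI j) as [B [HB ->]]. fold E.
    rewrite !ncmul_assoc, sEE, ncmul_1_l, <- ncmul_assoc, EE2, ncmul_1_r. exact HB. }
  assert (LH : NClim H (sg E' ** F0 ** E')).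
  { apply NClim_mul; [apply NClim_mul|]; auto using NClim_const. }
  assert (LH' : NClim H (ncconj (sg E' ** F0 ** E'))).
  { apply (NClim_ext _ (fun j => ncconj (H j))); [intros; symmetry; apply Hreal|].
    apply NClim_conj, LH. }
  assert (R := NClim_unique _ _ _ LH LH').
  unfold F0 in R. rewrite !ncmul_assoc in R. rewrite R.
  rewrite !ncconj_mul, !sg_conj, !ncconj_exp.
  assert (EP : ncconj Phi = Phi) by apply (ncconj_PhiKZ Z HZ).
  unfold Psi. rewrite ncconj_swap, EP. unfold E'. rewrite ncconj_exp.
  replace (Cconj (0, - PI)%R) with (0, PI)%R; [reflexivity|].
  unfold Cconj; cbn [fst snd]. f_equal; ring.
Qed.

(** * Generating functions of star values *)

Lemma PhiRS_symmetry (Z : word -> C) : Zsh_spec Z ->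
  forall w, Cconj (sg (PhiRS Z) (map negb w)) = sg (PhiRS Z) w.
Proof.
  intros HZ. set (Phi := PhiKZ Z). set (Psi := ncswap Phi).
  assert (HR := half_circle_relation Z HZ). cbv zeta in HR. fold Phi Psi in HR.
  destruct (PhiKZ_swap_inverse Z HZ) as [I1 _]. fold Phi Psi in I1.
  assert (RP : ncconj Phi = Phi) by apply (ncconj_PhiKZ Z HZ).
  set (E := ncexp false (0, PI)%R) in *. set (E' := ncexp false (0, - PI)%R) in *.
  set (T := ncexp true (0, PI)%R) in *. set (T' := ncexp true (0, - PI)%R) in *.
  assert (X : forall b, ncexp b (0, PI)%R ** ncexp b (0, - PI)%R = ncone).
  { intros b. rewrite ncexp_add, <- (ncexp_0 b). f_equal.
    unfold Cplus, RtoC; cbn [fst snd]. f_equal; ring. }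
  assert (X' : forall b, ncexp b (0, - PI)%R ** ncexp b (0, PI)%R = ncone).
  { intros b. rewrite ncexp_comm. apply X. }
  assert (EE : E ** E' = ncone) by apply X. assert (E'E : E' ** E = ncone) by apply X'.
  assert (TT : T ** T' = ncone) by apply X. assert (T'T : T' ** T = ncone) by apply X'.
  assert (sEE : sg E' ** sg E = ncone) by (rewrite <- sg_mul, E'E; apply sg_one).
  assert (sI : sg Phi ** sg Psi = ncone) by (rewrite <- sg_mul, I1; apply sg_one).
  (* With the half circles multiplied out, the full loop Phi exp(2 pi i X_false) Psi appears on one
     side and its conjugate under [sg] on the other. *)
  assert (HR2 : T ** Phi ** (E ** E) ** Psi = sg Phi ** sg (E' ** E') ** sg Psi ** T').
  { apply (f_equal (fun F => sg Phi ** sg E' ** F ** E ** Psi)) in HR.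
    rewrite !ncmul_assoc in HR.
    rewrite <- (ncmul_assoc (sg Phi) (sg E') (sg E)), sEE, ncmul_1_r, sI, ncmul_1_l in HR.
    rewrite <- (ncmul_assoc _ E' E), E'E, ncmul_1_r in HR.
    rewrite <- (ncmul_assoc _ Phi Psi), I1, ncmul_1_r in HR.
    rewrite sg_mul, !ncmul_assoc. symmetry. exact HR. }
  set (h := (0, PI / 2)%R : C). set (h' := (0, - (PI / 2))%R : C).
  (* [PhiRS] with its letters exchanged, as the coordinate u = 1 - z demands. *)
  set (FY := ncexp true h ** (Phi ** ((E ** E) ** (Psi ** ncexp true h)))).
  assert (HFY : ncswap (PhiRS Z) = FY).
  { unfold PhiRS. rewrite !ncswap_mul, !ncswap_exp. simpl negb.
    change (ncswap (PhiKZ_swap Z)) with (ncswap (ncswap Phi)). rewrite ncswap_invol.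
    fold Phi Psi. unfold FY, E. rewrite ncexp_add.
    replace (piC * Ci / 2) with h.
    2:{ unfold h, piC, Ci, RtoC, Cdiv, Cmult, Cinv; cbn [fst snd]. f_equal; field. }
    replace (2 * (piC * Ci)) with ((0, PI)%R + (0, PI)%R).
    2:{ unfold piC, Ci, RtoC, Cplus, Cmult; cbn [fst snd]. f_equal; ring. }
    reflexivity. }
  assert (HFYc : ncconj (sg FY) = FY).
  (* Conjugation turns the exponent i pi/2 into - i pi/2, and a factor T on either side restores it;
     this explains the half exponents in [PhiRS]. *)
  { assert (H1 : ncexp true h' ** T = ncexp true h).
    { unfold T. rewrite ncexp_add. f_equal. unfold h, h', Cplus; cbn [fst snd]. f_equal; field. }
    assert (H2 : T ** ncexp true h' = ncexp true h).
    { unfold T. rewrite ncexp_comm. exact H1. }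
    assert (C1 : ncconj (ncexp true h) = ncexp true h') by apply ncconj_exp.
    assert (C2 : ncconj E = E') by apply ncconj_exp.
    unfold FY. rewrite !sg_mul, sg_exp_true, !ncconj_mul, C1, !sg_conj, C2.
    rewrite RP. replace (ncconj Psi) with Psi by (unfold Psi; rewrite ncconj_swap, RP; reflexivity).
    rewrite <- sg_mul.
    transitivity (ncexp true h' ** (T ** Phi ** (E ** E) ** Psi ** T) ** ncexp true h').
    - rewrite HR2. rewrite <- (ncmul_assoc _ T' T), T'T, ncmul_1_r, !ncmul_assoc. reflexivity.
    - rewrite <- (ncmul_assoc _ _ (ncexp true h')). rewrite <- (ncmul_assoc _ T), H2.
      rewrite !ncmul_assoc, H1. reflexivity. }
  intros w.
  (* The symmetry known for the swapped [PhiRS] is carried over to [sg] of [PhiRS] by the braid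
     relation. *)
  enough (R : ncconj (ncswap (sg (PhiRS Z))) = sg (PhiRS Z)).
  { exact (f_equal (fun F : ncs => F w) R). }
  rewrite <- (ncswap_invol (PhiRS Z)), HFY.
  rewrite <- sg_swap_sg, sg_conj, ncconj_swap, HFYc. reflexivity.
Qed.

(** * Star values as pairings with substituted words *)

Lemma sg_prefix (F : ncs) (p : nat) (w : word) :
  sg F (repeat false p ++ w) = RtoC (-1) ^ p * sg (fun v => F (repeat false p ++ v)) w.
Proof.
  revert F; induction p as [|p IH]; intros F.
  - simpl. change (fun v => F v) with F. ring.
  - cbn [repeat app Cpow]. change (sg F (false :: repeat false p ++ w)) with
      (- sg (lsh false F) (repeat false p ++ w)).
    rewrite IH. unfold lsh. ring.
Qed.

(** The sign cancels the one from the expansion of (1 + e_0 t)^(-1), as that of [sg_prefix] does for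
    s. *)
Lemma sg_suffix (F : ncs) (q : nat) (w : word) :
  sg F (w ++ repeat false q) = RtoC (-1) ^ q * sg (fun v => F (v ++ repeat false q)) w.
Proof.
  revert F; induction q as [|q IH]; intros F.
  - cbn [repeat Cpow]. rewrite app_nil_r.
    replace (fun v : word => F (v ++ [])%list) with F; [ring|].
    apply functional_extensionality; intros v. rewrite app_nil_r. reflexivity.
  - cbn [repeat Cpow]. rewrite (repeat_cons q false), app_assoc, sg_snoc, IH.
    replace (fun v : word => F (v ++ repeat false q ++ [false])%list) with
      (fun v : word => rsh false F (v ++ repeat false q)); [ring|].
    apply functional_extensionality; intros v. unfold rsh. rewrite app_assoc. reflexivity.
Qed.

(* [e_1 = phi(e_1) - phi(e_0)] for the substitution [phi] dual to [sg], on both sides of [w]. *)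
Lemma sg_frame (F : ncs) (p q : nat) (w : word) :
  RtoC (-1) ^ (p + q) *
    sg (fun v => F (repeat false p ++ [true] ++ v ++ [true] ++ repeat false q))%list w =
  (sg F (repeat false p ++ true :: w ++ true :: repeat false q)
   - sg F (repeat false p ++ false :: w ++ true :: repeat false q))
  - (sg F (repeat false p ++ true :: w ++ false :: repeat false q)
   - sg F (repeat false p ++ false :: w ++ false :: repeat false q)).
Proof.
  assert (A : forall F w, sg (lsh true F) w = sg F (true :: w) - sg F (false :: w)).
  { intros G v. unfold sg; simpl. ring. }
  assert (B : forall F w, sg (rsh true F) w = sg F (w ++ [true]) - sg F (w ++ [false])).
  { intros G v. rewrite !sg_snoc. ring. }
  set (G := fun v => F (repeat false p ++ v)%list).
  set (K := fun v => G (v ++ repeat false q)%list).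
  replace (fun v : word => F (repeat false p ++ [true] ++ v ++ [true] ++ repeat false q))%list with
    (lsh true (rsh true K)).
  2:{ apply functional_extensionality; intros v. unfold lsh, rsh, K, G.
      rewrite <- app_assoc. reflexivity. }
  assert (S1 : forall v b, sg F (repeat false p ++ v ++ b :: repeat false q) =
    RtoC (-1) ^ (p + q) * sg K (v ++ [b])).
  { intros v b. rewrite sg_prefix.
    change (b :: repeat false q) with ([b] ++ repeat false q)%list.
    rewrite (app_assoc v), sg_suffix, Cpow_add_r. apply (Cmult_assoc _ _ (sg K _)). }
  assert (S2 : forall c b, sg F (repeat false p ++ c :: w ++ b :: repeat false q) =
    RtoC (-1) ^ (p + q) * sg K ((c :: w) ++ [b])) by (intros c b; apply (S1 (c :: w) b)).
  rewrite !S2, A, !B. ring.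
Qed.

Lemma coarsenings_index (k : list nat) : is_index k -> k <> [] ->
  forall l, In l (coarsenings k) -> exists l1 l', l = l1 :: l' /\ (1 <= l1)%nat.
Proof.
  induction k as [|k1 r IH]; intros Hk Hne l Hl; [contradiction Hne; reflexivity|].
  inversion Hk as [|? ? H1 Hr]; subst.
  destruct r as [|r1 r].
  - destruct Hl as [<-|[]]. eauto.
  - change (coarsenings (k1 :: r1 :: r)) with (flat_map (fun l => match l with
      | nil => nil
      | l1 :: l' => (k1 :: l) :: ((k1 + l1)%nat :: l') :: nil
      end) (coarsenings (r1 :: r))) in Hl.
    apply in_flat_map in Hl. destruct Hl as [l0 [H0 Hl]].
    destruct l0 as [|l1 l']; [destruct Hl|].
    destruct Hl as [<-|[<-|[]]]; eexists; eexists; split; try reflexivity; lia.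
Qed.

Lemma csum_flat_map {A B : Type} (f : B -> C) (g : A -> list B) (l : list A) :
  csum (map f (flat_map g l)) = csum (map (fun x => csum (map f (g x))) l).
Proof.
  induction l as [|x l IH]; simpl; [reflexivity|]. rewrite map_app, csum_app, IH. reflexivity.
Qed.

Lemma omega_cons (k1 : nat) (r : list nat) : omega (k1 :: r) = (repeat false (k1 - 1) ++ ek r)%list.
Proof. reflexivity. Qed.

Lemma ek_omega (k : list nat) : k <> [] -> ek k = true :: omega k.
Proof. destruct k; [intros H; contradiction H; reflexivity|reflexivity]. Qed.

(** The sign (-1)^(wt + dep) counts the letters e_0 of [omega l]. A comma of k either stays, giving
    e_1, or becomes a plus, giving - e_0, so the sum over coarsenings expands a product of factors
    e_1 - e_0 and - e_0. *)
Lemma star_sum (F : ncs) (k : list nat) : is_index k -> k <> [] ->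
  csum (map (fun l => RtoC (-1) ^ (wt l + dep l) * F (omega l)) (coarsenings k))
  = sg F (omega k).
Proof.
  revert F; induction k as [|k1 r IH]; intros F Hk Hne; [contradiction Hne; reflexivity|].
  inversion Hk as [|? ? H1 Hr]; subst.
  destruct k1 as [|m]; [lia|].
  assert (Sg : forall n, RtoC (-1) ^ (S (S n)) = RtoC (-1) ^ n).
  { intros n. cbn [Cpow]. ring. }
  destruct r as [|r1 r].
  - cbn [coarsenings map csum]. rewrite omega_cons. simpl ek.
    replace (S m - 1)%nat with m by lia. rewrite sg_prefix.
    unfold wt, dep. simpl fold_right. simpl length.
    replace (S (m + 0) + 1)%nat with (S (S m)) by lia. rewrite Sg.
    unfold sg. cbn [sg_at]. rewrite Cplus_0_r. reflexivity.
  - assert (Hr' : r1 :: r <> []) by discriminate.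
    change (coarsenings (S m :: r1 :: r)) with (flat_map (fun l => match l with
      | nil => nil
      | l1 :: l' => (S m :: l) :: ((S m + l1)%nat :: l') :: nil
      end) (coarsenings (r1 :: r))).
    rewrite csum_flat_map.
    (* The letter b is the first comma of k: true if it is kept, false if it becomes a plus. *)
    set (G := fun (b : bool) (w : word) => F (repeat false m ++ b :: w)%list).
    rewrite (csum_ext _ (fun l => RtoC (-1) ^ m *
      (RtoC (-1) ^ (wt l + dep l) * (ncadd (G true) (ncscal (-1) (G false))) (omega l)))).
    + rewrite csum_scal, IH by assumption. rewrite (omega_cons (S m)), (ek_omega _ Hr').
      simpl (S m - 1)%nat. rewrite Nat.sub_0_r, sg_prefix. f_equal.
      rewrite sg_add, sg_scal. unfold ncadd, ncscal.
      change (sg (fun v => F (repeat false m ++ v)%list) (true :: omega (r1 :: r))) with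
        (sg (G true) (omega (r1 :: r)) - sg (G false) (omega (r1 :: r))). ring.
    + intros l Hl. destruct (coarsenings_index _ Hr Hr' l Hl) as [l1 [l' [-> Hl1]]].
      cbn [map csum]. rewrite !omega_cons. rewrite (ek_omega (l1 :: l')) by discriminate.
      rewrite omega_cons. unfold ncadd, ncscal, G.
      replace (S m - 1)%nat with m by lia.
      replace (S m + l1 - 1)%nat with (m + S (l1 - 1))%nat by lia.
      rewrite (repeat_app false m), <- app_assoc. cbn [repeat app].
      unfold wt, dep. cbn [fold_right length]. fold (wt l').
      set (n := wt l') in *. set (d := length l') in *.
      replace (S m + (l1 + n) + S (S d))%nat with (S (S (m + (l1 + n + S d)))) by lia.
      replace (S m + l1 + n + S d)%nat with (S (m + (l1 + n + S d))) by lia.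
      rewrite Sg. cbn [Cpow]. rewrite Cpow_add_r. ring.
Qed.

Lemma ek_repeat_1 (m : nat) : ek (repeat 1%nat m) = repeat true m.
Proof. induction m as [|m IH]; [reflexivity|]. simpl. rewrite IH. reflexivity. Qed.

(** [omega] drops an initial e_1; as the padding consists of letters e_1, it may be taken to be the
    one of k. *)
Lemma omega_padded (k : list nat) (m n : nat) : k <> [] ->
  omega (repeat 1%nat m ++ k ++ repeat 1%nat n) = (repeat true m ++ omega k ++ repeat true n)%list.
Proof.
  intros Hne. unfold omega at 1. rewrite !ek_app, !ek_repeat_1, (ek_omega k Hne).
  destruct m as [|m]; [reflexivity|]. cbn [repeat app tl].
  change (true :: omega k ++ repeat true n)%list with ([true] ++ (omega k ++ repeat true n))%list.
  rewrite app_assoc, <- repeat_cons. reflexivity.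
Qed.

Lemma csum_telescope (g : nat -> C) (n : nat) :
  csum (map (fun m => g (S m) - g m) (seq 0 n)) = g n - g 0%nat.
Proof.
  induction n as [|n IH]; [simpl; ring|].
  rewrite seq_S, map_app, csum_app, IH. simpl. ring.
Qed.

Definition prefactor : C := / (RtoC 2 * (piC * Ci)).

Lemma zRS_star_formula (Z : word -> C) (k : list nat) (p q : nat) : is_index k -> k <> [] ->
  zRS_star Z k p q = prefactor * (RtoC (-1) ^ (p + q) *
    sg (fun v => PhiRS Z (repeat false p ++ [true] ++ v ++ [true] ++ repeat false q))%list
      (omega k)).
Proof.
  intros Hk Hne. unfold zRS_star.
  rewrite <- (star_sum _ k Hk Hne), <- !csum_scal.
  apply csum_ext. intros l Hl. destruct (coarsenings_index k Hk Hne l Hl) as [l1 [l' [-> _]]].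
  unfold zRS, prefactor, Cdiv. cbv zeta. ring.
Qed.

Lemma is_index_padded (k : list nat) (m n : nat) : is_index k ->
  is_index (repeat 1%nat m ++ k ++ repeat 1%nat n).
Proof.
  intros Hk. assert (R : forall m, is_index (repeat 1%nat m)).
  { intros i; induction i; simpl; constructor; auto. }
  apply Forall_app. split; [apply R|]. apply Forall_app. split; [exact Hk|apply R].
Qed.

(** By [sg_frame] each term is a mixed second difference in (m, n), so the double sum telescopes to
    its four corners. *)
Lemma gen2_star_formula (Z : word -> C) (k : list nat) (a b : nat) : is_index k -> k <> [] ->
  let h := fun x y => sg (PhiRS Z) (repeat x (S a) ++ omega k ++ repeat y (S b))%list in
  gen2 (fun m n => zRS_star Z (repeat 1%nat m ++ k ++ repeat 1%nat n)) a b =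
  prefactor * ((h true true - h false true) - (h true false - h false false)).
Proof.
  intros Hk Hne h. unfold gen2.
  rewrite <- (map_id (flat_map _ _)), csum_flat_map.
  (* The paddings have constant lengths a + 1 and b + 1, with m and n letters e_1 next to
     [omega k]. *)
  set (W := fun m n => sg (PhiRS Z) (repeat false (S a - m) ++ repeat true m ++ omega k
    ++ repeat true n ++ repeat false (S b - n))%list).
  rewrite (csum_ext _ (fun m => prefactor *
    ((W (S m) (S b) - W (S m) 0%nat) - (W m (S b) - W m 0%nat)))).
  - rewrite csum_scal, (csum_telescope (fun m => W m (S b) - W m 0%nat)). f_equal.
    assert (E1 : forall x, W (S a) x = sg (PhiRS Z) (repeat true (S a) ++ omega k
      ++ repeat true x ++ repeat false (S b - x))%list).
    { intros x. unfold W. rewrite Nat.sub_diag. reflexivity. }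
    assert (E0 : forall x, W 0%nat x = sg (PhiRS Z) (repeat false (S a) ++ omega k
      ++ repeat true x ++ repeat false (S b - x))%list) by reflexivity.
    rewrite !E1, !E0, Nat.sub_diag, Nat.sub_0_r. simpl (repeat false 0). simpl (repeat true 0).
    rewrite app_nil_r. cbn [app]. unfold h. ring.
  - intros m Hm. apply in_seq in Hm. rewrite map_map.
    set (V := fun n => W (S m) n - W m n).
    rewrite (csum_ext _ (fun n => prefactor * (V (S n) - V n))).
    + rewrite csum_scal, csum_telescope. unfold V. ring.
    + intros n Hn. apply in_seq in Hn.
      rewrite zRS_star_formula.
      * rewrite sg_frame, omega_padded by exact Hne. unfold V, W.
        replace (S a - m)%nat with (S (a - m)) by lia.
        replace (S b - n)%nat with (S (b - n)) by lia.
        replace (S a - S m)%nat with (a - m)%nat by lia.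
        replace (S b - S n)%nat with (b - n)%nat by lia.
        assert (P : forall c i (v : word), (repeat c i ++ c :: v = c :: repeat c i ++ v)%list).
        { intros c i v. rewrite app_comm_cons, (repeat_cons i c), <- app_assoc. reflexivity. }
        cbn [repeat app]. rewrite <- !app_assoc, !P. cbn [repeat app]. ring.
      * apply is_index_padded, Hk.
      * intros E. apply app_eq_nil in E. destruct E as [_ E]. apply app_eq_nil in E.
        destruct E as [E _]. exact (Hne E).
Qed.

(** Plus signs and commas are the letters e_0 and e_1 of [omega], so that the dual index amounts to
    an exchange of letters. *)
Lemma seps_omega (k : list nat) : seps k = omega k.
Proof.
  induction k as [|k1 r IH]; [reflexivity|]. rewrite omega_cons. cbn [seps].
  destruct r as [|r1 r]; [reflexivity|]. rewrite IH, <- ek_omega by discriminate. reflexivity.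
Qed.

(** The counter c stands for c - 1 plus signs already read in the current block. *)
Lemma build_spec (s : list bool) (c : nat) : (1 <= c)%nat ->
  build c s <> [] /\ is_index (build c s) /\ omega (build c s) = (repeat false (c - 1) ++ s)%list.
Proof.
  revert c; induction s as [|[] s IH]; intros c Hc; cbn [build].
  - repeat split; [discriminate|repeat constructor; exact Hc].
  - destruct (IH 1%nat) as [N [I E]]; [lia|]. repeat split; [discriminate|constructor; auto|].
    rewrite omega_cons, (ek_omega _ N), E. reflexivity.
  - destruct (IH (S c)) as [N [I E]]; [lia|]. repeat split; [exact N|exact I|].
    rewrite E. replace (S c - 1)%nat with (S (c - 1)) by lia.
    cbn [repeat]. rewrite repeat_cons, <- app_assoc. reflexivity.
Qed.

Lemma dual_spec (k : list nat) :
  dual k <> [] /\ is_index (dual k) /\ omega (dual k) = map negb (omega k).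
Proof.
  unfold dual. rewrite seps_omega. destruct (build_spec (map negb (omega k)) 1) as [N [I E]].
  - lia.
  - repeat split; assumption.
Qed.

Lemma gen2_conj (f : nat -> nat -> ps2) (a b : nat) :
  gen2 (fun m n => conj2 (f m n)) a b = Cconj (gen2 f a b).
Proof.
  unfold gen2. rewrite Cconj_csum. f_equal.
  induction (seq 0 (S a)) as [|m l IH]; cbn [flat_map map]; [reflexivity|].
  rewrite map_app, IH, map_map. reflexivity.
Qed.

(** The source of the minus sign in the theorem. *)
Lemma prefactor_conj : Cconj prefactor = - prefactor.
Proof.
  assert (H := PI_RGT_0). unfold prefactor, piC.
  replace (2 * (PI * Ci)) with (0, 2 * PI)%R.
  - unfold Cconj, Cinv, Copp; cbn [fst snd]. f_equal; field; lra.
  - unfold Ci, Cmult, RtoC; cbn [fst snd]. f_equal; ring.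
Qed.

Theorem theorem5p5 (Z : word -> C) (HZ : Zsh_spec Z)
  (k : list nat) (Hk : is_index k) (Hne : k <> nil) :
  gen2 (fun m n => zRS_star Z (repeat 1%nat m ++ k ++ repeat 1%nat n))
  = opp2 (gen2 (fun m n => conj2 (zRS_star Z (repeat 1%nat m ++ dual k ++ repeat 1%nat n)))).
Proof.
  apply functional_extensionality; intros a. apply functional_extensionality; intros b.
  destruct (dual_spec k) as [Nd [Id Ed]].
  unfold opp2. rewrite gen2_conj, !gen2_star_formula by assumption. cbv zeta. rewrite Ed.
  set (h := fun x y => sg (PhiRS Z) (repeat x (S a) ++ omega k ++ repeat y (S b))%list).
  (* Exchanging all letters, padding included, amounts to conjugation; the four corners are permuted
     with their signs preserved. *)
  assert (S : forall x y, Cconj (sg (PhiRS Z)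
    (repeat x (S a) ++ map negb (omega k) ++ repeat y (S b))%list) = h (negb x) (negb y)).
  { intros x y. unfold h. rewrite <- (PhiRS_symmetry Z HZ (repeat (negb x) (S a) ++ _)).
    rewrite !map_app, !map_repeat, !Bool.negb_involutive. reflexivity. }
  rewrite Cmult_conj, !Cminus_conj, !S, prefactor_conj. simpl negb.
  change (prefactor * (h true true - h false true - (h true false - h false false)) =
    - (- prefactor * (h false false - h true false - (h false true - h true true)))).
  ring.
Qed.
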